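(* Let $G$ be an abelian Polish pro-Lie group. The following assertions are equivalent: (1) $G$ is an injective object in $\mathbf{proLiePAb}$; (2) $G$ is isomorphic to $\mathbb{R}^{\alpha }\oplus \mathbb{T}^{\beta }$ for some $\alpha ,\beta \in \omega +1$; (3) $G$ is path-connected; (4) $\mathrm{Ext}( \mathbb{T},G) =0$.
   Context: A Polish abelian group is an abelian topological group whose topology is Polish. An abelian Polish Lie group is a Polish abelian group isomorphic to $\mathbb{R}^{n}\oplus \mathbb{T}^{d}\oplus D$ with $n,d\in\omega$ and $D$ countable discrete. A Polish abelian group $G$ is pro-Lie if every neighborhood of $0$ in $G$ contains a closed subgroup $N$ such that $G/N$ is a Lie group. $\mathbf{proLiePAb}$ is the category of pro-Lie Polish abelian groups and continuous homomorphisms. Its short exact sequences are the sequences $0\to A\to B\to C\to 0$ of continuous homomorphisms that are algebraically exact with $A\to B$ a homeomorphism onto a closed subgroup. An object $I$ is injective if $\mathrm{Hom}(-,I)$ maps short exact sequences to short exact sequences of abelian groups. $\mathrm{Ext}(A,B)$ is the group of isomorphism classes of extensions $0\to B\to X\to A\to 0$ in $\mathbf{proLiePAb}$ (with Baer sum), so $\mathrm{Ext}(A,B)=0$ means that every such short exact sequence splits via continuous homomorphisms. $\mathbb{T}=\mathbb{R}/\mathbb{Z}$, and powers carry the product topology. *)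

(* Defs.v *)
From HB Require Import structures.
From mathcomp Require Import all_boot all_order all_algebra.
From mathcomp Require Import all_classical all_reals all_analysis.
From mathcomp Require Import ring_quotient.

Set Implicit Arguments.
Unset Strict Implicit.
Unset Printing Implicit Defensive.

Import Order.TTheory GRing.Theory Num.Theory.
Import numFieldNormedType.Exports.

Local Open Scope classical_set_scope.
Local Open Scope ring_scope.
Local Open Scope quotient_scope.

(* An alias of the product: on [G * H] itself, the library only declares the
   [topologicalZmodType] structure when [G] and [H] are topological vector
   spaces. *)
Definition dsum (G H : Type) : Type := (G * H)%type.

Section DirectSum.
Context (G H : topologicalZmodType).

HB.instance Definition _ := Topological.copy (dsum G H) (G * H)%type.
HB.instance Definition _ := GRing.Zmodule.copy (dsum G H) (G * H)%type.

Let dsum_sub_continuous :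
  continuous (fun x : dsum G H * dsum G H => x.1 - x.2).
Proof.
rewrite [X in continuous X](_ : _ =
  (fun x : (G * H) * (G * H) => (x.1.1 - x.2.1, x.1.2 - x.2.2))) //.
move=> [[x1 x2] [y1 y2]]; apply: cvg_pair.
- apply: (@cvg_comp _ _ _ (fun x : (G * H) * (G * H) => (x.1.1, x.2.1))
    (fun z : G * G => z.1 - z.2) _ (nbhs (x1, y1))).
    apply: cvg_pair.
      by apply: (@cvg_comp _ _ _ fst fst _ (nbhs (x1, x2)));
        [exact: cvg_fst|exact: cvg_fst].
    by apply: (@cvg_comp _ _ _ snd fst _ (nbhs (y1, y2)));
      [exact: cvg_snd|exact: cvg_fst].
  exact: (@sub_continuous G (x1, y1)).
- apply: (@cvg_comp _ _ _ (fun x : (G * H) * (G * H) => (x.1.2, x.2.2))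
    (fun z : H * H => z.1 - z.2) _ (nbhs (x2, y2))).
    apply: cvg_pair.
      by apply: (@cvg_comp _ _ _ fst snd _ (nbhs (x1, x2)));
        [exact: cvg_fst|exact: cvg_snd].
    by apply: (@cvg_comp _ _ _ snd snd _ (nbhs (y1, y2)));
      [exact: cvg_snd|exact: cvg_snd].
  exact: (@sub_continuous H (x2, y2)).
Qed.

HB.instance Definition _ :=
  PreTopologicalNmodule_isTopologicalZmodule.Build (dsum G H)
    dsum_sub_continuous.

End DirectSum.

Definition power (I G : Type) : Type := {ptws I -> G}.

Section Power.
Context (I : Type) (G : topologicalZmodType).

HB.instance Definition _ := Topological.copy (power I G) {ptws I -> G}.
HB.instance Definition _ := GRing.Zmodule.copy (power I G) (I -> G).

Let power_sub_continuous :
  continuous (fun x : power I G * power I G => x.1 - x.2).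
Proof.
move=> [x y]; apply/cvg_sup => i.
pose ev (f : power I G) : G := f i.
have ev_cvg (f : power I G) : ev g @[g --> f] --> nbhs (ev f).
  have /cvg_sup/(_ i) fi : nbhs f --> f by exact: cvg_id.
  move=> U Uf; apply: fi.
  exact: (@initial_continuous _ G (fun g : forall i : I, G => g i) f U).
suff sub_cvg : ev (z.1 - z.2) @[z --> (x, y)] --> nbhs (ev (x - y)).
  move=> U; rewrite nbhsE => -[_ [[V oV <-] Vxy] VU].
  by apply: filterS VU _; apply: sub_cvg; exact: open_nbhs_nbhs.
apply: (@cvg_comp _ _ _ (fun z : power I G * power I G => (ev z.1, ev z.2))
  (fun w : G * G => w.1 - w.2) _ (nbhs (ev x, ev y))).
  apply: cvg_pair.
    by apply: (@cvg_comp _ _ _ fst ev _ (nbhs x)); [exact: cvg_fst|exact: ev_cvg].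
  by apply: (@cvg_comp _ _ _ snd ev _ (nbhs y)); [exact: cvg_snd|exact: ev_cvg].
exact: (@sub_continuous G (ev x, ev y)).
Qed.

HB.instance Definition _ :=
  PreTopologicalNmodule_isTopologicalZmodule.Build (power I G)
    power_sub_continuous.

End Power.

Definition quotient_group (G : topologicalZmodType) (N : zmodClosed G) : Type :=
  quotient_topology (Quotient.quot N).

Section QuotientGroup.
Context (G : topologicalZmodType) (N : zmodClosed G).
Local Notation Q := (quotient_group N).

HB.instance Definition _ := Topological.on Q.
HB.instance Definition _ := GRing.isZmodule.Build Q
  (@Quotient.addqA G N) (@Quotient.addqC G N)
  (@Quotient.add0q G N) (@Quotient.addNq G N).

Let piB : {morph (\pi_Q : G -> Q) : x y / x - y >-> x - y}.
Proof.
move=> x y; apply: etrans (Quotient.pi_add N x (- y)) _.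
exact: (congr1 (Quotient.add (\pi x))) (Quotient.pi_opp N y).
Qed.

Let eq_pi (x y : G) : (\pi_Q x = \pi_Q y) <-> (x - y \in N).
Proof.
rewrite (Quotient.idealrBE N x y).
by split=> [xy|/eqP//]; apply/eqP.
Qed.

Let pi_open (A : set G) : open A -> open ((\pi_Q : G -> Q) @` A).
Proof.
move=> oA; rewrite /open /= /quotient_open.
rewrite (_ : _ @^-1` _ = \bigcup_(n in [set n | n \in N])
    ((fun x => x - n) @^-1` A)); last first.
  rewrite eqEsubset; split=> x /=.
    move=> [a Aa] /esym/eq_pi axN.
    by exists (x - a) => //=; rewrite opprB addrCA subrr addr0.
  move=> [n /= nN An]; exists (x - n) => //; apply/eq_pi.
  by rewrite addrAC subrr add0r rpredN.
apply: bigcup_open => n _; apply: open_comp => // x _.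
apply: (@cvg_comp _ _ _ (fun x : G => (x, n)) (fun w : G * G => w.1 - w.2) _
  (nbhs (x, n))); last exact: (@sub_continuous G (x, n)).
by apply: cvg_pair; [exact: cvg_id|exact: cvg_cst].
Qed.

Let quotient_sub_continuous : continuous (fun x : Q * Q => x.1 - x.2).
Proof.
move=> [x y]; rewrite -[x]reprK -[y]reprK /=.
set a := repr x; set b := repr y => U; rewrite -piB => Uab.
have /sub_continuous[[A B] /= [Aa Bb] ABU] :
  nbhs ((a, b).1 - (a, b).2) (\pi_Q @^-1` U).
  exact: (@pi_continuous _ _ (a - b) U Uab).
exists ((\pi_Q : G -> Q) @` A°, (\pi_Q : G -> Q) @` B°) => /=.
  split; apply: open_nbhs_nbhs.
    by split; [apply: pi_open; exact: open_interior|exists a].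
  by split; [apply: pi_open; exact: open_interior|exists b].
move=> [_ _] [/= [c /interior_subset Ac <-] [d /interior_subset Bd <-]].
by rewrite -piB; exact: (ABU (c, d)).
Qed.

HB.instance Definition _ :=
  PreTopologicalNmodule_isTopologicalZmodule.Build Q quotient_sub_continuous.

End QuotientGroup.

Definition int_pred (R : realType) : {pred R} := [pred x | x \is a Num.int].

Fact int_pred_zmod_closed (R : realType) : zmod_closed (@int_pred R).
Proof. by split=> [|x y xZ yZ]; rewrite inE ?rpred0 ?rpredB. Qed.

HB.instance Definition _ (R : realType) :=
  GRing.isZmodClosed.Build R (@int_pred R) (@int_pred_zmod_closed R).

Definition circle (R : realType) : topologicalZmodType :=
  quotient_group (@int_pred R : zmodClosed R).

(* The von Neumann ordinals [alpha <= omega], with [Some n] for [n] and [None]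
   for [omega]; [ordinal_le_omega alpha] is the set of elements of [alpha]. *)
Definition ordinal_le_omega (alpha : option nat) : Type :=
  if alpha is Some n then 'I_n else nat.

Definition chom_pred (A B : topologicalZmodType) : {pred (A -> B)} :=
  [pred f | `[< zmod_morphism f /\ continuous f >]].

Record chom (A B : topologicalZmodType) := CHom {
  chom_fun :> A -> B;
  chom_funP : chom_fun \in @chom_pred A B
}.

Section ChomZmodule.
Context (A B : topologicalZmodType).

Fact chom_pred_zmod_closed : zmod_closed (@chom_pred A B).
Proof.
split=> [|f g]; rewrite !inE.
  by split=> [x y|x]; [rewrite subr0|exact: cvg_cst].
move=> [fB fc] [gB gc]; split=> [x y|x].
  change (f (x - y) - g (x - y) = f x - g x - (f y - g y)).
  by rewrite fB gB !opprD !opprK addrACA.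
apply: (@cvg_comp _ _ _ (fun x => (f x, g x)) (fun w : B * B => w.1 - w.2) _
  (nbhs (f x, g x))); last exact: (@sub_continuous B (f x, g x)).
by apply: cvg_pair; [exact: fc|exact: gc].
Qed.

HB.instance Definition _ :=
  GRing.isZmodClosed.Build (A -> B) (@chom_pred A B) chom_pred_zmod_closed.
HB.instance Definition _ := [isSub for @chom_fun A B].
HB.instance Definition _ := [Choice of chom A B by <:].
HB.instance Definition _ := [SubChoice_isSubZmodule of chom A B by <:].

Fact chom_zmod_morphism (f : chom A B) : zmod_morphism f.
Proof. by case: f => f /= /asboolP[]. Qed.

HB.instance Definition _ (f : chom A B) :=
  GRing.isZmodMorphism.Build A B (chom_fun f) (chom_zmod_morphism f).

Fact chom_continuous (f : chom A B) : continuous f.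
Proof. by case: f => f /= /asboolP[]. Qed.

End ChomZmodule.

Section Precomposition.
Context (A B I : topologicalZmodType) (f : chom A B).

Fact precomp_subproof (h : chom B I) : h \o f \in @chom_pred A I.
Proof.
apply/asboolP; split=> [x y|x]; first by rewrite /= !raddfB.
by apply: continuous_comp; exact: chom_continuous.
Qed.

Definition precomp (h : chom B I) : chom A I := CHom (precomp_subproof h).

Fact precomp_zmod_morphism : zmod_morphism precomp.
Proof. by move=> h k; apply: val_inj. Qed.

HB.instance Definition _ :=
  GRing.isZmodMorphism.Build (chom B I) (chom A I) precomp
    precomp_zmod_morphism.

End Precomposition.

Arguments precomp {A B} I f h.

Definition isomorphic (A B : topologicalZmodType) : Prop :=
  exists (f : chom A B) (g : chom B A), cancel f g /\ cancel g f.

Section ProLie.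
Variable R : realType.

Definition completely_metrizable (T : topologicalType) : Prop :=
  exists (M : metricType R) (f : T -> M) (g : M -> T),
    [/\ continuous f, continuous g, cancel f g & cancel g f] /\
    forall F : set_system M, ProperFilter F -> cauchy F -> exists l : M, F --> l.

Definition polish (T : topologicalType) : Prop :=
  (exists2 S : set T, countable S & dense S) /\ completely_metrizable T.

Definition discrete (T : topologicalType) : Prop := forall A : set T, open A.

Definition lie (G : topologicalZmodType) : Prop :=
  polish G /\
  exists (n d : nat) (D : topologicalZmodType),
    [/\ countable [set: D], discrete D &
        isomorphic G (dsum (dsum (power 'I_n R) (power 'I_d (circle R))) D)].

Definition pro_lie (G : topologicalZmodType) : Prop :=
  forall U : set G, nbhs 0 U ->
    exists N : zmodClosed G,
      [/\ closed [set x | x \in N], [set x | x \in N] `<=` U &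
          lie (quotient_group N)].

Definition proLiePAb (G : topologicalZmodType) : Prop :=
  polish G /\ pro_lie G.

Definition zmod_short_exact (A B C : zmodType)
    (f : {additive A -> B}) (g : {additive B -> C}) : Prop :=
  [/\ injective f, range f = [set b | g b = 0] & range g = [set: C]].

(* [g] is only constrained on [range f]: it is the inverse of the homeomorphism
   of [A] onto [range f]. *)
Definition closed_embedding (A B : topologicalType) (f : A -> B) : Prop :=
  [/\ continuous f, closed (range f) &
      exists2 g : B -> A, cancel f g & {within range f, continuous g}].

Definition short_exact (A B C : topologicalZmodType)
    (i : chom A B) (p : chom B C) : Prop :=
  [/\ proLiePAb A, proLiePAb B, proLiePAb C,
      zmod_short_exact i p & closed_embedding i].

Definition injective_object (I : topologicalZmodType) : Prop :=
  proLiePAb I /\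
  forall (A B C : topologicalZmodType) (i : chom A B) (p : chom B C),
    short_exact i p -> zmod_short_exact (precomp I p) (precomp I i).

Definition splits (X A : topologicalZmodType) (p : chom X A) : Prop :=
  exists s : chom A X, cancel s p.

(* [Ext(A, B)] consists of the isomorphism classes of the extensions of [A] by
   [B] and its zero is the class of the split ones, hence this reading of
   [Ext(A, B) = 0]. *)
Definition Ext_eq0 (A B : topologicalZmodType) : Prop :=
  forall (X : topologicalZmodType) (i : chom B X) (p : chom X A),
    short_exact i p -> splits p.

Definition path_connected (T : topologicalType) : Prop :=
  forall x y : T, exists f : R -> T,
    [/\ {within `[0, 1], continuous f}, f 0 = x & f 1 = y].

End ProLie.

(* Main.v *)
(* (1) => (4): the identity of G extends along the inclusion of G in an extension.

   (4) => (3): push 0 -> Z -> R -> T -> 0 out along the map Z -> G sending 1 to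
   g. If the resulting extension X of T by G splits, the image of the segment
   [0, 1] of R under the projection X -> G joins 0 to g.

   (3) => (2): along a path from 0 to g, a character chi of G lifts to R; let
   lift chi g be the endpoint. The map lift is additive; let M be its range. By
   Baire's theorem pointwise limits of characters are characters, so that M is
   closed in every subspace of finite dimension. Hence countably many lifts lie
   in the span of a sequence v of independent functions such that a combination
   of v_0, ..., v_(k-1) is in M if and only if its coefficients at some of the
   indices are integers. The v_i at these indices give characters of G, and the
   others give homomorphisms from G to R. They define the topology of G, because
   the coordinates of the Lie quotients of G are combinations of them. A duality
   argument for the subgroups of R^k shows that they simultaneously take values
   near any prescribed ones, hence all values by completeness.

   (2) => (1): let f be a homomorphism from a closed subgroup A of B to R or T,
   and e a cover by R^m of the Lie quotient of B by a small subgroup. Then f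
   induces a homomorphism on a subgroup of R^m, not always closed, which is small
   near 0, and which extends to a homomorphism phi on R^m by linear algebra and
   Diophantine approximation. As R and T are divisible, f and phi have a common
   extension to B, which is continuous like phi because e is open. *)
Require Import Defs.
From HB Require Import structures.
From mathcomp Require Import all_boot all_order all_algebra.
From mathcomp Require Import all_classical all_reals all_analysis.
From mathcomp Require Import zify ring lra.
Set Implicit Arguments.
Unset Strict Implicit.
Unset Printing Implicit Defensive.

Import Order.TTheory GRing.Theory Num.Theory.
Import numFieldNormedType.Exports.

Local Open Scope classical_set_scope.
Local Open Scope ring_scope.
Local Open Scope quotient_scope.

(** * Topological abelian groups *)

(** G need not be locally compact, so no duality theorem is at hand; characters are handled
    directly, with Baire's theorem and completeness as the main tools. Completeness is needed for
    the translations of G and not for some metric, hence the passage from complete metrics to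
    convergence of translation-Cauchy filters. Likewise a Lie group is handled through an open
    homomorphism from some R^m, a property that quotients inherit at once, whereas the decomposition
    R^n + T^d + D is not visibly inherited.

    The lifts form a group M of real functions on G, additive in chi, and the space of these
    functions carries no topology. Closedness in subspaces of finite dimension is enough to choose
    the independent functions one at a time: beyond the span of the previous ones, the new
    coordinates of M are either discrete, and a least positive one yields a factor T, or they
    accumulate at 0, and M contains a line, which yields a factor R.

    Elements of T are represented in [-1/2, 1/2). Representatives add as long as they are below 1/4,
    and the bound 1/8 leaves room for the difference of two characters. *)

Section TopologicalGroup.
Context {G : topologicalZmodType}.
Implicit Types (x y : G) (U V : set G).

Lemma continuous_add2 (T : topologicalType) (f g : T -> G) :
  continuous f -> continuous g -> continuous (fun t => f t + g t).
Proof.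
move=> fc gc t; apply: (@cvg_comp _ _ _ (fun t => (f t, g t))
  (fun z : G * G => z.1 + z.2) _ (nbhs (f t, g t))).
  by apply: cvg_pair; [exact: fc|exact: gc].
exact: (@add_continuous G (f t, g t)).
Qed.

Lemma continuous_addl x : continuous (fun y => x + y).
Proof. by apply: continuous_add2 => y; [exact: cvg_cst|exact: cvg_id]. Qed.

Lemma nbhs_shift x U : nbhs x U <-> nbhs 0 (fun y => U (x + y)).
Proof.
split=> [xU|U0].
  by have := @continuous_addl x 0 U; rewrite addr0 => /(_ xU).
have := @continuous_addl (- x) x (fun y => U (x + y)); rewrite addNr => /(_ U0).
apply: (@filterS _ (nbhs x)) => y /=; by rewrite addrA subrr add0r.
Qed.

Lemma nbhs_shiftB x U : nbhs x (fun y => U (y - x)) <-> nbhs 0 U.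
Proof.
rewrite nbhs_shift; suff -> : (fun y => U (x + y - x)) = U by [].
by apply/funext => y; rewrite addrAC subrr add0r.
Qed.

Lemma nbhs_shiftN x U : nbhs 0 U -> nbhs x (fun y => U (x - y)).
Proof.
move=> U0; apply: (nbhs_shift x _).2.
have := @opp_continuous G 0 U; rewrite oppr0 => /(_ U0).
apply: (@filterS _ (nbhs (0 : G))) => y /=.
by rewrite opprD addrA subrr sub0r.
Qed.

Lemma nbhs0_split U : nbhs 0 U -> exists V,
  [/\ nbhs 0 V, forall x, V x -> V (- x), forall x y, V x -> V y -> U (x - y)
    & forall x y, V x -> V y -> U (x + y)].
Proof.
move=> U0; have := @sub_continuous G (0, 0) U; rewrite /= subr0 => /(_ U0).
move=> [[A B] /= [A0 B0] ABU].
have N0 : nbhs 0 (fun x => (A `&` B) (- x)).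
  have := @opp_continuous G 0 (A `&` B); rewrite oppr0; apply.
  exact: filterI.
pose V x := (A `&` B) x /\ (A `&` B) (- x).
have Vop x : V x -> V (- x) by rewrite /V opprK => -[].
have VU x y : V x -> V y -> U (x - y).
  by move=> [[Ax _] _] [[_ By] _]; exact: (ABU (x, y)).
exists V; split=> // [|x y Vx Vy]; first by apply: filterI => //; exact: filterI.
by rewrite -[y]opprK; apply: VU => //; exact: Vop.
Qed.

Lemma nbhs0_closed U : nbhs 0 U -> exists2 V, nbhs 0 V & closure V `<=` U.
Proof.
move=> /nbhs0_split[V [V0 Vop VU _]]; exists V => // x Vx.
have /Vx[y [Vy Vyx]] := (nbhs_shiftB x V).2 V0.
by rewrite -[x](subKr y); exact: VU.
Qed.

Lemma nbhs_closed x U : nbhs x U -> exists2 V, nbhs x V & closure V `<=` U.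
Proof.
move=> /nbhs_shift/nbhs0_closed[V V0 VU]; exists (fun y => V (y - x)).
  exact/nbhs_shiftB.
move=> y /= Vy; rewrite -[y](subrK x) addrC; apply: VU => W.
move=> /(nbhs_shift _ _).1 Wyx.
have /Vy[z /= [Vz Wz]] : nbhs y (fun z => W (z - x)).
  apply/nbhs_shift; apply: filterS Wyx => z /=.
  by rewrite addrAC.
by exists (z - x).
Qed.

(** Cauchy filters for the uniform structure of translations. The notion refers to no metric, so it
    is convenient for quotients and products. *)
Definition group_cauchy (F : set_system G) :=
  forall U, nbhs 0 U -> exists x, F (fun y => U (y - x)).

Definition group_complete := forall F : set_system G, ProperFilter F ->
  group_cauchy F -> exists l : G, F --> l.

Lemma group_cauchyP F : Filter F -> group_cauchy F <->
  forall U, nbhs 0 U -> exists2 A, F A & forall x y, A x -> A y -> U (x - y).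
Proof.
move=> FF; split=> FC U U0.
  have [V [V0 Vop VU _]] := nbhs0_split U0.
  have [x Fx] := FC V V0; exists (fun y => V (y - x)) => // a b Va Vb.
  have -> : a - b = (a - x) - (b - x) by rewrite opprB addrA subrK.
  exact: VU.
have [A FA AU] := FC U U0.
have [[x Ax]|nA] := pselect (exists x, A x).
  by exists x; apply: filterS FA => y Ay; exact: AU.
by exists 0; apply: filterS FA => y Ay; case: nA; exists y.
Qed.

Definition countable_base0 := exists2 B : nat -> set G,
  (forall n, nbhs 0 (B n)) & forall U, nbhs 0 U -> exists n, B n `<=` U.

End TopologicalGroup.
Arguments group_complete : clear implicits.
Arguments countable_base0 : clear implicits.

(** * Polish abelian groups *)

Lemma dependent_choice_nat (T : Type) (P : nat -> T -> Prop)
    (Q : nat -> T -> T -> Prop) (x0 : T) :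
  P 0%N x0 -> (forall n x, P n x -> exists2 y, P n.+1 y & Q n x y) ->
  exists u : nat -> T, u 0%N = x0 /\ forall n, P n (u n) /\ Q n (u n) (u n.+1).
Proof.
move=> P0 PQ.
have /choice[f fP] : forall z : nat * T, exists y,
    P z.1 z.2 -> P z.1.+1 y /\ Q z.1 z.2 y.
  move=> [n x]; have [Px|nPx] := pselect (P n x); last by exists x.
  by have [y Py Qy] := PQ n x Px; exists y.
pose fix u n := if n is m.+1 then f (m, u m) else x0.
exists u; split=> // n; suff Pu : P n (u n) by split=> //; have [] := fP (n, u n) Pu.
by elim: n => // n Pn; have [] := fP (n, u n) Pn.
Qed.

(* Cantor's intersection theorem, freed from the metric: [sm n] is the class of
   the sets contained in a ball of radius [1 / (n + 1)]. *)
Lemma completely_metrizable_small (R : realType) (T : topologicalType) :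
  completely_metrizable R T -> exists sm : nat -> set (set T),
  [/\ forall n (x : T), exists2 U, nbhs x U & sm n U,
      forall n U V, U `<=` V -> sm n V -> sm n U &
      forall O : nat -> set T, (forall n, O n.+1 `<=` O n) ->
        (forall n, O n !=set0) -> (forall n, sm n (O n)) ->
        exists x : T, (forall n, closure (O n) x) /\
          forall V, nbhs x V -> exists n, O n `<=` V].
Proof.
move=> [M [f [g [[fc gc fK gK] Mc]]]].
exists (fun n U => exists c : M, forall x, U x -> ball c n.+1%:R^-1 (f x)).
split.
- move=> n x; exists (f @^-1` ball (f x) n.+1%:R^-1); last by exists (f x).
  by apply: fc; apply: nbhsx_ballx; rewrite invr_gt0.
- by move=> n U V UV [c Vc]; exists c => x /UV/Vc.
move=> O Odec On0 Osm.
have Ole n m : (n <= m)%N -> O m `<=` O n.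
  elim: m => [|m IH]; first by rewrite leqn0 => /eqP ->.
  rewrite leq_eqVlt => /orP[/eqP -> //|]; rewrite ltnS => /IH.
  by apply: subset_trans; exact: Odec.
pose F : set_system M := filter_from setT (fun n => f @` O n).
have FF : ProperFilter F.
  apply: filter_from_proper; last by move=> n _; case: (On0 n) => x Ox; exists (f x), x.
  apply: filter_from_filter; first by exists 0%N.
  move=> i j _ _; exists (maxn i j) => // _ [x Ox <-].
  by split; exists x => //; apply: Ole Ox; rewrite (leq_maxl, leq_maxr).
have [|l Fl] := Mc F FF.
  apply/cauchyP => e e0.
  have [n ne] : exists n, n.+1%:R^-1 < e.
    exists (Num.truncn e^-1).
    by rewrite -ltf_pV2 ?(posrE,invr_gt0)// invrK truncnS_gt.
  have [c cO] := Osm n; exists c, n => // _ [x Ox <-].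
  by apply: le_ball (ltW ne) _ _; exact: cO.
have lim V : nbhs (g l) V -> exists n, O n `<=` V.
  move=> Vl; have /Fl[n _ nV] : nbhs l (g @^-1` V) by exact: gc.
  by exists n => x Ox; rewrite -(fK x); apply: nV; exists x.
exists (g l); split=> // n W /lim[m mW].
have [x Ox] := On0 (maxn n m); exists x; split.
  by apply: Ole Ox; exact: leq_maxl.
by apply: mW; apply: Ole Ox; exact: leq_maxr.
Qed.

Lemma nbhs_open_closure (G : topologicalZmodType) (x : G) (U : set G) :
  nbhs x U -> exists V, [/\ open V, V x & closure V `<=` U].
Proof.
move=> /nbhs_closed[V xV VU]; exists V°; split; first exact: open_interior.
  exact: xV.
by apply: subset_trans VU; apply: closure_subset; exact: interior_subset.
Qed.

(** If no [F n] had interior, there would be small nonempty open sets, each containing the closure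
    of the next, with that closure avoiding [F n]; their common point would lie in no [F n].
    Regularity of the group provides the closures. *)
Lemma Baire_group (R : realType) (G : topologicalZmodType) (F : nat -> set G) :
  completely_metrizable R G -> (forall n, closed (F n)) ->
  (forall x, exists n, F n x) -> exists n (x : G), nbhs x (F n).
Proof.
move=> /completely_metrizable_small[sm [smE smS smP]] Fcl Fcov.
apply: contrapT => Fint.
have [||u [u0 uP]] := @dependent_choice_nat _
  (fun n O => open O /\ O !=set0)
  (fun n O O' => sm n O' /\ closure O' `<=` O `\` F n) (@setT G).
- by split; [exact: openT|exists 0].
- move=> n O [oO On0].
  have [x [Ox Fx]] : exists x, O x /\ ~ F n x.
    apply: contrapT => nx; apply: Fint; have [x Ox] := On0; exists n, x.
    move: (open_nbhs_nbhs (conj oO Ox)); apply: filterS => y Oy.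
    by apply: contrapT => Fy; apply: nx; exists y.
  have [U xU smU] := smE n x.
  have : nbhs x (U `&` (O `\` F n)).
    apply: filterI => //; apply: open_nbhs_nbhs; split=> //.
    by apply: openI => //; exact/closed_openC.
  move=> /nbhs_open_closure[V [oV Vx VU]]; exists V.
    by split=> //; exists x.
  split; last by move=> y /VU[].
  by apply: smS smU => y /(@subset_closure _ V)/VU[].
have [|||x [xO _]] := smP (fun n => u n.+1).
- by move=> n y; case: (uP n.+1) => _ [_ +] /subset_closure => /[apply] -[].
- by move=> n; have [[]] := uP n.+1.
- by move=> n; have [_ []] := uP n.
have [n Fx] := Fcov x.
by have [_ [_ /(_ x)[]]] := uP n; first exact: xO.
Qed.

(* Klee's theorem. For a Cauchy filter [F], one builds shrinking open sets [P]
   and [O] with [A + P <= O] for some [A] in [F]: if [y] and [x] are the points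
   that they determine then [F + y] converges to [x]. *)
Lemma completely_metrizable_complete (R : realType) (G : topologicalZmodType) :
  completely_metrizable R G -> group_complete G.
Proof.
move=> /completely_metrizable_small[sm [smE smS smP]] F FF /group_cauchyP FC.
have [||u [u0 uP]] := @dependent_choice_nat _
  (fun n (PO : set G * set G) => [/\ open PO.1, open PO.2, PO.1 !=set0 &
    exists2 A, F A & forall a p, A a -> PO.1 p -> PO.2 (a + p)])
  (fun n PO PO' => [/\ sm n PO'.1, sm n PO'.2, closure PO'.1 `<=` PO.1 &
    closure PO'.2 `<=` PO.2])
  (setT, setT).
- split; [exact: openT|exact: openT|by exists 0|].
  by exists setT => //; exact: filterT.
- move=> n [P O] /= [oP oO [y Py] [A FA AO]].
  have Py0 : nbhs 0 (fun z => P (y + z)).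
    by apply: (nbhs_shift y P).1; exact: open_nbhs_nbhs.
  have [A1 FA1 A1P] := FC _ Py0.
  have [a [Aa A1a]] := filter_ex (filterI FA FA1).
  set x := a + y.
  have [U xU smU] := smE n x.
  have : nbhs x (U `&` O).
    apply: filterI => //; apply: open_nbhs_nbhs; split=> //.
    by apply: AO.
  move=> /nbhs_open_closure[V [oV Vx VU]].
  have /nbhs_shift/nbhs0_split[W [W0 Wop WV1 WV]] := open_nbhs_nbhs (conj oV Vx).
  have [A2 FA2 A2W] := FC _ W0.
  have [a' [A2a' A1a']] := filter_ex (filterI FA2 FA1).
  have Py' : P (x - a').
    have -> : x - a' = y + (a - a') by rewrite /x addrAC addrC.
    exact: A1P.
  have [U' yU' smU'] := smE n (x - a').
  have : nbhs (x - a') (U' `&` P `&` (fun z => W (z - (x - a')))).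
    apply: filterI; last exact/nbhs_shiftB.
    by apply: filterI => //; exact: open_nbhs_nbhs.
  move=> /nbhs_open_closure[P' [oP' P'y P'U]].
  exists (P', V) => /=.
    split=> //; first by exists (x - a').
    exists A2 => // b p A2b P'p.
    have -> : b + p = x + ((b - a') + (p - (x - a'))).
      by rewrite -{1}[x](subrKC a') addrACA !subrKC.
    apply: WV; first exact: A2W.
    by have /P'U[] := subset_closure P'p.
  split.
  - by apply: smS smU' => z /(@subset_closure _ P')/P'U[[]].
  - by apply: smS smU => z /(@subset_closure _ V)/VU[].
  - by move=> z /P'U[[]].
  - by move=> z /VU[].
have [|||y [yP _]] := smP (fun n => (u n.+1).1).
- by move=> n z; case: (uP n.+1) => _ [_ _ + _] /subset_closure => /[apply].
- by move=> n; have [[]] := uP n.+1.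
- by move=> n; have [_ []] := uP n.
have [|||x [_ xO]] := smP (fun n => (u n.+1).2).
- by move=> n z; case: (uP n.+1) => _ [_ _ _ +] /subset_closure => /[apply].
- move=> n; have [[_ _ [p Pp] [A FA AO]] _] := uP n.+1.
  by have [a Aa] := filter_ex FA; exists (a + p); exact: AO.
- by move=> n; have [_ []] := uP n.
exists (x - y) => V Vxy.
have [|n nV] := xO (fun z => V (z - y)).
  apply/nbhs_shift; apply: filterS ((nbhs_shift _ _).1 Vxy) => z /=.
  by rewrite addrAC.
have [[_ _ _ [A FA AO]] _] := uP n.+1.
apply: filterS FA => a Aa; rewrite -[a](addrK y); apply: nV; apply: AO => //.
by have [_ [_ _ + _]] := uP n.+1; apply; exact: yP.
Qed.

(** * Metrization of complete groups with a countable base at 0 *)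

Definition group_uniform (G : topologicalZmodType) : Type := G.

Section GroupUniform.
Local Open Scope relation_scope.
Context (G : topologicalZmodType).
Local Notation T := (group_uniform G).

HB.instance Definition _ := Topological.copy T G.

Definition group_entourage : set_system (T * T) :=
  [set E | exists2 U : set G, nbhs 0 U &
    forall x y : G, U (y - x) -> E (x, y)].

Let entourage_filter : Filter group_entourage.
Proof.
split.
- by exists setT => //; exact: filterT.
- move=> P Q [U U0 UP] [V V0 VQ]; exists (U `&` V); first exact: filterI.
  by move=> x y [Uxy Vxy]; split; [exact: UP|exact: VQ].
- by move=> P Q PQ [U U0 UP]; exists U => // x y /UP/PQ.
Qed.

Let entourage_diagonal A : group_entourage A -> diagonal `<=` A.
Proof.
move=> [U U0 UA] [x y]; rewrite /diagonal /= => ->; apply: UA; rewrite subrr.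
exact: nbhs_singleton.
Qed.

Let entourage_inv A : group_entourage A -> group_entourage A^-1.
Proof.
move=> [U U0 UA]; have [V [V0 Vop VU1 VU2]] := nbhs0_split U0.
exists V => // x y Vxy; apply: UA; rewrite -opprB -[- _]add0r.
by apply: VU1 => //; exact: nbhs_singleton.
Qed.

Let entourage_split_ex A :
  group_entourage A -> exists2 B, group_entourage B & B \; B `<=` A.
Proof.
move=> [U U0 UA]; have [V [V0 Vop VU1 VU2]] := nbhs0_split U0.
exists [set z | V (z.2 - z.1 : G)]; first by exists V.
move=> [x y] [z /= Vxz Vzy]; apply: UA.
have -> : y - x = (z - x : G) + (y - z) by rewrite [RHS]addrC addrA subrK.
exact: VU2.
Qed.

Let nbhsE : nbhs = nbhs_ group_entourage.
Proof.
apply/funext => x; apply/funext => A; apply/propext; split.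
  move=> /(nbhs_shift (x : G) A).1 A0.
  exists [set z : T * T | z.1 = x -> A z.2].
    by exists (fun y => A ((x : G) + y)) => // y z + /= yx; rewrite yx subrKC.
  by move=> y; rewrite /xsection /= inE => /(_ erefl).
move=> [E [U U0 UE] EA]; apply: filterS ((nbhs_shiftB x U).2 U0).
by move=> y Uyx; apply: EA; rewrite /xsection /= inE; exact: UE.
Qed.

HB.instance Definition _ := Nbhs_isUniform_mixin.Build T
  entourage_filter entourage_diagonal entourage_inv entourage_split_ex nbhsE.

Lemma group_uniform_countable : countable_base0 G -> countable_uniformity T.
Proof.
move=> [B B0 BP]; apply/countable_uniformityP.
exists (fun n => [set z : T * T | B n (z.2 - z.1 : G)]).
  by move=> A [U /BP[n nU] UA]; exists n => -[x y] /= /nU/UA.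
by move=> n; exists (B n).
Qed.

End GroupUniform.

Section Metrization.
Context (R : realType) (M : pseudoMetricType R).
Hypothesis M_hausdorff : hausdorff_space M.
Hypothesis M_bounded : forall x y : M, ball x 2 y.

(** The body mentions the two hypotheses so that the type depends on them outside the section; the
    metric structure can then be attached to this name. *)
Definition metrized : Type := let _ := M_hausdorff in let _ := M_bounded in M.

HB.instance Definition _ := Choice.on metrized.

(** The pseudometric is given by its balls; [M_bounded] makes the set of radii nonempty, and
    [M_hausdorff] separates the points. *)
Definition ball_dist (x y : metrized) : R :=
  inf [set e : R | 0 < e /\ ball (x : M) e y].

Let dist_set_inf (x y : M) : has_inf [set e : R | 0 < e /\ ball x e y].
Proof.
split; first by exists 2.
by exists 0 => e [e0 _]; exact: ltW.
Qed.

Let dist_lt (x y : M) e : ball_dist x y < e -> ball x e y.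
Proof.
move=> /(inf_lt (dist_set_inf x y).1)[d [d0 xdy] de].
exact: le_ball (ltW de) _ xdy.
Qed.

Let dist_le (x y : M) e : 0 < e -> ball x e y -> ball_dist x y <= e.
Proof. by move=> e0 xy; apply: ge_inf => //; exact: (dist_set_inf x y).2. Qed.

Let dist_ge0 (x y : M) : 0 <= ball_dist x y.
Proof.
apply: lb_le_inf; first by case: (dist_set_inf x y).
by move=> e [e0 _]; exact: ltW.
Qed.

Let distxx x : ball_dist x x = 0.
Proof.
apply/eqP; rewrite eq_le dist_ge0 andbT; apply/ler_addgt0Pl => e e0.
by rewrite addr0; apply: dist_le => //; exact: ballxx.
Qed.

Let dist_positivity x y : ball_dist x y = 0 -> x = y.
Proof.
move=> xy0; apply: M_hausdorff => A B /nbhs_ballP[e e0 eA] /nbhs_singleton By.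
by exists y; split=> //; apply: eA; apply: dist_lt; rewrite xy0.
Qed.

Let dist_sym x y : ball_dist x y = ball_dist y x.
Proof.
by congr inf; apply/seteqP; split=> e [e0 /ball_sym].
Qed.

Let dist_triangle y x z : ball_dist x z <= ball_dist x y + ball_dist y z.
Proof.
apply/ler_addgt0Pr => e e0.
have -> : ball_dist x y + ball_dist y z + e =
  (ball_dist x y + e / 2) + (ball_dist y z + e / 2) by lra.
have e20 : 0 < e / 2 by rewrite divr_gt0.
apply: dist_le; first by rewrite addr_gt0 // ltr_wpDl ?dist_ge0.
by apply: (@ball_triangle _ _ (y : M)); apply: dist_lt; rewrite ltrDl.
Qed.

HB.instance Definition _ := isMetric.Build R metrized
  distxx dist_positivity dist_sym dist_triangle.

Lemma metrized_in : continuous (id : M -> metrized).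
Proof.
(* A point of a ball of radius [r] is only known to be at distance at most [r], hence the radius
   [e / 2]. *)
move=> x A /nbhs_ballP[e /= e0 eA]; apply/nbhs_ballP; exists (e / 2) => /=.
  by rewrite divr_gt0.
move=> y xy; apply: eA; rewrite ballEmdist /=.
apply: (@le_lt_trans _ _ (e / 2)); last by lra.
by apply: dist_le => //; rewrite divr_gt0.
Qed.

Lemma metrized_out : continuous (id : metrized -> M).
Proof.
move=> x A /nbhs_ballP[e /= e0 eA]; apply/nbhs_ballP; exists e => //= y.
by rewrite ballEmdist => /= xy; apply: eA; exact: dist_lt.
Qed.

Lemma metrized_cauchy (F : set_system metrized) : Filter F ->
  cauchy F -> cauchy (F : set_system M).
Proof.
move=> FF /cauchy_ballP Fc; apply/cauchy_ballP => e e0.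
by apply: filterS (Fc e e0) => -[x y] /=; rewrite ballEmdist; exact: dist_lt.
Qed.

End Metrization.

Lemma complete_group_metrizable (R : realType) (G : topologicalZmodType) :
  hausdorff_space G -> countable_base0 G -> group_complete G ->
  completely_metrizable R G.
Proof.
move=> Gh /group_uniform_countable cu Gc.
pose N : pseudoMetricType R := countable_uniform cu.
pose Nb : forall x y : N, ball x 2 y := @countable_uniform.countable_uniform_bounded R _ cu.
pose Nh : hausdorff_space N := Gh.
exists (metrized Nh Nb), id, id; split.
  by split=> //; [exact: (@metrized_in _ N)|exact: (@metrized_out _ N)].
move=> F FF /metrized_cauchy Fc.
have [|l Fl] := Gc F FF.
  apply/group_cauchyP => U U0.
  have [|[A B] /= [FA FB] AB] := Fc [set z : N * N | U ((z.2 : G) - z.1)].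
    by exists U.
  exists (A `&` B); first exact: filterI.
  by move=> x y [Ax Bx] [Ay By]; exact: (AB (y, x)).
by exists l => V /metrized_in; exact: Fl.
Qed.

(** * Continuous homomorphisms, quotients and the open mapping theorem *)

Section ChomMorphism.
Context {A B : topologicalZmodType} (f : chom A B).

Lemma chomB x y : f (x - y) = f x - f y. Proof. exact: raddfB. Qed.
Lemma chomD x y : f (x + y) = f x + f y. Proof. exact: raddfD. Qed.
Lemma chomN x : f (- x) = - f x. Proof. exact: raddfN. Qed.
Lemma chom0 : f 0 = 0. Proof. exact: raddf0. Qed.

End ChomMorphism.

Lemma continuous_additive (A B : topologicalZmodType) (f : A -> B) :
  zmod_morphism f -> (forall U, nbhs 0 U -> nbhs 0 (f @^-1` U)) ->
  continuous f.
Proof.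
move=> fB f0 x U /(nbhs_shift (f x) U).1/f0 Ux.
apply: filterS ((nbhs_shiftB x _).2 Ux) => y /=.
by rewrite fB subrKC.
Qed.

Definition mk_chom (A B : topologicalZmodType) (f : A -> B)
    (fB : zmod_morphism f) (fc : continuous f) : chom A B :=
  CHom (asboolT (conj fB fc) : f \in @chom_pred A B).

Lemma nbhs0_preimage (A B : topologicalZmodType) (f : chom A B) U :
  nbhs 0 U -> nbhs 0 (f @^-1` U).
Proof. by move=> U0; apply: (@chom_continuous _ _ f 0); rewrite chom0. Qed.

(** Openness is tested at 0 only, which is enough for a homomorphism. *)
Definition open_hom (A B : topologicalZmodType) (f : A -> B) :=
  forall U, nbhs 0 U -> nbhs 0 (f @` U).

Lemma mk_chomE (A B : topologicalZmodType) (f : A -> B)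
    (fB : zmod_morphism f) (fc : continuous f) x : mk_chom fB fc x = f x.
Proof. by []. Qed.

Section Quotient.
Context {G : topologicalZmodType} (N : zmodClosed G).
Local Notation Q := (quotient_group N).

Fact quotient_pi_subproof : (\pi_Q : G -> Q) \in @chom_pred G Q.
Proof.
apply/asboolT; split; last exact: pi_continuous.
move=> x y; apply: etrans (Quotient.pi_add N x (- y)) _.
exact: (congr1 (Quotient.add (\pi x))) (Quotient.pi_opp N y).
Qed.

Definition quotient_pi : chom G Q := CHom quotient_pi_subproof.

Lemma quotient_pi_eq0 x : quotient_pi x = 0 <-> x \in N.
Proof.
rewrite -[X in _ = X](chom0 quotient_pi).
have := Quotient.idealrBE N x 0; rewrite subr0 => ->.
by split=> [xy|/eqP//]; apply/eqP.
Qed.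

Lemma quotient_pi_surj q : exists x, quotient_pi x = q.
Proof. by exists (repr q); exact: reprK. Qed.

Lemma quotient_pi_open : open_hom quotient_pi.
Proof.
move=> U; rewrite nbhsE => -[A [oA A0] AU].
have : open (quotient_pi @` A).
  rewrite /open /= /quotient_open.
  rewrite (_ : _ @^-1` _ = \bigcup_(n in [set n | n \in N])
    ((fun x => - n + x) @^-1` A)).
    apply: bigcup_open => n _; apply: open_comp => // x _.
    exact: continuous_addl.
  apply/seteqP; split=> x.
    move=> [a Aa ax]; exists (x - a) => /=.
      by apply/quotient_pi_eq0; rewrite chomB; apply/eqP; rewrite subr_eq0; apply/eqP; exact: esym.
    by rewrite opprB subrK.
  move=> [n /= /quotient_pi_eq0 nN An]; exists (- n + x) => //.
  suff: quotient_pi (- n + x) = quotient_pi x by [].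
  by rewrite chomD chomN nN oppr0 add0r.
move=> oA'; apply: (@filterS _ _ _ (quotient_pi @` A)); first exact: image_subset.
by apply: open_nbhs_nbhs; split=> //; exists 0 => //; exact: chom0.
Qed.

End Quotient.

(** Any set-theoretic section [s] of [p] will do: [h \o s] is additive because [h] vanishes on the
    kernel of [p], and continuous because [p] is open. *)
Lemma chom_factor (A B C : topologicalZmodType) (p : chom A B) (h : chom A C) :
  open_hom p -> (forall b, exists a, p a = b) ->
  (forall a, p a = 0 -> h a = 0) -> exists k : chom B C, forall a, k (p a) = h a.
Proof.
move=> po /choice[s ps] ph.
have hs a : h (s (p a)) = h a.
  by apply/eqP; rewrite -subr_eq0 -chomB; apply/eqP/ph; rewrite chomB ps subrr.
have kB : zmod_morphism (h \o s).
  move=> x y /=; rewrite -chomB -[x in LHS]ps -[y in LHS]ps -chomB.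
  exact: hs.
suff kc : continuous (h \o s) by exists (mk_chom kB kc).
apply: continuous_additive => // U /(nbhs0_preimage h)/po.
by apply: filterS => _ [a Ua <-] /=; rewrite hs.
Qed.

Lemma isomorphic_bij (A B : topologicalZmodType) (f : chom A B) :
  open_hom f -> (forall b, exists a, f a = b) -> (forall a, f a = 0 -> a = 0) ->
  isomorphic A B.
Proof.
move=> fo fs f0.
have idB : zmod_morphism (@id A) by [].
have idc : continuous (@id A) by move=> x; exact: cvg_id.
have [k kf] := chom_factor (h := mk_chom idB idc) fo fs f0.
by exists f, k; split=> // b; have [a <-] := fs b; rewrite kf.
Qed.

Lemma group_hausdorff (G : topologicalZmodType) :
  (forall x : G, (forall U, nbhs 0 U -> U x) -> x = 0) -> hausdorff_space G.
Proof.
move=> G0 x y xy; apply/eqP; rewrite -subr_eq0; apply/eqP/G0 => U U0.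
have [V [V0 Vop VU1 VU2]] := nbhs0_split U0.
have [z [Vzx Vzy]] := xy _ _ ((nbhs_shiftB x V).2 V0) ((nbhs_shiftB y V).2 V0).
have -> : x - y = (z - y) - (z - x) by rewrite opprB [RHS]addrC addrA subrK.
exact: VU1.
Qed.

Lemma hausdorff_nbhs0 (G : topologicalZmodType) (x : G) :
  hausdorff_space G -> (forall U, nbhs 0 U -> U x) -> x = 0.
Proof.
move=> Gh x0; apply: Gh => A B Ax B0; exists x; split; last exact: x0.
exact: nbhs_singleton.
Qed.

Section CauchySequences.
Context {G : topologicalZmodType}.

(** The inclusion of [V n.+1 + V n.+1] in [V n] does the work of a geometric series for an invariant
    metric. The base is met with a shift of one, as the construction starts from the whole group. *)
Lemma countable_base0_nested : countable_base0 G -> exists V : nat -> set G,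
  [/\ forall n, nbhs 0 (V n), forall n x, V n x -> V n (- x),
      forall n x y, V n.+1 x -> V n.+1 y -> V n (x + y),
      forall n x, V n.+1 x -> V n x &
      forall U, nbhs 0 U -> exists n, V n `<=` U].
Proof.
move=> [B B0 BP].
have [||V [_ VP]] := @dependent_choice_nat (set G)
  (fun n V => [/\ nbhs 0 V, forall x, V x -> V (- x) & (0 < n)%N -> V `<=` B n.-1])
  (fun n V W => forall x y, W x -> W y -> V (x + y)) setT.
- by split=> //; exact: filterT.
- move=> n U [U0 _ _].
  have [V [V0 Vop _ VU]] := nbhs0_split (filterI U0 (B0 n)).
  exists V; last by move=> x y Vx Vy; have [] := VU x y Vx Vy.
  split=> // _ x Vx; have [] := VU x 0 Vx (nbhs_singleton V0).
  by rewrite addr0.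
exists V; split.
- by move=> n; have [[]] := VP n.
- by move=> n; have [[]] := VP n.
- by move=> n; have [_] := VP n.
- move=> n x Vx; rewrite -[x]addr0; have [_] := VP n; apply=> //.
  by have [[/nbhs_singleton]] := VP n.+1.
by move=> U /BP[n nU]; exists n.+1; have [[_ _ /(_ isT) VB] _] := VP n.+1; exact: subset_trans nU.
Qed.

Context (V : nat -> set G).
Hypotheses (V0 : forall n, nbhs 0 (V n))
  (VD : forall n x y, V n.+1 x -> V n.+1 y -> V n (x + y)).

Lemma nested_sum (x : nat -> G) n m :
  (forall k, V k.+1 (x k.+1 - x k)) -> (n <= m)%N -> V n (x m - x n).
Proof.
move=> xV /subnKC; move: (m - n)%N => d <-; elim: d n => [|d IH] n.
  by rewrite addn0 subrr; exact: nbhs_singleton.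
by have := VD (IH n.+1) (xV n); rewrite addSnnS addrA subrK.
Qed.

Lemma nested_cvg (x : nat -> G) : group_complete G ->
  (forall U, nbhs 0 U -> exists n, V n `<=` U) ->
  (forall k, V k.+1 (x k.+1 - x k)) ->
  exists l, x @ \oo --> l /\ forall n, closure (V n) (l - x n).
Proof.
move=> Gc Vbase xV.
have [|l xl] := Gc (x @ \oo) _.
  move=> U /Vbase[n nU]; exists (x n); exists n => // m /= nm.
  by apply: nU; exact: nested_sum.
exists l; split=> // n U /(nbhs_shift (l - x n) U).1 U0.
have /xl[m _ mP] := (nbhs_shiftB l _).2 U0.
exists (x (maxn m n) - x n); split.
  by apply: nested_sum => //; exact: leq_maxr.
have := mP (maxn m n) (leq_maxl m n) => /=.
by rewrite addrAC subrKC.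
Qed.

End CauchySequences.

Section Polish.
Variable R : realType.

(** The form in which Polish groups are used: these conditions can be checked on quotients and
    products without producing a metric. *)
Definition polish_group (G : topologicalZmodType) : Prop :=
  [/\ hausdorff_space G, countable_base0 G, group_complete G &
      exists2 S : set G, countable S & dense S].

Lemma polish_groupP (G : topologicalZmodType) : polish R G <-> polish_group G.
Proof.
split=> [[Gs Gm]|[Gh Gb Gc Gs]]; last first.
  by split=> //; exact: complete_group_metrizable.
split=> //; last exact: completely_metrizable_complete Gm.
- move: Gm => [M [f [g [[fc gc fK gK] _]]]] x y xy.
  apply: (can_inj fK); apply: metric_hausdorff => A B /fc fA /fc fB.
  by have [z [Az Bz]] := xy _ _ fA fB; exists (f z).
- move: Gm => [M [f [g [[fc gc fK gK] _]]]].
  exists (fun n => f @^-1` ball (f 0) n.+1%:R^-1).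
    by move=> n; apply: fc; apply: nbhsx_ballx; rewrite invr_gt0.
  move=> U U0; have : nbhs (g (f 0)) U by rewrite fK.
  move=> /gc/nbhs_ballP[e /= e0 eU].
  exists (Num.truncn e^-1) => x /= xe; rewrite -(fK x); apply: eU.
  apply: le_ball xe; apply: ltW.
  by rewrite -ltf_pV2 ?(posrE,invr_gt0)// invrK truncnS_gt.
Qed.

End Polish.

(** For completeness, points in smaller and smaller members of a Cauchy filter are lifted one after
    another, with steps in [V n.+1]. The lifts converge in [G], and the filter converges to the
    image of their limit. *)
Lemma polish_quotient (G : topologicalZmodType) (N : zmodClosed G) :
  closed [set x | x \in N] -> polish_group G -> polish_group (quotient_group N).
Proof.
move=> Ncl [Gh Gb Gc [S Sc Sd]].
pose p := quotient_pi N.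
have po : open_hom p := quotient_pi_open N.
have ps : forall b, exists a, p a = b := quotient_pi_surj (N := N).
split.
- apply: group_hausdorff => q; have [x <-] := ps q => x0.
  apply/quotient_pi_eq0; apply: Ncl => U /(nbhs_shift x U).1 Ux.
  have [|y Uy pxy] := x0 (p @` [set y | U (x - y)]).
    apply: po; have := @opp_continuous G 0 (fun y => U (x + y)).
    by rewrite oppr0; apply.
  exists (x - y); split=> //=; apply/quotient_pi_eq0.
  by rewrite chomB -/p -pxy subrr.
- move: Gb => [B B0 BP]; exists (fun n => p @` B n) => [n|U]; first exact: po.
  by move=> /(nbhs0_preimage p)/BP[n nU]; exists n => _ [x /nU Ux <-].
- move=> F FF /group_cauchyP FC.
  have [V [V0 Vop VD VS VP]] := countable_base0_nested Gb.
  have /choice[A AP] n : exists A, F A /\ forall x y, A x -> A y -> (p @` V n) (x - y).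
    by have [A FA AV] := FC _ (po _ (V0 n)); exists A.
  pose A' n := \bigcap_(i in `I_n.+1) A i.
  have FA' n : F (A' n).
    rewrite /A'; elim: n => [|n IH].
      rewrite (_ : \bigcap_(i in _) _ = A 0%N); first by case: (AP 0%N).
      apply/seteqP; split=> [x Ax|x Ax [|i]] //=; exact: Ax.
    apply: filterS (filterI IH (AP n.+1).1) => x [xA Ax] i /=.
    by rewrite ltnS leq_eqVlt => /orP[/eqP -> //|]; exact: xA.
  have [q0 q0A] := filter_ex (FA' 1%N).
  have [x0 px0] := ps q0.
  have [||x [_ xP]] := @dependent_choice_nat G (fun n x => A' n.+1 (p x))
    (fun n x y => V n.+1 (y - x)) x0.
  + by rewrite px0.
  + move=> n x xA; have [q qA] := filter_ex (FA' n.+2).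
    have [||z Vz zq] := (AP n.+1).2 q (p x); [by apply: qA => /=|by apply: xA => /=|].
    exists (x + z); first by rewrite chomD -/p zq addrC subrK.
    by rewrite addrAC subrr add0r.
  have [|l [xl lP]] := nested_cvg V0 VD Gc VP (x := x).
    by move=> k; have [_] := xP k.
  exists (p l) => U /(nbhs_shift _ _).1.
  move=> /(nbhs0_preimage p)/nbhs0_split[W [W0 Wop _ WU]].
  have [n nW] := VP _ W0.
  have /xl[m _ mW] := (nbhs_shiftB l _).2 W0.
  pose k := maxn n m.
  apply: filterS (FA' k.+1) => q qA.
  have [||z Vz zq] := (AP k.+1).2 q (p (x k)).
  + by apply: qA => /=.
  + by have [xA _] := xP k; apply: xA => /=.
  have : U (p l + p ((x k - l) + z)).
    apply: WU; first by apply: mW => /=; exact: leq_maxr.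
    apply: nW.
    have Vle i j y : (i <= j)%N -> V j y -> V i y.
      elim: j => [|j IH]; first by rewrite leqn0 => /eqP ->.
      rewrite leq_eqVlt => /orP[/eqP -> //|]; rewrite ltnS => ij /VS.
      exact: IH.
    by apply: Vle Vz; rewrite /k (leq_trans (leq_maxl n m)).
  by rewrite -chomD addrA subrKC chomD -/p zq addrC subrK.
- exists (p @` S); first exact: card_le_trans (card_image_le p S) Sc.
  move=> O [y Oy] oO; have [x px] := ps y; rewrite -px in Oy.
  have [||z [Oz Sz]] := Sd (p @^-1` O); last by exists (p z); split=> //; exists z.
    by exists x.
  by apply: open_comp oO => z _; exact: chom_continuous.
Qed.

Lemma dsum_nbhs0 (G H : topologicalZmodType) (U : set (dsum G H)) :
  nbhs 0 U <-> exists A B, [/\ nbhs (0 : G) A, nbhs (0 : H) B &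
    forall x y, A x -> B y -> U (x, y)].
Proof.
split=> [[[A B] /= [A0 B0] ABU]|[A [B [A0 B0 ABU]]]].
  by exists A, B; split=> // x y Ax By; exact: ABU.
by exists (A, B) => // -[x y] [/= Ax By]; exact: ABU.
Qed.

Lemma polish_dsum (G H : topologicalZmodType) :
  polish_group G -> polish_group H -> polish_group (dsum G H).
Proof.
move=> [Gh [B B0 BP] Gc [S Sc Sd]] [Hh [C C0 CP] Hc [T Tc Td]]; split.
- apply: group_hausdorff => -[x y] xy0; congr pair.
    apply: hausdorff_nbhs0 => // U U0.
    apply: (xy0 (fun z => U z.1)); apply/dsum_nbhs0.
    by exists U, setT; split=> //; exact: filterT.
  apply: hausdorff_nbhs0 => // U U0.
  apply: (xy0 (fun z => U z.2)); apply/dsum_nbhs0.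
  by exists setT, U; split=> //; exact: filterT.
- exists (fun k => if unpickle k is Some (n, m) then
      [set x : dsum G H | B n x.1 /\ C m x.2] else setT).
    move=> k; case: unpickle => [[n m]|]; last exact: filterT.
    by apply/dsum_nbhs0; exists (B n), (C m).
  move=> U /dsum_nbhs0[A [A' [/BP[n nA] /CP[m mA'] AU]]].
  exists (pickle (n, m)); rewrite pickleK => -[x y] /= [/nA Ax /mA'].
  exact: AU.
- move=> F FF FC.
  have [|x Fx] := Gc (fst @ F) _.
    move=> U U0; have [|z Fz] := FC (fun z => U z.1); last by exists z.1.
    by apply/dsum_nbhs0; exists U, setT; split=> //; exact: filterT.
  have [|y Fy] := Hc (snd @ F) _.
    move=> U U0; have [|z Fz] := FC (fun z => U z.2); last by exists z.2.
    by apply/dsum_nbhs0; exists setT, U; split=> //; exact: filterT.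
  exists (x, y) => W /= [[U V] /= [/Fx FU /Fy FV] UVW].
  apply: filterS (filterI (FU : F (fst @^-1` U)) (FV : F (snd @^-1` V))).
  by move=> [a b] [/= Ua Vb]; exact: UVW.
- exists (S `*` T); first exact: countableX.
  move=> O [[x y] Oxy] oO.
  have [[U V] /= [xU yV] UVO] := open_nbhs_nbhs (conj oO Oxy).
  move: xU yV; rewrite !nbhsE => -[U' [oU' U'x] U'U] [V' [oV' V'y] V'V].
  have [a [U'a Sa]] : U' `&` S !=set0 by apply: Sd => //; exists x.
  have [b [V'b Tb]] : V' `&` T !=set0 by apply: Td => //; exists y.
  by exists (a, b); split=> //; apply: UVO; split; [exact: U'U|exact: V'V].
Qed.

Lemma polish_real (R : realType) : polish_group R.
Proof.
split.
- exact: Rhausdorff.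
- exists (fun n => ball (0 : R) n.+1%:R^-1).
    by move=> n; apply: nbhsx_ballx; rewrite invr_gt0.
  move=> U /nbhs_ballP[e /= e0 eU].
  exists (Num.truncn e^-1); apply: subset_trans eU; apply: le_ball; apply: ltW.
  by rewrite -ltf_pV2 ?(posrE,invr_gt0)// invrK truncnS_gt.
- move=> F FF FC; apply/cvg_ex; apply: (@cauchy_cvg R F FF).
  apply: (cauchyP F).2 => e e0.
  have [x Fx] := FC _ (nbhsx_ballx (0 : R) _ e0).
  exists x; apply: filterS Fx => y.
  by rewrite /ball /= sub0r normrN distrC.
- exists (range (@ratr R)); last exact: dense_rat.
  exact: card_le_trans (card_image_le _ _) (countableP _).
Qed.

(* Banach's argument: by Baire's theorem the closure of the image of a
   neighborhood of 0 is a neighborhood of 0, and completeness of the source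
   removes the closure. *)
Lemma open_mapping (R : realType) (G H : topologicalZmodType) (f : chom G H) :
  polish_group G -> polish R H -> (forall y, exists x, f x = y) -> open_hom f.
Proof.
move=> [Gh Gb Gc [S Sc Sd]] Hp fs.
have [Hh _ _ _] := (polish_groupP R H).1 Hp.
have near_open U : nbhs 0 U -> nbhs 0 (closure (f @` U)).
  move=> U0; have [V [V0 Vop VU1 VU2]] := nbhs0_split U0.
  have [s sS] : exists s : nat -> G, forall x, exists n, V (x - s n).
    have S0 : S !=set0.
      have [|x [_ Sx]] := Sd setT _ openT; first by exists 0.
      by exists x.
    have /pfcard_geP[S0'|/unsquash s] := Sc; first by case: S0 => x; rewrite S0'.
    exists s => x; have := nbhs_shiftN x V0.
    rewrite nbhsE => -[A [oA Ax] AV].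
    have [|y [Ay /(@surj _ _ _ _ s)[n _ ny]]] := Sd A _ oA; first by exists x.
    by exists n; rewrite ny; exact: AV.
  have [|||n [y yP]] := @Baire_group R H
    (fun n => closure ((fun z => f (s n) + z) @` (f @` V))).
  - by case: Hp.
  - by move=> n; exact: closed_closure.
  - move=> y; have [x <-] := fs y; have [n nx] := sS x.
    exists n; apply: subset_closure; exists (f (x - s n)); first by exists (x - s n).
    by rewrite chomB subrKC.
  have : nbhs 0 (fun z => closure ((fun z => f (s n) + z) @` (f @` V)) (y + z)).
    exact: (nbhs_shift _ _).1.
  apply: filterS => z zP W /(nbhs_shift z _).1/nbhs0_split[W' [W0 W'op W'U _]].
  have yz := nbhs_singleton yP.
  have [_ [[_ [v1 Vv1 <-] <-] /= W1]] := zP _ ((nbhs_shiftB _ W').2 W0).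
  have [_ [[_ [v2 Vv2 <-] <-] /= W2]] := yz _ ((nbhs_shiftB _ W').2 W0).
  exists (f (v1 - v2)); split; first by exists (v1 - v2) => //; exact: VU1.
  have e (a p q : H) : z + (a + p - (y + z) - (a + q - y)) = p - q.
    rewrite (opprD y z) [- y - z]addrC (addrA (a + p)) (opprB _ y) subrKA.
    by rewrite addrAC opprD addrACA subrr add0r subrKC.
  by have := W'U _ _ W1 W2; rewrite e chomB.
have [V [V0 Vop VD VS VP]] := countable_base0_nested Gb.
have cV n y : closure (f @` V n) y ->
    exists2 x, V n x & closure (f @` V n.+1) (y - f x).
  move=> yV; have [_ [[x Vx <-] yx]] := yV _ (nbhs_shiftN y (near_open _ (V0 n.+1))).
  by exists x.
move=> U /nbhs0_closed[U' /VP[n0 n0U'] U'U].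
have W0 n : nbhs 0 (V (n0 + n)%N) by [].
have WD n x y : V (n0 + n.+1)%N x -> V (n0 + n.+1)%N y -> V (n0 + n)%N (x + y).
  by rewrite addnS; exact: VD.
have WP O : nbhs 0 O -> exists n, V (n0 + n)%N `<=` O.
  move=> /VP[n nO]; exists n; apply: subset_trans nO => x.
  by move: (n0) => d; elim: d => // d IH; rewrite addSn => /VS.
apply: filterS (near_open _ (W0 1%N)) => y y1.
have [||x [x0 xP]] := @dependent_choice_nat G
  (fun n x => closure (f @` V (n0 + n.+1)%N) (y - f x))
  (fun n x x' => V (n0 + n.+1)%N (x' - x)) 0.
- by rewrite chom0 subr0.
- move=> n x /cV[z Vz zP]; exists (x + z); last by rewrite addrAC subrr add0r.
  by rewrite chomD opprD addrA addnS.
have [|l [xl lP]] := nested_cvg W0 WD Gc WP (x := x).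
  by move=> k; have [_] := xP k.
exists l.
  apply: U'U; have := lP 0%N; rewrite x0 subr0 addn0.
  exact: closure_subset.
apply/esym/subr0_eq/hausdorff_nbhs0 => // O /nbhs0_split[E [E0 _ _ EO]].
have [E' E'0 E'E] := nbhs0_closed E0.
have [n nE'] := WP _ (nbhs0_preimage f E'0).
have /xl[m _ mP] := (nbhs_shiftB l _).2 (nbhs0_preimage f E0).
pose k := maxn n m.
rewrite -(subrKA (f (x k))); apply: EO.
  apply: E'E; have [yk _] := xP k; apply: closure_subset yk => _ [z Vz <-].
  apply: nE'.
  have : V (n0 + n + (k.+1 - n))%N z.
    by rewrite -addnA subnKC // (leq_trans (leq_maxl n m)).
  by elim: (k.+1 - n)%N => [|d IH]; rewrite ?addn0 // addnS => /VS.
by rewrite -chomB; apply: mP => /=; exact: leq_maxr.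
Qed.

(** * Extension of homomorphisms into divisible groups *)

Definition divisible (D : zmodType) :=
  forall n (d : D), (0 < n)%N -> exists d', d' *+ n = d.

Section DivisibleExtension.
Context (H D : zmodType).
Hypothesis Ddiv : divisible D.

(* The graph of an additive map defined on a subgroup of [H]. *)
Definition partial_hom (S : set (H * D)) :=
  [/\ S (0, 0), forall x y, S x -> S y -> S (x.1 - y.1, x.2 - y.2) &
      forall d, S (0, d) -> d = 0].

Lemma partial_homMz S x y k :
  partial_hom S -> S (x, y) -> S (x *~ k, y *~ k).
Proof.
move=> [S0 SB _] Sxy.
have SN z : S z -> S (- z.1, - z.2).
  by move=> Sz; have := SB _ _ S0 Sz; rewrite /= !sub0r.
have Sn n : S (x *+ n, y *+ n).
  elim: n => [|n IH]; first by rewrite !mulr0n.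
  by have := SB _ _ IH (SN _ Sxy); rewrite /= !opprK -!mulrSr.
case: k => n; first by rewrite -!pmulrn; exact: Sn.
by rewrite !NegzE !mulrNz -!pmulrn; exact: SN (Sn _).
Qed.

(** If a positive multiple of [b] is in the domain, the value at [b] is a quotient of the value at
    the least one, by divisibility; otherwise any value is consistent, and 0 is taken. *)
Let extend S b : partial_hom S -> exists S', [/\ partial_hom S', S `<=` S' &
  exists d, S' (b, d)].
Proof.
move=> Sh; have [S0 SB SF] := Sh.
pose P n := `[< (0 < n)%N /\ exists d, S (b *+ n, d) >].
have [d' d'P] : exists d', forall k y, S (b *~ k, y) -> y = d' *~ k.
  have [[n Pn]|nP] := pselect (exists n, P n).
    have [m /asboolP[m0 [d Sd]] mmin] := find_ex_minn (ex_intro _ n Pn).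
    have [d' d'd] := Ddiv d m0; exists d' => k y Sky.
    have [q [r [kqr rm]]] : exists q (r : nat), k = q * m%:Z + r%:Z /\ (r < m)%N.
      exists (divz k m%:Z), (`|modz k m%:Z|%N); split.
        by rewrite gez0_abs ?modz_ge0 -?divz_eq // -lt0n.
      by rewrite -ltz_nat gez0_abs ?modz_ge0 ?ltz_pmod -?lt0n.
    have Sm : S (b *~ (q * m%:Z), d *~ q).
      by rewrite mulrC mulrzA -pmulrn; exact: partial_homMz.
    have := SB _ _ Sky Sm; rewrite /= -mulrzBr kqr addrAC subrr add0r -pmulrn.
    have [->|r0] := posnP r.
      rewrite mulr0n => /SF/eqP; rewrite subr_eq0 => /eqP ->.
      by rewrite addr0 mulrC mulrzA -pmulrn d'd.
    move=> Sr; have /mmin : P r by apply/asboolP; split=> //; exists (y - d *~ q).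
    by rewrite leqNgt rm.
  exists 0 => k y Sky; rewrite mul0rz.
  have [k0|k0] := eqVneq k 0; first by apply: SF; rewrite k0 mulr0z in Sky.
  case: nP; exists `|k|%N; apply/asboolP; split; first by rewrite absz_gt0.
  case: k Sky k0 => k Sky _; first by exists y; rewrite pmulrn.
  by have := SB _ _ S0 Sky; rewrite /= NegzE mulrNz !sub0r opprK => Sk; exists (- y).
exists [set z | exists x y k, [/\ S (x, y), z.1 = x + b *~ k & z.2 = y + d' *~ k]].
split; last 2 first.
- by move=> [x y] Sxy; exists x, y, 0; rewrite !mulr0z !addr0.
- by exists d', 0, 0, 1; rewrite !add0r !mulr1z.
split.
- by exists 0, 0, 0; rewrite !mulr0z !addr0.
- move=> [u1 u2] [v1 v2] [x [y [k [Sxy /= -> ->]]]] [x' [y' [k' [Sxy' /= -> ->]]]].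
  exists (x - x'), (y - y'), (k - k'); split; first exact: (SB _ _ Sxy Sxy').
    by rewrite mulrzBr opprD addrACA.
  by rewrite mulrzBr opprD addrACA.
- move=> d [x [y [k [Sxy /= e ->]]]].
  have -> : d' *~ k = - y; last by rewrite subrr.
  apply/esym/d'P; have := SB _ _ S0 Sxy.
  have -> : b *~ k = - x by apply/eqP; rewrite -addr_eq0 addrC -e.
  by rewrite /= !sub0r.
Qed.

Lemma divisible_extension (S : set (H * D)) : partial_hom S ->
  exists2 h : H -> D, zmod_morphism h & forall x y, S (x, y) -> h x = y.
Proof.
move=> Sh.
pose P A := A = set0 \/ (partial_hom A /\ S `<=` A).
have [F FP Ftot|A [AP Amax]] := @Zorn_bigcup _ P.
  have [[B [FB [x Bx]]]|F0] := pselect (exists B, F B /\ B !=set0); last first.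
    left; apply/seteqP; split=> // x [B FB Bx]; apply: F0; exists B; split=> //.
    by exists x.
  right; have FB' C : F C -> C !=set0 -> partial_hom C /\ S `<=` C.
    by move=> /FP[->|//] [].
  have [[B0 _ _] SB] : partial_hom B /\ S `<=` B by apply: FB' => //; exists x.
  split; last by move=> z /SB Bz; exists B.
  split; first by exists B.
    move=> u v [C FC Cu] [E FE Ev].
    have [CE|EC] := Ftot _ _ FC FE.
      exists E => //; have [[_ EB _] _] := FB' _ FE (ex_intro _ _ Ev).
      by apply: EB => //; exact: CE.
    exists C => //; have [[_ CB _] _] := FB' _ FC (ex_intro _ _ Cu).
    by apply: CB => //; exact: EC.
  move=> d [C FC Cd]; have [[_ _ CF] _] := FB' _ FC (ex_intro _ _ Cd).
  exact: CF.
have [Ah SA] : partial_hom A /\ S `<=` A.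
  case: AP => [A0|//]; exfalso; apply: (Amax S); last by right; split.
  rewrite A0; split=> // /(_ (0, 0)) S0; apply: S0.
  by case: Sh.
have /choice[h hA] b : exists d, A (b, d).
  have [A' [A'h AA' [d A'd]]] := extend b Ah.
  apply: contrapT => nb; apply: (Amax A'); last first.
    by right; split=> //; exact: subset_trans AA'.
  by split=> // /(_ _ A'd) Abd; apply: nb; exists d.
have [A0 AB AF] := Ah.
have Auniq x y : A (x, y) -> h x = y.
  by move=> Axy; have := AB _ _ (hA x) Axy; rewrite /= subrr => /AF/subr0_eq.
exists h; last by move=> x y /SA/Auniq.
by move=> x y; apply: Auniq; exact: (AB _ _ (hA x) (hA y)).
Qed.

End DivisibleExtension.

(** * Closed subgroups of finite-dimensional spaces *)

Section UltrafilterLimits.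
Context {R : realType} (U : set_system nat) (UU : UltraFilter U).

(** Limits along an ultrafilter stand for convergent subsequences: several bounded sequences
    converge at once, without successive extractions. *)
Lemma ultra_bounded_cvg (a : nat -> R) B :
  (forall n, `|a n| <= B) -> exists l : R, a @ U --> l.
Proof.
move=> aB; have [|l [_ al]] := @segment_compact R (- B) B (a @ U) _.
  by apply: (@filterE _ U) => n; rewrite /= in_itv /= -ler_norml.
exists l => W lW; have [//|aW] := in_ultra_setVsetC (a @^-1` W) UU.
by have [y [nWy Wy]] := al (~` W) W aW lW.
Qed.

End UltrafilterLimits.

Lemma cvg_sum_ord {R : realType} {T : Type} (F : set_system T) {FF : Filter F}
    k (f : 'I_k -> T -> R) (l : 'I_k -> R) :
  (forall i, f i @ F --> l i) ->
  \sum_(i < k) f i n @[n --> F] --> \sum_(i < k) l i.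
Proof.
by move=> fl; apply: cvg_big => // x; exact: add_continuous.
Qed.

Section AdaptedBases.
Context {R : realType} {V : lmodType R} (M : set V).
Hypotheses (M0 : M 0) (MB : forall x y, M x -> M y -> M (x - y)).

Definition lin k (v : nat -> V) (x : nat -> R) := \sum_(i < k) x i *: v i.

Definition independent k v :=
  forall x, lin k v x = 0 -> forall i, (i < k)%N -> x i = 0.

(** Within the span of [v], the set [M] is a product of lines, where [tau] holds, and of copies of Z
    elsewhere. *)
Definition adapted k v (tau : nat -> bool) := independent k v /\
  forall x, M (lin k v x) <->
    forall i, (i < k)%N -> tau i || (x i \is a Num.int).

(** Closedness in the subspaces of finite dimension, expressed by coordinates because [V] has no
    topology; it will be a space of functions on the group. *)
Definition span_closed := forall k v (x : nat -> nat -> R) (l : nat -> R),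
  (forall i, (i < k)%N -> x n i @[n --> \oo] --> l i) ->
  (forall n, M (lin k v (x n))) -> M (lin k v l).

Lemma linD k v x y : lin k v (fun i => x i + y i) = lin k v x + lin k v y.
Proof. by rewrite -big_split; apply: eq_bigr => i _; rewrite scalerDl. Qed.

Lemma linZ k v a x : lin k v (fun i => a * x i) = a *: lin k v x.
Proof. by rewrite scaler_sumr; apply: eq_bigr => i _; rewrite scalerA. Qed.

Lemma linB k v x y : lin k v (fun i => x i - y i) = lin k v x - lin k v y.
Proof.
by rewrite -sumrB; apply: eq_bigr => i _; rewrite scalerBl.
Qed.

Lemma eq_lin k v w x y : (forall i, (i < k)%N -> x i = y i) ->
  (forall i, (i < k)%N -> v i = w i) -> lin k v x = lin k w y.
Proof. by move=> xy vw; apply: eq_bigr => i _; rewrite xy // vw. Qed.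

Definition extend_with {T : Type} k (f : nat -> T) t i := if i == k then t else f i.

Lemma extend_lt {T : Type} k (f : nat -> T) t i : (i < k)%N -> extend_with k f t i = f i.
Proof. by rewrite /extend_with; case: eqVneq => // ->; rewrite ltnn. Qed.

Lemma extend_eq {T : Type} k (f : nat -> T) t : extend_with k f t k = t.
Proof. by rewrite /extend_with eqxx. Qed.

Lemma lin_extend k v w x :
  lin k.+1 (extend_with k v w) x = lin k v x + x k *: w.
Proof.
rewrite /lin big_ord_recr /= extend_eq; congr (_ + _).
by apply: eq_bigr => i _; rewrite extend_lt.
Qed.

Let MN x : M x -> M (- x).
Proof. by move=> Mx; rewrite -sub0r; exact: MB. Qed.

Let MD x y : M x -> M y -> M (x + y).
Proof. by move=> Mx /MN My; rewrite -[y]opprK; exact: MB. Qed.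

Let MZ x z : M x -> M (x *~ z).
Proof.
move=> Mx; have Mn n : M (x *+ n).
  by elim: n => [|n IH]; rewrite ?mulr0n // mulrS; exact: MD.
by case: z => n; rewrite ?NegzE ?mulrNz -pmulrn //; exact: MN.
Qed.

Section Step.
Variables (k : nat) (v : nat -> V) (tau : nat -> bool) (u : V).
Hypotheses (Mcl : span_closed) (kvt : adapted k v tau) (Mu : M u)
  (uk : forall x, lin k v x <> u).

Let A (x : nat -> R) c := M (lin k v x + c *: u).

Let A_lin x : A x 0 <-> forall i, (i < k)%N -> tau i || (x i \is a Num.int).
Proof. by rewrite /A scale0r addr0; exact: (kvt.2 x). Qed.

Let AB x c y d : A x c -> A y d -> A (fun i => x i - y i) (c - d).
Proof. by move=> Ax Ay; rewrite /A linB scalerBl addrACA -opprD; exact: MB. Qed.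

Let AZ x c (z : int) : A x c -> A (fun i => z%:~R * x i) (z%:~R * c).
Proof.
by rewrite /A linZ -scalerA -scalerDr scaler_int; exact: MZ.
Qed.

(** The combination with coefficients [x] on [v] and [s] on the new vector has the coordinates
    [x i + s * x0 i] and [s * c0] with respect to [v] and [u], which turns the hypothesis into
    adaptedness. As [c0 != 0], the vector [u] is in the new span. *)
Let extend_adapted x0 (c0 : R) t : c0 != 0 ->
  (forall x s, A (fun i => x i + s * x0 i) (s * c0) <->
    A x 0 /\ (t || (s \is a Num.int))) ->
  adapted k.+1 (extend_with k v (lin k v x0 + c0 *: u)) (extend_with k tau t) /\
  exists x, lin k.+1 (extend_with k v (lin k v x0 + c0 *: u)) x = u.
Proof.
move=> c00 At; have [indep _] := kvt.
have linE x : lin k.+1 (extend_with k v (lin k v x0 + c0 *: u)) x =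
    lin k v (fun i => x i + x k * x0 i) + (x k * c0) *: u.
  by rewrite lin_extend linD linZ scalerDr scalerA addrA.
split; first split.
- move=> x; rewrite linE => x_0.
  have xk0 : x k = 0.
    apply: contrapT => /eqP xk; set y := fun i => _ in x_0.
    apply: (uk (x := fun i => - (x k * c0)^-1 * y i)); rewrite linZ.
    have /eqP -> : lin k v y == - ((x k * c0) *: u) by rewrite -addr_eq0 x_0.
    by rewrite scaleNr scalerN opprK scalerA mulVf ?scale1r // mulf_neq0.
  have x_k : forall i, (i < k)%N -> x i = 0.
    apply: indep; rewrite -[RHS]x_0 xk0 mul0r scale0r addr0.
    by apply: eq_lin => // i _; rewrite mul0r addr0.
  by move=> i; rewrite ltnS leq_eqVlt => /orP[/eqP ->//|]; exact: x_k.
- move=> x; rewrite linE; apply: iff_trans (At x (x k)) _.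
  rewrite A_lin; split=> [[xi xk] i|xi].
    rewrite ltnS leq_eqVlt => /orP[/eqP ->|ik]; first by rewrite extend_eq.
    by rewrite extend_lt //; exact: xi.
  split=> [i ik|]; last by have := xi k (ltnSn k); rewrite extend_eq.
  by have := xi i (ltnW ik); rewrite extend_lt.
- exists (extend_with k (fun i => - (c0^-1 * x0 i)) c0^-1).
  rewrite linE extend_eq mulVf // scale1r -[RHS]add0r; congr (_ + _).
  rewrite /lin big1 // => i _; rewrite extend_lt // addrC subrr.
  by rewrite scale0r.
Qed.

(** [span_closed] is about sequences: the filter provides indices [f m] at which all the coordinates
    are within [1 / (m + 1)] of their limits. *)
Let Acl (U : set_system nat) (UF : ProperFilter U)
    (x : nat -> nat -> R) (c : nat -> R) (l : nat -> R) (d : R) :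
  (forall i, (i < k)%N -> x n i @[n --> U] --> l i) -> c @ U --> d ->
  (forall n, A (x n) (c n)) -> A l d.
Proof.
move=> xl cd Ax.
have /choice[f fP] m : exists n,
    `|d - c n| < m.+1%:R^-1 /\ forall i : 'I_k, `|l i - x n i| < m.+1%:R^-1.
  suff : U [set n | `|d - c n| < m.+1%:R^-1 /\
      forall i : 'I_k, `|l i - x n i| < m.+1%:R^-1] by exact: filter_ex.
  apply: filterI.
    by move/cvgrPdist_lt : cd; apply; rewrite invr_gt0.
  apply: filter_forall => i.
  by have /cvgrPdist_lt := xl i (ltn_ord i); apply; rewrite invr_gt0.
have small (a : nat -> R) b : (forall m, `|b - a (f m)| < m.+1%:R^-1) ->
    a (f m) @[m --> \oo] --> b.
  move=> ab; apply/cvgrPdist_lt => e e0; exists (Num.truncn e^-1) => // m /= em.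
  apply: lt_trans (ab m) _.
  rewrite -ltf_pV2 ?(posrE,invr_gt0)// invrK (lt_le_trans (truncnS_gt _)) //.
  by rewrite ler_nat ltnS.
have := Mcl (k := k.+1) (v := extend_with k v u)
  (x := fun m => extend_with k (x (f m)) (c (f m))) (l := extend_with k l d).
rewrite lin_extend extend_eq /A.
have linE y e : lin k v (extend_with k y e) = lin k v y.
  by apply: eq_lin => // i ik; rewrite extend_lt.
rewrite linE; apply => [i|m]; last first.
  by rewrite lin_extend extend_eq linE; exact: Ax.
rewrite ltnS leq_eqVlt => /orP[/eqP ->|ik].
  rewrite extend_eq; under eq_fun do rewrite extend_eq.
  by apply: small => m; have [] := fP m.
rewrite extend_lt //; under eq_fun do rewrite extend_lt //.
by apply: (small (x ^~ i)) => m; have [_ /(_ (Ordinal ik))] := fP m.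
Qed.

(* The last coordinates of the elements of [M] form a discrete group: the new
   vector is one with the least positive coordinate. *)
Let step_discrete (e : R) : 0 < e -> (forall x c, A x c -> c != 0 -> e <= `|c|) ->
  exists w t, adapted k.+1 (extend_with k v w) (extend_with k tau t) /\
    exists x, lin k.+1 (extend_with k v w) x = u.
Proof.
move=> e0 eA.
(* The least positive last coordinate is reached by minimizing the integer [truncn (c / e)]: two
   distinct last coordinates are at least [e] apart, so this integer tells them apart. *)
pose P n := `[< exists x c, [/\ A x c, 0 < c & Num.truncn (c / e) = n] >].
have P1 : exists n, P n.
  exists (Num.truncn (1 / e)); apply/asboolP; exists (fun=> 0), 1; split=> //.
  rewrite /A (_ : lin _ _ _ = 0) ?scale1r ?add0r //.
  by rewrite /lin big1 // => i _; rewrite scale0r.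
have [m /asboolP[x0 [c0 [A0 c00 c0m]]] mmin] := find_ex_minn P1.
have c0min x c : A x c -> 0 <= c < c0 -> c = 0.
  move=> Axc /andP[c_0 cc0]; apply: contrapT => /eqP c_n0.
  have cp : 0 < c by rewrite lt_def c_n0.
  have /mmin mc : P (Num.truncn (c / e)) by apply/asboolP; exists x, c.
  have /(eA _ _ (AB A0 Axc)) : c0 - c != 0 by rewrite subr_eq0 gt_eqF.
  rewrite gtr0_norm ?subr_gt0 // => ec.
  have : c0 / e < m.+1%:R by rewrite -c0m truncnS_gt.
  have : m%:R <= c / e.
    by rewrite -truncn_ge_nat // divr_ge0 // ltW.
  rewrite ler_pdivlMr // ltr_pdivrMr // -natr1; lra.
exists (lin k v x0 + c0 *: u), false.
apply: extend_adapted; first by rewrite gt_eqF.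
move=> x s; split=> [Axs|[Ax /= sZ]].
  have := AB Axs (AZ (Num.floor s) A0); rewrite -mulrBl => As.
  have s0 : (s - (Num.floor s)%:~R) * c0 = 0.
    apply: (c0min _ _ As); have /andP[s1 s2] := floor_itv s.
    apply/andP; split; first by rewrite mulr_ge0 ?subr_ge0 // ltW.
    by rewrite gtr_pMl // ltrBlDl -intrD1.
  move: s0 As => /[dup] + -> => /eqP; rewrite mulf_eq0 (gt_eqF c00) orbF.
  rewrite subr_eq0 => /eqP sE; rewrite /A -sE.
  have -> : lin k v (fun i => x i + s * x0 i - s * x0 i) = lin k v x.
    by apply: eq_lin => // i _; rewrite addrK.
  by split=> //; rewrite sE intr_int.
have /intrP[z sz] := sZ.
have := AB Ax (AZ (- z) A0); rewrite sub0r -mulNr -intrN opprK -sz /A.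
rewrite (eq_lin (w := v) (y := fun i => x i + s * x0 i)) // => i _.
by rewrite intrN mulNr opprK sz.
Qed.

(* The last coordinates of the elements of [M] accumulate at 0: a limit of
   multiples of shorter and shorter elements of [M] spans a line in [M]. *)
Let step_dense :
  (forall e : R, 0 < e -> exists x c, [/\ A x c, c != 0 & `|c| < e]) ->
  exists w t, adapted k.+1 (extend_with k v w) (extend_with k tau t) /\
    exists x, lin k.+1 (extend_with k v w) x = u.
Proof.
move=> Ae.
pose supp (x : nat -> R) := forall i, tau i || (k <= i)%N -> x i = 0.
have /choice[xc xcP] n : exists z : (nat -> R) * R, [/\ A z.1 z.2, z.2 != 0,
    `|z.2| < n.+1%:R^-1, supp z.1 & forall i, `|z.1 i| <= 1].
  have [|x [c [Axc c0 cn]]] := Ae n.+1%:R^-1; first by rewrite invr_gt0.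
  (* An element of [M] in the span of [v] is subtracted: the whole coordinate along a line, its
     integer part elsewhere. The remaining coordinates are bounded by 1 and vanish along the
     lines. *)
  pose y i : R := if tau i || (k <= i)%N then x i else (Num.floor (x i))%:~R.
  exists (fun i => x i - y i, c); split=> //=.
  - rewrite -[c]subr0; apply: AB => //; apply/A_lin => i ik.
    by rewrite /y; case: (tau i) => //=; rewrite leqNgt ik intr_int.
  - by move=> i ti; rewrite /y ti subrr.
  - move=> i; rewrite /y; case: ifP => _; first by rewrite subrr normr0 ler01.
    have /andP[x1 x2] := floor_itv (x i).
    rewrite intrD1 in x2; rewrite ger0_norm; lra.
have [U [UU Uoo]] := ultraFilterLemma eventually_filter.
have /choice[a aP] i : exists l : R, (xc n).1 i @[n --> U] --> l.
  by apply: (@ultra_bounded_cvg _ U UU _ 1) => n; have [] := xcP n.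
have c_0 : (xc n).2 @[n --> U] --> (0 : R).
  apply/cvgrPdist_lt => e e0; apply: Uoo.
  exists (Num.truncn e^-1) => // m /= em; rewrite sub0r normrN.
  have [_ _ cm _ _] := xcP m; apply: lt_trans cm _.
  rewrite -ltf_pV2 ?(posrE,invr_gt0)// invrK (lt_le_trans (truncnS_gt _)) //.
  by rewrite ler_nat ltnS.
have A_a : A a 0 by apply: Acl c_0 _ => [i _|n]; [exact: aP|have [] := xcP n].
have a_supp : supp a.
  move=> i ti; apply: cvg_unique (aP i) _ => //.
  rewrite (_ : (fun n => _) = cst 0); first exact: cvg_cst.
  by apply/funext => n; have [_ _ _ + _] := xcP n; exact.
(* Once the limit [a] is subtracted, the elements [(b n, c n)] are nonzero and tend to 0. *)
pose b n i := (xc n).1 i - a i.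
pose c n := (xc n).2.
have Ab n : A (b n) (c n).
  by rewrite -[c n]subr0; apply: AB => //; have [] := xcP n.
have b_supp n : supp (b n).
  by move=> i ti; rewrite /b a_supp //; have [_ _ _ -> //] := xcP n; rewrite subr0.
have b0 i : b n i @[n --> U] --> (0 : R).
  by rewrite -(subrr (a i)); apply: cvgB => //; exact: cvg_cst.
pose r n := `|c n| + \sum_(i < k) `|b n i|.
have sum_ge0 n : 0 <= \sum_(i < k) `|b n i| by apply: sumr_ge0.
have r0 n : 0 < r n.
  by rewrite /r ltr_pwDl // normr_gt0; have [] := xcP n.
have r_0 : r n @[n --> U] --> (0 : R).
  have : \sum_(i < k) `|b n i| @[n --> U] --> \sum_(i < k) `|0 : R|.
    by apply: (cvg_sum_ord (f := fun i n => `|b n i|)) => i; exact: cvg_norm.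
  rewrite big1 => [s0|i _]; last exact: normr0.
  rewrite -[X in _ --> X]addr0; apply: cvgD => //.
  by rewrite -(normr0 R); exact: cvg_norm.
(* Multiplication by the integer [N n] brings the norm [r n] close to 1, so that the limit [(w, d)]
   has norm 1. *)
pose N n : R := (Num.truncn (r n)^-1)%:R.
have N0 n : 0 <= N n by [].
have Nr n : 1 - r n <= N n * r n <= 1.
  have /andP[N1 N2] : N n <= (r n)^-1 < N n + 1.
    by rewrite natr1; apply: truncn_itv; rewrite invr_ge0 ltW.
  rewrite -ler_pdivlMr // div1r N1 andbT.
  have : (r n)^-1 * r n <= (N n + 1) * r n by rewrite ler_pM2r // ltW.
  by rewrite mulVf ?gt_eqF //; lra.
have bdd n (t : R) : `|t| <= r n -> `|N n * t| <= 1.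
  move=> tr; rewrite normrM ger0_norm //.
  by have /andP[_] := Nr n; apply: le_trans; rewrite ler_wpM2l.
have b_le n i : `|b n i| <= r n.
  have [ik|ki] := ltnP i k; last by rewrite b_supp ?ki ?orbT // normr0 ltW.
  rewrite /r (bigD1 (Ordinal ik)) //= addrCA lerDl addr_ge0 //.
  exact: sumr_ge0.
have c_le n : `|c n| <= r n by rewrite /r lerDl.
have /choice[w wP] i : exists l : R, N n * b n i @[n --> U] --> l.
  by apply: (@ultra_bounded_cvg _ U UU _ 1) => n; exact: bdd.
have [d dP] : exists l : R, N n * c n @[n --> U] --> l.
  by apply: (@ultra_bounded_cvg _ U UU _ 1) => n; exact: bdd.
have w_supp : supp w.
  move=> i ti; apply: cvg_unique (wP i) _ => //.
  rewrite (_ : (fun n => _) = cst 0); first exact: cvg_cst.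
  by apply/funext => n; rewrite b_supp // mulr0.
have wd1 : `|d| + \sum_(i < k) `|w i| = 1.
  have l1 : N n * r n @[n --> U] --> `|d| + \sum_(i < k) `|w i|.
    rewrite (_ : (fun n => _) = (fun n => `|N n * c n| + \sum_(i < k) `|N n * b n i|)).
      apply: cvgD; first exact: cvg_norm.
      by apply: (cvg_sum_ord (f := fun i n => `|N n * b n i|)) => i; exact: cvg_norm.
    apply/funext => n; rewrite /r mulrDr mulr_sumr normrM (ger0_norm (N0 n)).
    by congr (_ + _); apply: eq_bigr => i _; rewrite normrM (ger0_norm (N0 n)).
  apply: cvg_unique l1 _ => //.
  apply: (squeeze_cvgr (f := fun n => 1 - r n) (h := cst 1)).
  - by apply: (@filterE _ U) => n; exact: Nr.
  - by rewrite -[X in _ --> X]subr0; apply: cvgB => //; exact: cvg_cst.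
  - exact: cvg_cst.
(* The integer multiples by [floor (s * N n)] tend to [s] times the limit, because a bounded
   rounding error multiplies a null sequence. Thus [M] contains the whole line of [(w, d)]. *)
have frac_cvg s (t : nat -> R) l : t @ U --> (0 : R) -> N n * t n @[n --> U] --> l ->
    (Num.floor (s * N n))%:~R * t n @[n --> U] --> s * l.
  move=> t0 tl; rewrite -[s * l]subr0.
  rewrite (_ : (fun n => _) = fun n => s * (N n * t n) -
     (s * N n - (Num.floor (s * N n))%:~R) * t n); last first.
    by apply/funext => n; rewrite mulrBl opprB mulrA addrC subrK.
  apply: cvgB; first exact: cvgMr.
  apply/norm_cvg0P; apply: (squeeze_cvgr (f := cst 0) (h := fun n => `|t n|)).
  - apply: (@filterE _ U) => n; rewrite normr_ge0 /= normrM.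
    have /andP[s1 s2] := floor_itv (s * N n); rewrite intrD1 in s2.
    rewrite ler_piMl //; rewrite ger0_norm; lra.
  - exact: cvg_cst.
  - by rewrite -(normr0 R); exact: cvg_norm.
have Aline s : A (fun i => s * w i) (s * d).
  apply: (@Acl U _ (fun n i => (Num.floor (s * N n))%:~R * b n i)
    (fun n => (Num.floor (s * N n))%:~R * c n)).
  - by move=> i _; exact: frac_cvg.
  - exact: frac_cvg.
  - by move=> n; exact: AZ.
(* Otherwise the line is in the span of [v] and some [w i] with [tau i] false is nonzero; rescaled,
   it gives the coordinate [2^-1], which is not an integer. *)
have d0 : d != 0.
  apply/eqP => d_0; move: wd1; rewrite d_0 normr0 add0r big1.
    by move/eqP; rewrite eq_sym oner_eq0.
  move=> i _; apply/eqP; rewrite normr_eq0; apply/eqP.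
  case ti : (tau i); first by apply: w_supp; rewrite ti.
  apply: contrapT => /eqP wi0.
  have := Aline (2^-1 / w i); rewrite d_0 mulr0 => /A_lin/(_ i (ltn_ord i)).
  rewrite ti divfK //= => /intrP[z zE].
  have : (z * 2)%:~R = (1 : int)%:~R :> R by rewrite intrM -zE mulVf.
  by move/intr_inj; lia.
exists (lin k v w + d *: u), true; apply: extend_adapted => // x s /=.
split=> [Axs|[Ax _]].
  split=> //; have := AB Axs (Aline s); rewrite subrr /A.
  by rewrite (eq_lin (w := v) (y := x)) // => i _; rewrite addrK.
have := AB Ax (Aline (- s)); rewrite sub0r mulNr opprK /A.
rewrite (eq_lin (w := v) (y := fun i => x i + s * w i)) // => i _.
by rewrite mulNr opprK.
Qed.

Lemma adapted_step : exists w t,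
  adapted k.+1 (extend_with k v w) (extend_with k tau t) /\
  exists x, lin k.+1 (extend_with k v w) x = u.
Proof.
have [[e [e0 eA]]|nA] := pselect (exists e : R, 0 < e /\
    forall x c, A x c -> c != 0 -> e <= `|c|); first exact: step_discrete eA.
apply: step_dense => e e0; apply: contrapT => nx; apply: nA; exists e.
split=> // x c Axc c0; rewrite leNgt; apply/negP => ce.
by apply: nx; exists x, c.
Qed.

End Step.
End AdaptedBases.

Section AdaptedExtensions.
Context {R : realType} {V : lmodType R} (M : set V).

Lemma eq_adapted k (v w : nat -> V) tau sigma :
  (forall i, (i < k)%N -> v i = w i) -> (forall i, (i < k)%N -> tau i = sigma i) ->
  adapted M k v tau -> adapted M k w sigma.
Proof.
move=> vw ts [vi vM].
have linE x : lin k w x = lin k v x by apply: eq_lin => // i ik; rewrite vw.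
split=> [x|x]; rewrite linE; first exact: vi.
by rewrite vM; split=> xi i ik; [rewrite -ts|rewrite ts] => //; exact: xi.
Qed.

Lemma independent_extend k (v : nat -> V) u : independent k v ->
  (forall x, lin k v x <> u) -> independent k.+1 (extend_with k v u).
Proof.
move=> vi uk x; rewrite lin_extend => x0.
have xk0 : x k = 0.
  apply: contrapT => /eqP xk.
  apply: (uk (fun i => - (x k)^-1 * x i)); rewrite linZ.
  have /eqP -> : lin k v x == - (x k *: u) by rewrite -addr_eq0 x0.
  by rewrite scaleNr scalerN opprK scalerA mulVf // scale1r.
have x_k : forall i, (i < k)%N -> x i = 0.
  by apply: vi; rewrite -[RHS]x0 xk0 scale0r addr0.
by move=> i; rewrite ltnS leq_eqVlt => /orP[/eqP ->//|]; exact: x_k.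
Qed.

Hypotheses (M0 : M 0) (MB : forall x y, M x -> M y -> M (x - y)).
Hypothesis (Mcl : span_closed M).

Lemma adapted_step_or k (v : nat -> V) tau u : adapted M k v tau -> M u ->
  exists k' v' tau', [/\ adapted M k' v' tau', (k <= k')%N,
    forall i, (i < k)%N -> v' i = v i, forall i, (i < k)%N -> tau' i = tau i &
    exists x, lin k' v' x = u].
Proof.
move=> kvt Mu; have [uk|uk] := pselect (exists x, lin k v x = u).
  by exists k, v, tau.
have [|w [t [kwt wu]]] := adapted_step M0 MB Mcl kvt Mu.
  by move=> x xu; apply: uk; exists x.
exists k.+1, (extend_with k v w), (extend_with k tau t); split=> // i ik;
  by rewrite extend_lt.
Qed.

(** Vectors already chosen are never changed, so the successive families are initial segments of one
    sequence. [K] may be bounded: an index that is never reached receives an arbitrary value, that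
    of stage 0. *)
Lemma adapted_sequence (u : nat -> V) : (forall j, M (u j)) ->
  exists (K : nat -> nat) (v : nat -> V) (tau : nat -> bool),
  [/\ forall j, adapted M (K j) v tau, forall j, (K j <= K j.+1)%N &
      forall j, exists x, lin (K j.+1) v x = u j].
Proof.
move=> Mu.
have [||s [s0 sP]] := @dependent_choice_nat (nat * (nat -> V) * (nat -> bool))%type
  (fun _ s => adapted M s.1.1 s.1.2 s.2)
  (fun j s s' => [/\ (s.1.1 <= s'.1.1)%N,
    forall i, (i < s.1.1)%N -> s'.1.2 i = s.1.2 i,
    forall i, (i < s.1.1)%N -> s'.2 i = s.2 i &
    exists x, lin s'.1.1 s'.1.2 x = u j]) (0%N, u, fun=> false).
- split=> [x _ i //|x]; rewrite /= /lin big_ord0; split=> // _.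
- move=> j [[k v] tau] /= kvt.
  have [k' [v' [tau' [kvt' kk' vv' tt' xu]]]] := adapted_step_or kvt (Mu j).
  by exists (k', v', tau').
pose K j := (s j).1.1.
have Kle j d : (K j <= K (j + d))%N.
  elim: d => [|d IH]; first by rewrite addn0.
  by rewrite addnS (leq_trans IH) //; have [_ []] := sP (j + d)%N.
have agree j d i : (i < K j)%N ->
    (s (j + d)%N).1.2 i = (s j).1.2 i /\ (s (j + d)%N).2 i = (s j).2 i.
  move=> ij; elim: d => [|d [IH1 IH2]]; first by rewrite addn0.
  have [_ [_ e1 e2 _]] := sP (j + d)%N.
  by rewrite addnS e1 ?e2 //; exact: leq_trans ij (Kle _ _).
have /choice[J JP] i : exists j, (exists j', (i < K j')%N) -> (i < K j)%N.
  by have [[j ij]|nj] := pselect (exists j', (i < K j')%N); [exists j|exists 0%N].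
have agree' j i : (i < K j)%N ->
    (s (J i)).1.2 i = (s j).1.2 i /\ (s (J i)).2 i = (s j).2 i.
  move=> ij; have iJ := JP i (ex_intro _ j ij).
  have [jJ|/ltnW Jj] := leqP j (J i).
    by have := agree j (J i - j)%N i ij; rewrite subnKC.
  by have := agree (J i) (j - J i)%N i iJ; rewrite subnKC // => -[-> ->].
exists K, (fun i => (s (J i)).1.2 i), (fun i => (s (J i)).2 i); split.
- move=> j; have [] := sP j; move=> + _; apply: eq_adapted => i ij.
    by have [] := agree' j i ij.
  by have [] := agree' j i ij.
- by move=> j; rewrite -addn1; exact: Kle.
- move=> j; have [_ [_ _ _ [x xu]]] := sP j; exists x; rewrite -xu.
  by apply: eq_lin => // i ij; have [] := agree' j.+1 i ij.
Qed.

End AdaptedExtensions.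

(** The three kinds of directions for a closed subgroup of R^m: a line, a copy of Z, and, for
    [None], a direction outside its span. *)
Definition coord_ok {R : realType} (t : option bool) (x : R) : Prop :=
  match t with
  | Some true => True
  | Some false => x \is a Num.int
  | None => x = 0
  end.

Section ClosedSubgroups.
Context {R : realType} {m : nat}.
Local Notation V := 'rV[R]_m.

Lemma lin_mulmx k (v : nat -> V) x :
  lin k v x = (\row_(i < k) x i) *m (\matrix_(i < k) v i).
Proof.
by rewrite mulmx_sum_row; apply: eq_bigr => i _; rewrite mxE rowK.
Qed.

Lemma independent_row_free k (v : nat -> V) :
  independent k v -> row_free (\matrix_(i < k) v i).
Proof.
move=> vi; rewrite -kermx_eq0; apply/eqP/row_matrixP => i; rewrite row0.
set z := row i _.
have zv : z *m (\matrix_(i < k) v i) = 0 by rewrite -row_mul mulmx_ker row0.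
apply/rowP => j; rewrite [RHS]mxE.
pose x n := if insub n is Some i then z 0 i else 0.
have xE (l : 'I_k) : x l = z 0 l by rewrite /x valK.
rewrite -xE; apply: (vi _ _ _ (ltn_ord j)).
rewrite lin_mulmx (_ : (\row_(_ < _) _) = z) //.
by apply/rowP => l; rewrite mxE xE.
Qed.

Lemma independent_leq k (v : nat -> V) : independent k v -> (k <= m)%N.
Proof. by move=> /independent_row_free/eqP <-; exact: rank_leq_col. Qed.

Lemma independent_basis k (v : nat -> V) : independent k v ->
  exists2 w, independent m w & forall i, (i < k)%N -> w i = v i.
Proof.
move En : (m - k)%N => n; elim: n k v En => [|n IH] k v En vi.
  have km : k = m.
    by apply/eqP; rewrite eqn_leq (independent_leq vi) -subn_eq0 En.
  by rewrite km in vi; exists v.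
have /row_subPn[i nui] : ~~ (1%:M <= \matrix_(i < k) v i)%MS.
  apply/negP => /mxrankS; rewrite mxrank1 leqNgt => /negP; apply.
  by rewrite (eqP (independent_row_free vi)) -subn_gt0 En.
have [||w wi wE] := IH k.+1 (extend_with k v (row i 1%:M)).
- by rewrite subnS En.
- apply: independent_extend => // x xu; move/negP: nui; apply.
  by rewrite -xu lin_mulmx submxMl.
exists w => // j jk; rewrite wE ?extend_lt //; exact: ltnW.
Qed.

Variable M : set V.
Hypotheses (M0 : M 0) (MB : forall x y, M x -> M y -> M (x - y)).
Hypothesis Mcl : forall (x : nat -> V) (l : V),
  (forall j, x n 0 j @[n --> \oo] --> l 0 j) -> (forall n, M (x n)) -> M l.

Lemma row_span_closed : span_closed M.
Proof.
move=> k v x l xl Mx; apply: Mcl Mx => j.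
rewrite /lin summxE; under eq_fun do rewrite summxE.
apply: (cvg_sum_ord (f := fun i n => (x n i *: v i) 0 j)) => i.
rewrite mxE; under eq_fun do rewrite mxE.
by apply: cvgMl; apply: xl.
Qed.

Lemma adapted_span k (v : nat -> V) tau : adapted M k v tau ->
  exists k' v' tau', [/\ adapted M k' v' tau', (k <= k')%N,
    forall i, (i < k)%N -> v' i = v i, forall i, (i < k)%N -> tau' i = tau i &
    forall u, M u -> exists x, lin k' v' x = u].
Proof.
move En : (m - k)%N => n; elim: n k v tau En => [|n IH] k v tau En kvt;
    have [kM|nM] := pselect (forall u, M u -> exists x, lin k v x = u);
    try by exists k, v, tau.
  case: nM => u _; have vfree := independent_row_free kvt.1.
  have : (u <= \matrix_(i < k) v i)%MS.
    apply: submx_full; rewrite /row_full (eqP vfree) eqn_leq (independent_leq kvt.1).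
    by rewrite -subn_eq0 En.
  move=> /submxP[z ->]; exists (fun n => if insub n is Some i then z 0 i else 0).
  rewrite lin_mulmx; congr (_ *m _); apply/rowP => i; rewrite mxE.
  by rewrite valK.
have [u [Mu uk]] : exists u, M u /\ forall x, lin k v x <> u.
  apply: contrapT => nu; apply: nM => u Mu; apply: contrapT => nx.
  by apply: nu; exists u; split=> // x xu; apply: nx; exists x.
have [w [t [kwt wu]]] := adapted_step M0 MB row_span_closed kvt Mu uk.
have [|k' [v' [tau' [kvt' kk' vv' tt' sp]]]] := IH _ _ _ _ kwt.
  by rewrite subnS En.
exists k', v', tau'; split=> //; first exact: ltnW.
  by move=> i ik; rewrite vv' ?extend_lt // ltnW.
by move=> i ik; rewrite tt' ?extend_lt // ltnW.
Qed.

(** The adapted family is enlarged until it spans [M] and then completed to a basis; [P] is the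
    inverse of its matrix. The initial vectors are kept for the sake of [circle_linear_lift], where
    a prescribed vector has to be one of the basis. *)
Lemma closed_subgroup_coordinates k (v : nat -> V) tau : adapted M k v tau ->
  exists (P : 'M[R]_m) (t : 'I_m -> option bool), [/\ P \in unitmx,
    forall z, M z <-> forall i, coord_ok (t i) ((z *m P) 0 i) &
    forall i : 'I_m, (i < k)%N -> v i *m P = delta_mx 0 i /\ t i = Some (tau i)].
Proof.
move=> /adapted_span[k' [v' [tau' [[v'i v'M] kk' vv' tt' sp]]]].
have [w wi wE] := independent_basis v'i.
pose Q := \matrix_(i < m) w i.
have Qu : Q \in unitmx by rewrite -row_free_unit; exact: independent_row_free.
have k'm := independent_leq v'i.
exists (invmx Q), (fun i => if (i < k')%N then Some (tau' i) else None).
split; first by rewrite unitmx_inv.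
- move=> z; pose x n := if insub n is Some i then (z *m invmx Q) 0 i else 0.
  have xE (i : 'I_m) : x i = (z *m invmx Q) 0 i by rewrite /x valK.
  have zE : z = lin m w x.
    rewrite lin_mulmx (_ : (\row_(_ < _) _) = z *m invmx Q) ?mulmxKV //.
    by apply/rowP => i; rewrite mxE xE.
  have split_lin y : lin m w y = lin k' v' y + \sum_(k' <= i < m) y i *: w i.
    rewrite /lin -(big_mkord xpredT (fun i => y i *: w i)).
    rewrite (@big_cat_nat _ _ _ k') //= big_mkord; congr (_ + _).
    by apply: eq_bigr => i _; rewrite wE.
  split=> [Mz i|zi].
    have [y yz] := sp z Mz.
    pose y' n := if (n < k')%N then y n else 0.
    have : lin m w (fun i => x i - y' i) = 0.
      rewrite linB -zE split_lin -yz (@big_nat_cond) big1 ?addr0.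
        rewrite [X in _ - X](_ : _ = lin k' v' y) ?subrr //.
        by apply: eq_lin => // j jk; rewrite /y' jk.
      by move=> j /andP[/andP[kj _] _]; rewrite /y' ltnNge kj scale0r.
    move=> /wi/(_ i (ltn_ord i))/subr0_eq; rewrite xE => ->.
    rewrite /y'; case: ifP => //= ik.
    have := (v'M y).1; rewrite yz => /(_ Mz i ik).
    by case: (tau' i).
  rewrite zE split_lin (@big_nat_cond) big1 ?addr0.
    apply/v'M => i ik; have im := leq_trans ik k'm.
    have := zi (Ordinal im); rewrite /= ik -xE /=.
    by case: (tau' i).
  move=> j /andP[/andP[kj jm] _]; have := zi (Ordinal jm).
  by rewrite /= ltnNge kj /= -xE /= => ->; rewrite scale0r.
- move=> i ik; have ik' := leq_trans ik kk'; rewrite ik' tt' //; split=> //.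
  have -> : v i = row i Q by rewrite rowK wE // vv'.
  by rewrite -row_mul mulmxV // row1.
Qed.

End ClosedSubgroups.

Section RowClosure.
Context {R : realType} {m : nat} (S : set 'rV[R]_m).
Hypotheses (S0 : S 0) (SB : forall x y, S x -> S y -> S (x - y)).

Definition row_closure : set 'rV[R]_m := [set z | forall d : R, 0 < d ->
  exists2 w, S w & forall i, `|z 0 i - w 0 i| < d].

Lemma subset_row_closure : S `<=` row_closure.
Proof. by move=> z Sz d d0; exists z => // i; rewrite subrr normr0. Qed.

Lemma row_closure0 : row_closure 0. Proof. exact: subset_row_closure. Qed.

Lemma row_closureB x y : row_closure x -> row_closure y -> row_closure (x - y).
Proof.
move=> Mx My d d0; have d20 : 0 < d / 2 by rewrite divr_gt0.
have [a Sa aP] := Mx _ d20; have [b Sb bP] := My _ d20.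
exists (a - b); first exact: SB.
move=> i; rewrite [(x - y) 0 i]mxE [(- y) 0 i]mxE [(a - b) 0 i]mxE [(- b) 0 i]mxE.
rewrite (_ : _ - _ = (x 0 i - a 0 i) - (y 0 i - b 0 i)); last by ring.
have := ler_normB (x 0 i - a 0 i) (y 0 i - b 0 i).
have := aP i; have := bP i; lra.
Qed.

Lemma row_closure_cvg (x : nat -> 'rV[R]_m) (l : 'rV[R]_m) :
  (forall j, x n 0 j @[n --> \oo] --> l 0 j) -> (forall n, row_closure (x n)) ->
  row_closure l.
Proof.
move=> xl Mx d d0; have d20 : 0 < d / 2 by rewrite divr_gt0.
have : \forall n \near \oo, forall j, `|l 0 j - x n 0 j| < d / 2.
  by apply: filter_forall => j; have /cvgrPdist_lt := xl j; apply.
move=> /filter_ex[n nP].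
have [a Sa aP] := Mx n _ d20; exists a => // i.
have := ler_normD (l 0 i - x n 0 i) (x n 0 i - a 0 i).
by rewrite subrKA; have := aP i; have := nP i; lra.
Qed.

End RowClosure.

(** * The circle *)

Section Circle.
Context {R : realType}.
Local Notation T := (circle R).
Implicit Types (t : R) (x y : T).

Definition circle_pi : chom R T := quotient_pi (@int_pred R : zmodClosed R).

Lemma circle_pi_eq0 t : circle_pi t = 0 <-> t \is a Num.int.
Proof. exact: quotient_pi_eq0. Qed.

Lemma circle_pi_eq t t' : circle_pi t = circle_pi t' <-> t - t' \is a Num.int.
Proof.
rewrite -circle_pi_eq0 chomB; split=> [->|/subr0_eq//]; exact: subrr.
Qed.

Lemma circle_pi_surj x : exists t, circle_pi t = x.
Proof. exact: quotient_pi_surj. Qed.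

Lemma circle_pi_open : open_hom circle_pi.
Proof. exact: quotient_pi_open. Qed.

Fact crep_exists x : exists t, circle_pi t = x /\ - 2^-1 <= t < 2^-1.
Proof.
have [t <-] := circle_pi_surj x.
exists (t - (Num.floor (t + 2^-1))%:~R); split.
  by apply/circle_pi_eq; rewrite addrAC subrr add0r rpredN intr_int.
have /andP[] := floor_itv (t + 2^-1); rewrite intrD1; lra.
Qed.

(** The absolute value of this representative is the distance to 0 in the circle, and serves as a
    norm there. *)
Definition crep x : R := projT1 (cid (crep_exists x)).

Lemma crepK x : circle_pi (crep x) = x.
Proof. by have [] := projT2 (cid (crep_exists x)). Qed.

Lemma crep_itv x : - 2^-1 <= crep x < 2^-1.
Proof. by have [] := projT2 (cid (crep_exists x)). Qed.

Lemma int_lt1 t : t \is a Num.int -> `|t| < 1 -> t = 0.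
Proof.
move=> /intrP[z ->]; rewrite -intr_norm -[1]/(1%:~R) ltr_int => z1.
by have -> : z = 0 by lia.
Qed.

Lemma crep_circle_pi t : `|t| < 2^-1 -> crep (circle_pi t) = t.
Proof.
move=> t2; apply: subr0_eq; apply: int_lt1.
  by apply/circle_pi_eq; rewrite crepK.
have /andP[] := crep_itv (circle_pi t).
by move: t2; rewrite !ltr_norml => /andP[]; lra.
Qed.

Lemma crep_le t : `|crep (circle_pi t)| <= `|t|.
Proof.
have [/crep_circle_pi -> //|t2] := ltP `|t| 2^-1.
apply: le_trans t2; have /andP[] := crep_itv (circle_pi t).
by rewrite ler_norml => ? ?; apply/andP; split=> //; exact: ltW.
Qed.

Lemma crep0 : crep 0 = 0.
Proof. by rewrite -(chom0 circle_pi) crep_circle_pi // normr0 invr_gt0. Qed.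

Lemma crep_triangle x y : `|crep (x + y)| <= `|crep x| + `|crep y|.
Proof.
by rewrite -{1}(crepK x) -{1}(crepK y) -chomD (le_trans (crep_le _)) // ler_normD.
Qed.

Lemma crep_normN x : `|crep (- x)| = `|crep x|.
Proof.
have le z : `|crep (- z)| <= `|crep z|.
  by rewrite -{1}(crepK z) -chomN (le_trans (crep_le _)) // normrN.
by apply/eqP; rewrite eq_le le -{1}[x]opprK le.
Qed.

Lemma crepD x y : `|crep x| < 4^-1 -> `|crep y| < 4^-1 ->
  crep (x + y) = crep x + crep y.
Proof.
move=> x4 y4; rewrite -{1}(crepK x) -{1}(crepK y) -chomD crep_circle_pi //.
by rewrite (le_lt_trans (ler_normD _ _)) //; move: x4 y4; lra.
Qed.

Lemma crep_eq0 x : crep x = 0 -> x = 0.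
Proof. by move=> x0; rewrite -(crepK x) x0 chom0. Qed.

(** As long as the multiples stay below [4^-1], their representatives are the multiples of [crep x],
    which are unbounded unless [crep x] is 0. *)
Lemma circle_no_small_subgroup x : (forall n, `|crep (x *+ n)| < 4^-1) -> x = 0.
Proof.
move=> xn; apply: crep_eq0; apply: contrapT => /eqP x0.
have x1 : `|crep x| < 4^-1 by have := xn 1%N; rewrite mulr1n.
have E n : crep (x *+ n) = n%:R * crep x.
  elim: n => [|n IH]; first by rewrite mulr0n crep0 mul0r.
  by rewrite mulrS crepD // IH -natr1 mulrDl mul1r addrC.
have := xn (Num.truncn `|crep x|^-1).+1.
rewrite E normrM normr_nat ltNge => /negP; apply.
have : 1 <= (Num.truncn `|crep x|^-1).+1%:R * `|crep x|.
  by rewrite -ler_pdivrMr ?normr_gt0 // div1r ltW // truncnS_gt.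
lra.
Qed.

Lemma nbhs0_crep (e : R) : 0 < e -> nbhs (0 : T) [set x | `|crep x| < e].
Proof.
move=> e0; have := circle_pi_open (nbhsx_ballx (0 : R) e e0).
apply: filterS => _ [t + <-]; rewrite /ball /= sub0r normrN.
exact: le_lt_trans (crep_le t).
Qed.

Lemma nbhs0_crep_ex (U : set T) : nbhs 0 U ->
  exists2 e : R, 0 < e & forall x, `|crep x| < e -> U x.
Proof.
move=> /(nbhs0_preimage circle_pi)/nbhs_ballP[e /= e0 eU]; exists e => // x xe.
by rewrite -(crepK x); apply: eU; rewrite /ball /= sub0r normrN.
Qed.

Lemma closed_int : closed [set t : R | t \is a Num.int].
Proof.
move=> t tZ /=; apply: contrapT => nt.
pose f := (Num.floor t)%:~R : R.
have /andP[ft tf] := floor_itv t; rewrite intrD1 -/f in tf ft.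
have {}ft : f < t.
  rewrite lt_neqAle ft andbT; apply/eqP => ft'; apply: nt.
  by rewrite -ft' intr_int.
pose d := Num.min (t - f) (f + 1 - t).
have d0 : 0 < d by rewrite lt_min !subr_gt0 ft.
have [s [/intrP[z ->]]] := tZ _ (nbhsx_ballx t d d0).
rewrite /ball /= /d lt_min => /andP[]; rewrite !ltr_norml => /andP[z1 z2] /andP[z3 z4].
have : f < z%:~R by lra.
rewrite ltr_int => fz; have : z%:~R < f + 1 by lra.
by rewrite -intrD1 ltr_int ltzD1 leNgt fz.
Qed.

Lemma polish_circle : polish_group T.
Proof. by apply: polish_quotient; [exact: closed_int|exact: polish_real]. Qed.

Lemma real_divisible : divisible R.
Proof.
move=> n t n0; exists (t / n%:R); rewrite -[LHS]mulr_natr divfK //.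
by rewrite pnatr_eq0 -lt0n.
Qed.

Lemma circle_divisible : divisible T.
Proof.
move=> n x n0; have [t <-] := circle_pi_surj x.
have [t' <-] := real_divisible t n0; exists (circle_pi t').
exact: (esym (raddfMn circle_pi n t')).
Qed.

End Circle.

(** * Powers, sums and subgroups *)

Section Power.
Context {I : Type} {G : topologicalZmodType}.
Local Notation P := (power I G).

Lemma power_eval_continuous i : continuous (fun x : P => x i).
Proof.
move=> f; have /cvg_sup/(_ i) fi : nbhs f --> f by exact: cvg_id.
move=> U Uf; apply: fi.
exact: (@initial_continuous _ G (fun g : forall i : I, G => g i) f U).
Qed.

Lemma power_cvg (F : set_system P) (x : P) : Filter F ->
  (forall i, (fun y : P => y i) @ F --> x i) -> F --> x.
Proof.
move=> FF Fx; apply/cvg_sup => i U; rewrite nbhsE => -[_ [[V oV <-] Vx] VU].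
by apply: filterS VU _; apply: Fx; exact: open_nbhs_nbhs.
Qed.

Lemma continuous_power (X : topologicalType) (f : X -> P) :
  (forall i, continuous (fun x => f x i)) -> continuous f.
Proof. by move=> fc x; apply: power_cvg => i; exact: fc. Qed.

Lemma power_eval_zmod_morphism i : zmod_morphism (fun x : P => x i).
Proof. by []. Qed.

Definition power_eval i : chom P G :=
  mk_chom (@power_eval_zmod_morphism i) (@power_eval_continuous i).

End Power.

Lemma nbhs0_power {R : realType} m (U : set (power 'I_m R)) : nbhs 0 U ->
  exists2 e : R, 0 < e & forall x : power 'I_m R, (forall i, `|x i| < e) -> U x.
Proof.
pose F : set_system (power 'I_m R) := filter_from [set e : R | 0 < e]
  (fun e => [set x : power 'I_m R | forall i, `|x i| < e]).
have FF : Filter F.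
  apply: filter_from_filter; first by exists 1; rewrite /= ltr01.
  move=> d e /= d0 e0; exists (Num.min d e); first by rewrite lt_min d0.
  by move=> x /= xde; split=> i; have := xde i; rewrite lt_min => /andP[].
have F0 : F --> (0 : power 'I_m R).
  apply: power_cvg => i W /nbhs_ballP[e /= e0 eW]; exists e => // x /= xe.
  by apply: eW; rewrite /ball /= sub0r normrN.
by move=> /F0[e /= e0 eU]; exists e => // x xe; exact: eU.
Qed.

Lemma nbhs0_box {R : realType} m (e : R) : 0 < e ->
  nbhs (0 : power 'I_m R) [set x | forall i, `|x i| < e].
Proof.
move=> e0; apply: (@filter_forall _ _ (fun i (x : power 'I_m R) => `|x i| < e)
  (nbhs (0 : power 'I_m R)) _) => i.
have := nbhs0_preimage (power_eval i : chom (power 'I_m R) R) (U := fun t : R => `|t| < e).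
apply.
apply/nbhs_ballP; exists e => // t; by rewrite /ball /= sub0r normrN.
Qed.

(** The proof that [S] is a subgroup is an argument of the predicate, so that the structure of
    subgroup can be inferred from the term. *)
Definition subgroup_pred {G : zmodType} (S : set G)
  (S_zmod : S 0 /\ forall x y, S x -> S y -> S (x - y)) : {pred G} :=
  [pred x | `[< S x >]].

Fact subgroup_pred_zmod_closed {G : zmodType} (S : set G) S_zmod :
  zmod_closed (@subgroup_pred G S S_zmod).
Proof.
have [S0 SB] := S_zmod; split; first exact/asboolP.
by move=> x y /asboolP Sx /asboolP Sy; exact/asboolP/SB.
Qed.

HB.instance Definition _ (G : zmodType) S S_zmod := GRing.isZmodClosed.Build G
  (@subgroup_pred G S S_zmod) (subgroup_pred_zmod_closed S_zmod).

Lemma subgroup_predP {G : zmodType} (S : set G) S_zmod x :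
  x \in @subgroup_pred G S S_zmod <-> S x.
Proof. by split=> [/asboolP|?]; [|exact/asboolP]. Qed.

Lemma continuous_dsum (X : topologicalType) (G H : topologicalZmodType)
    (f : X -> G) (g : X -> H) :
  continuous f -> continuous g -> continuous (fun x => (f x, g x) : dsum G H).
Proof. by move=> fc gc x; apply: cvg_pair; [exact: fc|exact: gc]. Qed.

Section ChomConstructions.
Context {A B C : topologicalZmodType}.

Fact chom_pair_zmod_morphism (f : chom A B) (g : chom A C) :
  zmod_morphism (fun x => (f x, g x) : dsum B C).
Proof. by move=> x y; rewrite !chomB. Qed.

Definition chom_pair (f : chom A B) (g : chom A C) : chom A (dsum B C) :=
  mk_chom (@chom_pair_zmod_morphism f g)
    (continuous_dsum (@chom_continuous A B f) (@chom_continuous A C g)).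

Fact chom_power_zmod_morphism I (f : I -> chom A B) :
  zmod_morphism (fun x => (fun i => f i x) : power I B).
Proof. by move=> x y; apply/funext => i; rewrite chomB. Qed.

Definition chom_power I (f : I -> chom A B) : chom A (power I B) :=
  mk_chom (@chom_power_zmod_morphism I f)
    (continuous_power (fun i => @chom_continuous A B (f i))).

Fact chom_id_subproof : @id A \in @chom_pred A A.
Proof. by apply/asboolT; split=> // x; exact: cvg_id. Qed.

Definition chom_id : chom A A := CHom chom_id_subproof.

Fact chom_fst_subproof : (fst : dsum B C -> B) \in @chom_pred (dsum B C) B.
Proof. by apply/asboolT; split=> // x; exact: cvg_fst. Qed.

Definition chom_fst : chom (dsum B C) B := CHom chom_fst_subproof.

Fact chom_snd_subproof : (snd : dsum B C -> C) \in @chom_pred (dsum B C) C.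
Proof. by apply/asboolT; split=> // x; exact: cvg_snd. Qed.

Definition chom_snd : chom (dsum B C) C := CHom chom_snd_subproof.

Lemma chom_addE (f g : chom A B) x : (f + g) x = f x + g x.
Proof. exact: (congr1 (fun h => h x) (GRing.valD f g)). Qed.

Lemma chom_oppE (f : chom A B) x : (- f) x = - f x.
Proof. exact: (congr1 (fun h => h x) (GRing.valN f)). Qed.

Lemma chom_pairE (f : chom A B) (g : chom A C) x : chom_pair f g x = (f x, g x).
Proof. by []. Qed.

Lemma chom_powerE I (f : I -> chom A B) x i : chom_power f x i = f i x.
Proof. by []. Qed.

End ChomConstructions.

Lemma open_hom_comp (A B C : topologicalZmodType) (f : chom A B) (g : chom B C) :
  open_hom f -> open_hom g -> open_hom (precomp C f g).
Proof.
move=> fo go U /fo/go; apply: filterS => _ [_ [x Ux <-] <-].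
by exists x.
Qed.

Lemma isomorphic_open (A B : topologicalZmodType) (f : chom A B) (g : chom B A) :
  cancel f g -> cancel g f -> open_hom f.
Proof.
move=> fK gK U /(nbhs0_preimage g); apply: filterS => y Uy.
by exists (g y); rewrite ?gK.
Qed.

(** * Lie groups and pro-Lie groups *)

Section MatrixHom.
Context {R : realType} {m : nat}.

Definition row_of (x : power 'I_m R) : 'rV[R]_m := \row_i x i.

Lemma row_ofB x y : row_of (x - y) = row_of x - row_of y.
Proof. by apply/rowP => i; rewrite !mxE. Qed.

Lemma mulmx_coord_zmod_morphism k (P : 'M[R]_(m, k)) i :
  zmod_morphism (fun x : power 'I_m R => (row_of x *m P) 0 i).
Proof. by move=> x y; rewrite row_ofB mulmxBl !mxE. Qed.

Lemma mulmx_coord_continuous k (P : 'M[R]_(m, k)) i :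
  continuous (fun x : power 'I_m R => (row_of x *m P) 0 i).
Proof.
rewrite (_ : (fun _ => _) = fun x : power 'I_m R => \sum_j x j * P j i); last first.
  by apply/funext => x; rewrite mxE; apply: eq_bigr => j _; rewrite mxE.
move=> x; have := @cvg_sum_ord R _ (nbhs x) _ m (fun j (y : power 'I_m R) => y j * P j i)
  (fun j => x j * P j i).
apply=> j; apply: cvgMl; exact: power_eval_continuous.
Qed.

Definition mulmx_coord k (P : 'M[R]_(m, k)) i : chom (power 'I_m R) R :=
  mk_chom (@mulmx_coord_zmod_morphism k P i) (@mulmx_coord_continuous k P i).

End MatrixHom.

Section LieCover.
Variable R : realType.
Local Notation T := (circle R).

(** Among Polish groups this characterizes the Lie groups, by [lie_euclidean_cover] and [cover_lie].
    Surjectivity is not asked: the image is an open subgroup, and the discrete factor accounts for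
    the rest. *)
Definition euclidean_cover (H : topologicalZmodType) :=
  exists m (e : chom (power 'I_m R) H), open_hom e.

Lemma euclidean_cover_open (H K : topologicalZmodType) (f : chom H K) :
  open_hom f -> euclidean_cover H -> euclidean_cover K.
Proof.
move=> fo [m [e eo]]; exists m, (precomp K e f); exact: open_hom_comp.
Qed.

Definition torus_hom n d (D : topologicalZmodType) :
    chom (power 'I_(n + d) R) (dsum (dsum (power 'I_n R) (power 'I_d T)) D) :=
  chom_pair (chom_pair (chom_power (fun i => power_eval (lshift d i)))
    (chom_power (fun j => precomp T (power_eval (rshift n j)) circle_pi))) 0.

Lemma torus_cover n d (D : topologicalZmodType) : discrete D ->
  euclidean_cover (dsum (dsum (power 'I_n R) (power 'I_d T)) D).
Proof.
move=> Dd; exists (n + d)%N, (torus_hom n d D).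
move=> U /nbhs0_power[e e0 eU].
apply/dsum_nbhs0; exists [set z | (forall i, `|z.1 i| < e) /\
  forall j, `|crep (z.2 j)| < e], [set 0]; split.
- apply/dsum_nbhs0; exists [set x | forall i, `|x i| < e],
    [set x | forall j, `|crep (x j)| < e]; split=> //; first exact: nbhs0_box.
  apply: (@filter_forall _ _ (fun j (x : power 'I_d T) => `|crep (x j)| < e)
    (nbhs (0 : power 'I_d T)) _) => j.
  by have := nbhs0_preimage (power_eval j : chom (power 'I_d T) T) (nbhs0_crep e0).
- by apply: open_nbhs_nbhs; split.
- move=> [x y] _ /= [xe ye] ->.
  exists ((fun k : 'I_(n + d) => match fintype.split k with inl i => x i
    | inr j => crep (y j) end) : power 'I_(n + d) R).
    apply: eU => k; case: (fintype.split k) => //.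
  congr (_, _); congr (_, _); apply/funext => i.
    by rewrite (unsplitK (inl i)).
  rewrite -[RHS]crepK; apply: (congr1 circle_pi).
  by rewrite /= (unsplitK (inr i)).
Qed.

Lemma lie_euclidean_cover (H : topologicalZmodType) :
  lie R H -> euclidean_cover H.
Proof.
move=> [_ [n [d [D [_ Dd [f [g [fK gK]]]]]]]].
by apply: (euclidean_cover_open (isomorphic_open gK fK)); exact: torus_cover.
Qed.

Lemma power_divisible I (G : topologicalZmodType) :
  divisible G -> divisible (power I G).
Proof.
move=> Gd n x n0; have /choice[y yP] i := Gd n (x i) n0.
exists y; apply/funext => i; rewrite -yP.
by elim: n {n0 yP} => [|n IH]; rewrite ?mulr0n // !mulrS -IH.
Qed.

Lemma dsum_divisible (G H : topologicalZmodType) :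
  divisible G -> divisible H -> divisible (dsum G H).
Proof.
move=> Gd Hd n [x y] n0; have [x' <-] := Gd n x n0; have [y' <-] := Hd n y n0.
exists (x', y').
by elim: n {n0} => [|n IH]; rewrite ?mulr0n // !mulrS IH.
Qed.

Lemma group_discrete (D : topologicalZmodType) :
  nbhs (0 : D) [set 0] -> discrete D.
Proof.
move=> D0 A; rewrite openE => x Ax; apply: filterS ((nbhs_shiftB x _).2 D0).
by move=> y /= /subr0_eq ->.
Qed.

Section CoverLie.
Context (H : topologicalZmodType) (Hp : polish R H) (m : nat).
Context (e : chom (power 'I_m R) H) (eo : open_hom e).

Let Hh : hausdorff_space H. Proof. by have [] := (polish_groupP R H).1 Hp. Qed.

Lemma cover_kernel_coordinates : exists (P : 'M[R]_m) (t : 'I_m -> option bool),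
  P \in unitmx /\
  forall x, e x = 0 <-> forall i, coord_ok (t i) ((row_of x *m P) 0 i).
Proof.
pose M := [set z : 'rV[R]_m | e (fun i => z 0 i) = 0].
have M0 : M 0.
  rewrite /M /= (_ : (fun i => _) = 0) ?chom0 //.
  by apply/funext => i; rewrite mxE.
have MB x y : M x -> M y -> M (x - y).
  rewrite /M /= => x0 y0.
  rewrite (_ : (fun i => _) = (fun i => x 0 i) - (fun i => y 0 i) :> power 'I_m R).
    by rewrite chomB x0 y0 subrr.
  by apply/funext => i; rewrite !mxE.
have Mcl (x : nat -> 'rV[R]_m) (l : 'rV[R]_m) :
    (forall j, x n 0 j @[n --> \oo] --> l 0 j) -> (forall n, M (x n)) -> M l.
  move=> xl Mx; rewrite /M /=.
  pose z n : power 'I_m R := fun i => x n 0 i.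
  pose w : power 'I_m R := fun i => l 0 i.
  have zw : z @ \oo --> w by apply: power_cvg => i; exact: xl.
  have el := cvg_comp _ _ zw (@chom_continuous _ _ e w).
  apply: (cvg_unique Hh el); rewrite (_ : _ \o _ = cst 0); first exact: cvg_cst.
  by apply/funext => n; exact: Mx.
have [|P [t [Pu Mt _]]] := closed_subgroup_coordinates M0 MB Mcl
  (k := 0) (v := fun=> 0) (tau := fun=> false).
  by split=> [x _ i //|x]; rewrite /lin big_ord0.
exists P, t; split=> // x; rewrite -Mt /M /=.
by rewrite (_ : (fun i => _) = x) //; apply/funext => i; rewrite mxE.
Qed.

(** Modulo the kernel of [e], read in the coordinates [P], a line disappears, an integral direction
    gives T and a transverse one gives R. The resulting isomorphism from the image of [e] onto [L]
    extends to [H] because [L] is divisible, and the extension is continuous because [e] is open.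
    The quotient of [H] by the open image of [e] is discrete, and countable by separability. *)
Lemma cover_lie : lie R H.
Proof.
split=> //; have [P [t [Pu Pt]]] := cover_kernel_coordinates.
pose A := [pred i | t i == None]; pose B := [pred i | t i == Some false].
pose L := dsum (power 'I_#|A| R) (power 'I_#|B| T).
pose cR (i : 'I_#|A|) : chom (power 'I_m R) R := mulmx_coord P (enum_val i).
pose cT (j : 'I_#|B|) : chom (power 'I_m R) T :=
  precomp T (mulmx_coord P (enum_val j)) circle_pi.
pose c : chom (power 'I_m R) L := chom_pair (chom_power cR) (chom_power cT).
have c_ker x : c x = 0 <-> e x = 0.
  rewrite Pt; split=> [[cA cB'] i|xi].
    case ti : (t i) => [[]|] //.
      have iB : i \in B by rewrite inE ti.
      apply/circle_pi_eq0; have := congr1 (fun f => f (enum_rank_in iB i)) cB'.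
      by rewrite enum_rankK_in.
    have iA : i \in A by rewrite inE ti.
    have := congr1 (fun f => f (enum_rank_in iA i)) cA.
    by rewrite /= enum_rankK_in.
  congr (_, _); apply/funext => i.
    have := xi (enum_val i); have := enum_valP i; rewrite inE => /eqP ->.
    exact.
  apply/circle_pi_eq0; have := xi (enum_val i).
  by have := enum_valP i; rewrite inE => /eqP ->.
have c_lift (a : power 'I_#|A| R) (b : power 'I_#|B| T) : exists x, c x = (a, b) /\
    forall r : R, 0 < r -> (forall i, `|a i| < r) -> (forall j, `|crep (b j)| < r) ->
    forall k, `|mulmx_coord P k x| < r.
  pose y i : R := match pselect (i \in A), pselect (i \in B) with
    | left iA, _ => a (enum_rank_in iA i)
    | _, left iB => crep (b (enum_rank_in iB i)) | _, _ => 0 end.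
  pose x : power 'I_m R := fun i => (\row_i y i *m invmx P) 0 i.
  have xy i : mulmx_coord P i x = y i.
    rewrite /= (_ : row_of x = \row_i y i *m invmx P) ?mulmxKV ?mxE //.
    by apply/rowP => j; rewrite mxE.
  exists x; split.
    congr (_, _); apply/funext => i.
      rewrite chom_powerE /cR xy /y; case: pselect => [jA|].
        by congr (a _); apply: enum_val_inj; rewrite enum_rankK_in.
      by have := enum_valP i.
    have jB := enum_valP i; apply: etrans (congr1 circle_pi (xy _)) _.
    rewrite /y; case: pselect => [jA|_].
      by exfalso; move: {+}jA jB; rewrite !inE => /eqP ->.
    case: pselect => // jB'; rewrite crepK.
    by congr (b _); apply: enum_val_inj; rewrite enum_rankK_in.
  move=> r r0 ar br k; rewrite xy /y; case: pselect => [jA|_]; first exact: ar.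
  by case: pselect => [jB|_]; [exact: br|rewrite normr0].
have co : open_hom c.
  move=> U /nbhs0_power[d d0 dU].
  have : nbhs (0 : power 'I_m R)
      [set y | forall i, `|mulmx_coord (invmx P) i y| < d].
    apply: (@filter_forall _ _ (fun i y => `|mulmx_coord (invmx P) i y| < d)
      (nbhs (0 : power 'I_m R)) _) => i.
    have := nbhs0_preimage (mulmx_coord (invmx P) i) (U := fun t : R => `|t| < d).
    apply; apply/nbhs_ballP; exists d => // s; by rewrite /ball /= sub0r normrN.
  move=> /nbhs0_power[r r0 rU].
  apply/dsum_nbhs0; exists [set x | forall i, `|x i| < r],
    [set x | forall j, `|crep (x j)| < r]; split; first exact: nbhs0_box.
    apply: (@filter_forall _ _ (fun j (x : power _ T) => `|crep (x j)| < r)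
      (nbhs (0 : power _ T)) _) => j.
    by have := nbhs0_preimage (power_eval j : chom (power _ T) T) (nbhs0_crep r0).
  move=> a b ar br; have [x [xab xr]] := c_lift a b; exists x => //.
  apply: dU => i.
  have -> : x i = mulmx_coord (invmx P) i (fun k => mulmx_coord P k x).
    rewrite /= (_ : row_of _ = row_of x *m P) ?mulmxK ?mxE //.
    by apply/rowP => j; rewrite mxE.
  by apply: rU => k; exact: xr.
have c_surj l : exists x, c x = l.
  by case: l => a b; have [x [xab _]] := c_lift a b; exists x.
have Ldiv : divisible L.
  apply: dsum_divisible; apply: power_divisible.
    exact: real_divisible.
  exact: circle_divisible.
pose S : set (H * L) := [set z | exists x, z = (e x, c x)].
have [h hB hS] : exists2 h : H -> L, zmod_morphism h & forall x y, S (x, y) -> h x = y.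
  apply: divisible_extension Ldiv _ _; split.
  - by exists 0; rewrite chom0 chom0.
  - move=> _ _ [x ->] [y ->] /=; exists (x - y).
    by rewrite chomB chomB.
  - move=> d [x [e0 ->]]; apply/c_ker.
    by rewrite -e0.
have hE x : h (e x) = c x by apply: hS; exists x.
have hc : continuous h.
  apply: continuous_additive => // U /(nbhs0_preimage c)/eo.
  by apply: filterS => _ [x Ux <-] /=; rewrite hE.
have NS : [set y | exists x, e x = y] 0 /\
    forall x y, [set y | exists x, e x = y] x -> [set y | exists x, e x = y] y ->
      [set y | exists x, e x = y] (x - y).
  split; first by exists 0; rewrite chom0.
  by move=> _ _ [x <-] [y <-]; exists (x - y); rewrite chomB.
pose N : zmodClosed H := subgroup_pred NS.
pose D := quotient_group N; pose q : chom H D := quotient_pi N.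
have q0 x : q x = 0 <-> exists y, e y = x.
  by rewrite quotient_pi_eq0 subgroup_predP.
have N0 : nbhs (0 : H) [set x | exists y, e y = x].
  have : nbhs (0 : H) (e @` setT) by apply: eo; exact: filterT.
  by apply: filterS => _ [x _ <-]; exists x.
have D0 : nbhs (0 : D) [set 0].
  apply: (@filterS _ (nbhs (0 : D)) _ _ _ _ (@quotient_pi_open _ N _ N0)).
  by move=> _ [x /q0 x0 <-].
have Dcount : countable [set: D].
  have [_ _ _ [C Cc Cd]] := (polish_groupP R H).1 Hp.
  apply: sub_countable Cc; apply: card_le_trans (card_image_le q C).
  apply: subset_card_le => b _; have [x <-] := quotient_pi_surj b.
  have := nbhs_shiftB x [set x | exists y, e y = x].
  move=> /iffRL/(_ N0); rewrite nbhsE => -[W [oW Wx] WN].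
  have [|z [/WN zx Cz]] := Cd W _ oW; first by exists x.
  exists z => //; apply: subr0_eq; rewrite -chomB; exact/q0.
exists #|A|, #|B|, D; split=> //; first exact: group_discrete.
apply: (isomorphic_bij (f := chom_pair (mk_chom hB hc) q)).
- move=> U /(nbhs0_preimage e)/co U0; apply/dsum_nbhs0.
  exists (c @` (e @^-1` U)), [set 0]; split=> // _ _ [x Ux <-] ->.
  exists (e x) => //; congr (_, _); first exact: hE.
  by apply/q0; exists x.
- move=> [l b]; have [x <-] := quotient_pi_surj b.
  have [y cy] := c_surj (l - h x); exists (x + e y).
  rewrite chom_pairE; congr (_, _).
    have := hB (x + e y) x; rewrite addrAC subrr add0r hE cy.
    by move=> /(congr1 (fun z => z + h x)); rewrite !subrK.
  rewrite chomD (_ : q (e y) = 0) ?addr0 //.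
  by apply/q0; exists y.
- move=> x [hx0 /q0[y yx]]; rewrite -yx; apply/c_ker.
  by rewrite -hE yx.
Qed.

End CoverLie.
End LieCover.

Lemma closure_zmod (G : topologicalZmodType) (S : set G) :
  S 0 /\ (forall x y, S x -> S y -> S (x - y)) ->
  closure S 0 /\ (forall x y, closure S x -> closure S y -> closure S (x - y)).
Proof.
move=> [S0 SB]; split; first exact: subset_closure.
move=> x y Sx Sy U /(@sub_continuous G (x, y))[[A B] /= [xA yB] ABU].
have [a [Sa Aa]] := Sx _ xA; have [b [Sb Bb]] := Sy _ yB.
by exists (a - b); split; [exact: SB|exact: (ABU (a, b))].
Qed.

Lemma open_hom_factor (A B C : topologicalZmodType) (p : chom A B) (h : chom A C)
    (k : chom B C) : open_hom h -> (forall a, k (p a) = h a) -> open_hom k.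
Proof.
move=> ho kp U /(nbhs0_preimage p)/ho; apply: filterS => _ [a Ua <-].
by exists (p a) => //; exact: kp.
Qed.

Section ProLie.
Variable R : realType.
Local Notation T := (circle R).

Lemma pro_lie_cover (G : topologicalZmodType) : polish R G ->
  pro_lie R G <-> forall U : set G, nbhs 0 U -> exists N : zmodClosed G,
    [/\ closed [set x | x \in N], [set x | x \in N] `<=` U &
        euclidean_cover R (quotient_group N)].
Proof.
move=> /(polish_groupP R G).1 Gp; split=> GL U /GL[N [Ncl NU NL]]; exists N; split=> //.
  exact: lie_euclidean_cover.
have [m [e eo]] := NL.
by apply: (cover_lie _ eo); apply/polish_groupP; exact: polish_quotient.
Qed.

(** The image of [N1] in the quotient need not be closed. Its closure is still small, because the
    closure of [V] is inside [U], and the quotient by it inherits the cover of [G / N1]. *)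
Lemma proLiePAb_quotient (G : topologicalZmodType) (N : zmodClosed G) :
  proLiePAb R G -> closed [set x | x \in N] -> proLiePAb R (quotient_group N).
Proof.
move=> [Gp GL] Ncl.
have Qp : polish R (quotient_group N).
  by apply/polish_groupP; apply: polish_quotient => //; exact: (polish_groupP R G).1.
split=> //; apply/(pro_lie_cover Qp) => U /nbhs0_closed[V V0 VU].
pose p := quotient_pi N.
have [N1 [N1cl N1V N1L]] := (pro_lie_cover Gp).1 GL _ (nbhs0_preimage p V0).
pose S := p @` [set x | x \in N1].
have S_zmod : S 0 /\ forall x y, S x -> S y -> S (x - y).
  split; first by exists 0; [exact: rpred0|exact: chom0].
  move=> _ _ [x Nx <-] [y Ny <-]; exists (x - y); last exact: chomB.
  exact: rpredB.
pose N2 : zmodClosed (quotient_group N) := subgroup_pred (closure_zmod S_zmod).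
have N2E : [set x | x \in N2] = closure S.
  by apply/seteqP; split=> x /=; rewrite subgroup_predP.
exists N2; rewrite N2E; split; first exact: closed_closure.
  by apply: subset_trans VU; apply: closure_subset => _ [x /N1V Vx <-].
pose h := precomp _ p (quotient_pi N2).
have ho : open_hom h by apply: open_hom_comp; exact: quotient_pi_open.
have hN1 x : quotient_pi N1 x = 0 -> h x = 0.
  move=> /quotient_pi_eq0 xN1; apply/quotient_pi_eq0/subgroup_predP.
  by apply: subset_closure; exists x.
have [k kE] := chom_factor (@quotient_pi_open _ N1) (@quotient_pi_surj _ N1) hN1.
exact: euclidean_cover_open (open_hom_factor ho kE) N1L.
Qed.

Lemma cover_proLiePAb (G : topologicalZmodType) :
  polish R G -> euclidean_cover R G -> proLiePAb R G.
Proof.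
move=> Gp Gc; split=> //; apply/(pro_lie_cover Gp) => U U0.
have Z : [set x : G | x = 0] 0 /\ forall x y : G,
    [set x : G | x = 0] x -> [set x : G | x = 0] y -> [set x : G | x = 0] (x - y).
  by split=> // x y /= -> ->; rewrite subrr.
exists (subgroup_pred Z : zmodClosed G).
have -> : [set x : G | x \in (subgroup_pred Z : zmodClosed G)] = [set 0].
  by apply/seteqP; split=> x /=; rewrite subgroup_predP.
split.
- apply: accessible_closed_set1; apply: hausdorff_accessible.
  by have [] := (polish_groupP R G).1 Gp.
- by move=> _ ->; exact: nbhs_singleton.
- by apply: euclidean_cover_open Gc; exact: quotient_pi_open.
Qed.

Lemma proLiePAb_circle : proLiePAb R T.
Proof.
apply: proLiePAb_quotient; last exact: closed_int.
apply: cover_proLiePAb; first by apply/polish_groupP; exact: polish_real.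
exists 1%N, (power_eval ord0) => U /nbhs0_power[e e0 eU].
apply: filterS (nbhsx_ballx (0 : R) e e0) => t.
rewrite /ball /= sub0r normrN => te.
by exists ((fun=> t) : power 'I_1 R) => //; exact: eU.
Qed.

Let cover_dsum (H : topologicalZmodType) :
  euclidean_cover R H -> euclidean_cover R (dsum R H).
Proof.
move=> [m [e eo]]; exists (1 + m)%N.
pose x_ : chom (power 'I_(1 + m) R) R := power_eval (lshift m ord0).
pose y_ : chom (power 'I_(1 + m) R) (power 'I_m R) :=
  chom_power (fun j => power_eval (rshift 1 j)).
exists (chom_pair x_ (precomp H y_ e)) => U /nbhs0_power[d d0 dU].
apply/dsum_nbhs0; exists (ball 0 d), (e @` [set x | forall i, `|x i| < d]); split.
- exact: nbhsx_ballx.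
- by apply: eo; exact: nbhs0_box.
- move=> t y; rewrite /ball /= sub0r normrN => td [x xd <-].
  exists ((fun k : 'I_(1 + m) => match fintype.split k with inl _ => t
    | inr j => x j end) : power 'I_(1 + m) R).
    by apply: dU => k; case: (fintype.split k).
  congr (_, _); first by rewrite /= (unsplitK (inl ord0)).
  apply: (congr1 e); apply/funext => j.
  by rewrite /= (unsplitK (inr j)).
Qed.

Lemma proLiePAb_dsum_real (G : topologicalZmodType) :
  proLiePAb R G -> proLiePAb R (dsum R G).
Proof.
move=> [Gp GL]; have Dp : polish R (dsum R G).
  by apply/polish_groupP; apply: polish_dsum; [exact: polish_real|exact: (polish_groupP R G).1].
split=> //; apply/(pro_lie_cover Dp) => U /dsum_nbhs0[A [B [A0 B0 ABU]]].
have [N1 [N1cl N1B N1L]] := (pro_lie_cover Gp).1 GL _ B0.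
pose S := [set z : dsum R G | z.1 = 0 /\ z.2 \in N1].
have S_zmod : S 0 /\ forall x y, S x -> S y -> S (x - y).
  split; first by split=> //; exact: rpred0.
  move=> x y [x1 x2] [y1 y2]; split; last exact: rpredB.
  by have -> : (x - y).1 = x.1 - y.1 by []; rewrite x1 y1 subrr.
pose N : zmodClosed (dsum R G) := subgroup_pred S_zmod.
have NE : [set x | x \in N] = S.
  by apply/seteqP; split=> x /=; rewrite subgroup_predP.
exists N; rewrite NE; split.
- have -> : S = (fst @^-1` [set 0]) `&` (snd @^-1` [set x | x \in N1]) by [].
  have R0 : closed [set (0 : R)].
    by apply: accessible_closed_set1; apply: hausdorff_accessible; exact: Rhausdorff.
  apply: closedI.
    by apply: (preimage_closed _ R0) => x _; exact: cvg_fst.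
  by apply: (preimage_closed _ N1cl) => x _; exact: cvg_snd.
- by move=> [t y] [/= -> /N1B By]; apply: ABU => //; exact: nbhs_singleton.
pose q := quotient_pi N.
pose in1 : chom R (dsum R G) := chom_pair chom_id 0.
pose in2 : chom G (dsum R G) := chom_pair 0 chom_id.
have in2N1 x : quotient_pi N1 x = 0 -> precomp _ in2 q x = 0.
  by move=> /quotient_pi_eq0 xN1; apply/quotient_pi_eq0/subgroup_predP.
have [k kE] := chom_factor (@quotient_pi_open _ N1) (@quotient_pi_surj _ N1) in2N1.
pose E : chom (dsum R (quotient_group N1)) (quotient_group N) :=
  precomp _ chom_fst (precomp _ in1 q) + precomp _ chom_snd k.
apply: euclidean_cover_open (cover_dsum N1L).
apply: (open_hom_factor (h := q) (k := E)
  (p := chom_pair chom_fst (precomp _ chom_snd (quotient_pi N1)))).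
  exact: quotient_pi_open.
move=> [t y]; rewrite chom_addE.
apply: etrans (congr1 (fun z => _ + z) (kE y)) _.
rewrite -[LHS](chomD q (t, 0) (0, y)); congr (q (_, _)).
  by rewrite addr0.
by rewrite add0r.
Qed.

End ProLie.

(** * Extensions of the circle *)

Lemma closed_embedding_nbhs0 (A B : topologicalZmodType) (i : chom A B) :
  closed_embedding i -> forall U, nbhs 0 U ->
  exists2 W, nbhs 0 W & forall a, W (i a) -> U a.
Proof.
move=> [_ _ [g gK gc]] U U0.
have i0 : range i 0 by exists 0 => //; exact: chom0.
have g0 : g 0 = 0 by rewrite -(chom0 i) gK.
have gU : nbhs (g 0) U by rewrite g0.
have W0 := (subspace_continuousP _ _).1 gc 0 i0 U gU.
exists (fun b => range i b -> U (g b)); first exact: W0.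
by move=> a Wa; rewrite -(gK a); apply: Wa; exists a.
Qed.

Lemma closed_embedding_chom (A B : topologicalZmodType) (i : chom A B) :
  closed (range i) -> injective i ->
  (forall U, nbhs 0 U -> exists2 W, nbhs 0 W & forall a, W (i a) -> U a) ->
  closed_embedding i.
Proof.
move=> icl iI iU; split=> //; first exact: chom_continuous.
have /choice[g gE] b : exists a, range i b -> i a = b.
  have [[a _ ab]|nb] := pselect (range i b); first by exists a.
  by exists 0.
have gK : cancel i g by move=> a; apply: iI; apply: gE; exists a.
exists g => //; apply/subspace_continuousP => _ [a _ <-] U gU.
have aU : nbhs a U by rewrite -(gK a).
have [W W0 WU] := iU _ ((nbhs_shift a U).1 aU).
apply: filterS ((nbhs_shiftB (i a) W).2 W0) => b Wb [a' _ a'b].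
have Ua' : U a' by move: Wb; rewrite -a'b -chomB => /WU; rewrite subrKC.
suff: U (g b) by []; by rewrite -a'b gK.
Qed.

(** With a retraction [r] of [i], the map [x - i (r x)] vanishes on the kernel of [p]; as [p] is
    open, it factors through [p] and yields a section. *)
Lemma injective_Ext_eq0 (R : realType) (A I : topologicalZmodType) :
  injective_object R I -> Ext_eq0 R A I.
Proof.
move=> [_ Iinj] X i p ip; have [_ Xp Ap [iI irng prng] iemb] := ip.
have [_ _ rng] := Iinj _ _ _ _ _ ip.
have [r _ ri] : range (precomp I i) (chom_id : chom I I) by rewrite rng.
have riE a : r (i a) = a := congr1 (fun h : chom I I => h a) ri.
have ps a : exists x, p x = a.
  have [x _ xa] : range p a by rewrite prng.
  by exists x.
have po : open_hom p.
  apply: (@open_mapping R); [by apply/(polish_groupP R); case: Xp|by case: Ap|exact: ps].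
pose h : chom X X := chom_id - precomp X r i.
have hE x : h x = x - i (r x) by rewrite chom_addE chom_oppE.
have h0 x : p x = 0 -> h x = 0.
  move=> px; have [a _ <-] : range i x by rewrite irng.
  by rewrite hE riE subrr.
have [s sE] := chom_factor po ps h0; exists s => a.
have [x <-] := ps a; rewrite sE hE chomB.
have -> : p (i (r x)) = 0.
  have : range i (i (r x)) by exists (r x).
  by rewrite irng.
by rewrite subr0.
Qed.

Section RealExtension.
Context (R : realType) (G : topologicalZmodType) (hG : proLiePAb R G) (g : G).
Local Notation T := (circle R).

Let Gh : hausdorff_space G.
Proof. by have [] := (polish_groupP R G).1 hG.1. Qed.

Let S := [set z : dsum R G | exists n : int, z.1 = n%:~R /\ z.2 = - (g *~ n)].

Let S_zmod : S 0 /\ forall x y, S x -> S y -> S (x - y).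
Proof.
split; first by exists 0; rewrite mulr0z oppr0.
move=> [x1 x2] [y1 y2] [n [/= -> ->]] [m [/= -> ->]]; exists (n - m).
by rewrite /= intrB mulrzBr opprD.
Qed.

Let S_closed : closed S.
Proof.
move=> [t y] Sty.
have /intrP[n tn] : t \is a Num.int.
  apply: closed_int => U tU.
  have [|[s z] [[n [/= sn _]] Us]] := Sty (fun z => U z.1).
    by exists (U, setT) => [|[a b] []//]; split=> //; exact: filterT.
  by exists s; split=> //=; rewrite sn intr_int.
exists n; split=> //=; apply: subr0_eq; apply: hausdorff_nbhs0 => // U U0.
have [|[s z] [[m [/= sm zm]] [ts Uz]]] :=
    Sty (fun z : dsum R G => ball t 1 z.1 /\ U (y - z.2)).
  exists (ball t 1, [set z | U (y - z)]) => [|[a b] []//]; split.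
    by apply: nbhsx_ballx; exact: ltr01.
  exact: nbhs_shiftN.
suff mn : m = n by move: Uz; rewrite /= zm mn.
move: ts; rewrite /ball /= sm tn -intrB -intr_norm -[1]/(1%:~R) ltr_int.
by lia.
Qed.

Let N : zmodClosed (dsum R G) := subgroup_pred S_zmod.
Local Notation X := (quotient_group N).

Let q : chom (dsum R G) X := quotient_pi N.

Let q0 z : q z = 0 <-> S z.
Proof. by rewrite quotient_pi_eq0 subgroup_predP. Qed.

Let X_proLie : proLiePAb R X.
Proof.
apply: proLiePAb_quotient; first exact: proLiePAb_dsum_real.
have -> : [set x | x \in N] = S by apply/seteqP; split=> x /=; rewrite subgroup_predP.
exact: S_closed.
Qed.

Let i : chom G X := precomp X (chom_pair 0 chom_id) q.

Let i_inj y : i y = 0 -> y = 0.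
Proof.
move=> /q0[n [/= n0 ->]]; suff -> : n = 0 by rewrite mulr0z oppr0.
by apply/eqP; rewrite -(intr_eq0 R) -n0.
Qed.

Let r : chom R X := precomp X (chom_pair chom_id 0) q.

(* The push-out of 0 -> Z -> R -> T -> 0 along the map Z -> G sending 1 to g. *)
Lemma real_extension : exists (p : chom X T), short_exact R i p /\
  (forall t, p (r t) = circle_pi t) /\ r 1 = i g.
Proof.
have fq z : q z = 0 -> precomp T chom_fst circle_pi z = 0.
  by move=> /q0[n [zn _]]; apply/circle_pi_eq0; have : z.1 \is a Num.int by rewrite zn intr_int.
have [p pE] := chom_factor (@quotient_pi_open _ N) (@quotient_pi_surj _ N) fq.
have pr t : p (r t) = circle_pi t by exact: pE.
have iI : injective i by move=> y z yz; apply: subr0_eq; apply: i_inj; rewrite chomB yz subrr.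
have irng : range i = [set b | p b = 0].
  apply/seteqP; split=> [_ [y _ <-]|x /=].
    by apply: etrans (pE (0, y)) _; exact: chom0.
  have [[t y] <-] := quotient_pi_surj x => ty0.
  have t0 : circle_pi t = 0 := etrans (esym (pE (t, y))) ty0.
  have /circle_pi_eq0/intrP[n tn] := t0.
  exists (y + g *~ n) => //; apply: subr0_eq; rewrite -[LHS](chomB q); apply/q0.
  exists (- n); rewrite /= sub0r tn intrN; split=> //.
  by rewrite addrAC subrr add0r mulrNz opprK.
exists p; split; last first.
  split=> //; apply: subr0_eq; rewrite -[LHS](chomB q); apply/q0; exists 1.
  by split; rewrite /= ?subr0 // sub0r mulr1z.
split=> //; first exact: proLiePAb_circle.
  split=> //; apply/seteqP; split=> // x _.
  by have [t <-] := circle_pi_surj x; exists (r t) => //; exact: pr.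
apply: closed_embedding_chom => //.
  rewrite irng; have T0 : closed [set (0 : T)].
    apply: accessible_closed_set1; apply: hausdorff_accessible.
    by have [] := @polish_circle R.
  by apply: (preimage_closed _ T0) => x _; exact: chom_continuous.
(* The bound 1 on the real coordinate leaves [n = 0] as the only possible element of the subgroup
   that is divided out. *)
move=> U U0; exists (q @` [set z | `|z.1| < 1 /\ U z.2]).
  apply: quotient_pi_open; apply/dsum_nbhs0.
  exists (ball 0 1), U; split=> //; first by apply: nbhsx_ballx; exact: ltr01.
  by move=> t y; rewrite /ball /= sub0r normrN.
move=> y [[t z] [t1 Uz] tz]; rewrite /= in t1 Uz.
have : q ((t, z) - (0, y)) = 0.
  by apply/eqP; rewrite chomB subr_eq0; apply/eqP; exact: tz.
move=> /q0[n [/= tn zn]]; rewrite subr0 in tn.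
have n0 : n = 0 by move: t1; rewrite tn -intr_norm -[1]/(1%:~R) ltr_int; lia.
by rewrite n0 mulr0z oppr0 in zn; rewrite -(subr0_eq zn).
Qed.

Lemma Ext_circle_path : Ext_eq0 R T G ->
  exists f : R -> G, [/\ continuous f, f 0 = 0 & f 1 = g].
Proof.
move=> GT; have [p [ip [pr r1]]] := real_extension.
have [s sK] := GT _ _ _ ip; have [_ _ _ [iI irng _] iemb] := ip.
(* The component of [r t] in the image of [i] for the splitting [s]: it is killed by [p], and at 1
   it is [i g] because [circle_pi 1] is 0. *)
pose h : chom R X := r - precomp X circle_pi s.
have hE t : h t = r t - s (circle_pi t) by rewrite chom_addE chom_oppE.
have /choice[f fE] t : exists y, i y = h t.
  have [y _ yt] : range i (h t).
    rewrite irng; suff: p (h t) = 0 by [].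
    by rewrite hE chomB pr sK subrr.
  by exists y.
exists f; split.
- apply: (@continuous_additive R G f) => [t u|U U0].
    apply: iI; rewrite [RHS](chomB i) !fE.
    exact: etrans (fE _) (chomB h t u).
  have [W W0 WU] := closed_embedding_nbhs0 iemb U0.
  by apply: filterS (nbhs0_preimage h W0) => t Wt; apply: WU; rewrite fE.
- by apply: i_inj; rewrite fE chom0.
- apply: iI; apply: etrans (fE _) _; rewrite hE r1 (_ : circle_pi 1 = 0) ?chom0 ?subr0 //.
  by apply/circle_pi_eq0; exact: (intr_int _ 1).
Qed.

End RealExtension.

Lemma Ext_path_connected (R : realType) (G : topologicalZmodType) :
  proLiePAb R G -> Ext_eq0 R (circle R) G -> path_connected R G.
Proof.
move=> hG GT x y; have [f [fc f0 f1]] := Ext_circle_path hG (y - x) GT.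
exists (fun t => x + f t); split; last 2 first.
- by rewrite f0 addr0.
- by rewrite f1 subrKC.
apply: continuous_subspaceT; apply: continuous_add2 => // t; exact: cvg_cst.
Qed.

(** * Injectivity of R and T *)

Section EuclideanExtension.
Context {R : realType}.
Local Notation T := (circle R).

Section Graph.
Context {m : nat}.

Definition graph_point (s : R) (x : power 'I_m R) : 'rV[R]_m.+1 :=
  \row_i if unlift ord0 i is Some j then x j else s.

Lemma graph_point0 s x : graph_point s x 0 ord0 = s.
Proof. by rewrite mxE unlift_none. Qed.

Lemma graph_point_lift s x j : graph_point s x 0 (lift ord0 j) = x j.
Proof. by rewrite mxE liftK. Qed.

Lemma graph_pointB s t x y :
  graph_point s x - graph_point t y = graph_point (s - t) (x - y).
Proof.
by apply/rowP => i; rewrite !mxE; case: (unlift ord0 i).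
Qed.

Definition tail_coord (P : 'cV[R]_m.+1) : chom (power 'I_m R) R :=
  mulmx_coord (\col_j P (lift ord0 j) 0) 0.

Lemma mulmx_graph_point (P : 'cV[R]_m.+1) s x :
  (graph_point s x *m P) 0 0 = s * P ord0 0 + tail_coord P x.
Proof.
rewrite mxE big_ord_recl graph_point0; congr (_ + _).
rewrite /tail_coord /= mxE; apply: eq_bigr => j _.
by rewrite graph_point_lift !mxE.
Qed.

End Graph.

(** [F] is an additive relation and is not assumed functional. In both instances [V] contains no
    nonzero subgroup, so that smallness near 0 accounts for functionality as well as continuity. *)
Definition euclidean_extension (Z : topologicalZmodType) :=
  exists2 V, nbhs (0 : Z) V & forall m (F : set (power 'I_m R * Z)),
    F 0 -> (forall x y, F x -> F y -> F (x - y)) ->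
    (exists2 U, nbhs (0 : power 'I_m R) U & forall x z, F (x, z) -> U x -> V z) ->
    exists phi : chom (power 'I_m R) Z, forall x z, F (x, z) -> phi x = z.

(* The closure of the preimage of [F] in R^(m+1) meets the axis [R x 0] in Z,
   whence a linear form that takes integer values on it and the value 1 at the
   generator of Z. *)
Lemma circle_linear_lift m (F : set (power 'I_m R * T)) :
  F 0 -> (forall x y, F x -> F y -> F (x - y)) ->
  (exists2 U, nbhs (0 : power 'I_m R) U &
    forall x z, F (x, z) -> U x -> `|crep z| < 8^-1) ->
  exists Q : 'cV[R]_m, forall x z, F (x, z) -> circle_pi (mulmx_coord Q 0 x) = z.
Proof.
move=> F0 FB [U /nbhs0_power[e e0 eU] UV].
pose S : set 'rV[R]_m.+1 :=
  [set z | exists s x, F (x, circle_pi s) /\ z = graph_point s x].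
pose M := row_closure S.
have FM s x : F (x, circle_pi s) -> M (graph_point s x).
  by move=> Fx; apply: subset_row_closure; exists s, x.
have S0 : S 0.
  exists 0, 0; rewrite chom0; split=> //.
  by apply/rowP => i; rewrite !mxE; case: unlift.
have SB x y : S x -> S y -> S (x - y).
  move=> [s [a [Fa ->]]] [t [b [Fb ->]]]; exists (s - t), (a - b).
  by rewrite graph_pointB chomB; split=> //; exact: (FB _ _ Fa Fb).
have M0 : M 0 := row_closure0 S0.
have MB x y : M x -> M y -> M (x - y) by exact: row_closureB.
pose z0 : 'rV[R]_m.+1 := graph_point 1 0.
have z0E t : t *: z0 = graph_point t 0.
  by apply/rowP => i; rewrite !mxE; case: unlift => [j|]; rewrite ?mulr1 ?mulr0.
(* If [(t, 0)] is in [M], so are its multiples, each of them close to a point of [S] near the axis.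
   Hence the multiples of [circle_pi t] are smaller than [8^-1 + 8^-1], and [circle_pi t] is 0. *)
have Mz0 t : M (t *: z0) <-> t \is a Num.int.
  rewrite z0E; split=> [Mt|tZ]; last by apply: FM; rewrite (circle_pi_eq0 t).2.
  apply/circle_pi_eq0; apply: circle_no_small_subgroup => n.
  have {}Mt : M (graph_point (t *+ n) 0).
    elim: n => [|n IH]; first by apply: FM; rewrite mulr0n chom0.
    have MN : M (- graph_point t 0) by rewrite -sub0r; exact: MB.
    have := MB _ _ IH MN; rewrite opprK.
    congr M; apply/rowP => i; rewrite !mxE; case: unlift => [j|]; rewrite ?addr0 //.
    by rewrite -mulrSr.
  have [|_ [s [x [Fx ->]]] xP] := Mt (Num.min e 8^-1).
    by rewrite lt_min e0 invr_gt0 ltr0n.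
  have : `|crep (circle_pi s)| < 8^-1.
    apply: UV Fx _; apply: eU => j; have := xP (lift ord0 j).
    by rewrite !graph_point_lift sub0r normrN lt_min => /andP[].
  have := xP ord0; rewrite !graph_point0 lt_min => /andP[_ ts] s8.
  have -> : circle_pi t *+ n = circle_pi (t *+ n - s) + circle_pi s.
    by rewrite -chomD subrK; exact: (esym (raddfMn circle_pi n t)).
  have := crep_triangle (circle_pi (t *+ n - s)) (circle_pi s).
  have := crep_le (t *+ n - s); move: ts s8; lra.
have ad : adapted M 1 (fun=> z0) (fun=> false).
  have linE x : lin 1 (fun=> z0) x = x 0%N *: z0 by rewrite /lin big_ord1.
  split=> x; rewrite linE.
    move=> xz0 i; rewrite ltnS leqn0 => /eqP ->; apply: contrapT => /eqP x0.
    have : M ((2^-1 / x 0%N * x 0%N) *: z0) by rewrite -scalerA xz0 scaler0.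
    rewrite divfK // => /Mz0/intrP[z zE].
    have : (z * 2)%:~R = (1 : int)%:~R :> R by rewrite intrM -zE mulVf.
    by move/intr_inj; lia.
  rewrite Mz0; split=> [x0 i|/(_ 0%N isT)//].
  by rewrite ltnS leqn0 => /eqP ->.
have [P [ty [Pu MP /(_ ord0 isT)[z0P ty0]]]] :=
  closed_subgroup_coordinates M0 MB (@row_closure_cvg _ _ S) ad.
have P00 : P ord0 ord0 = 1.
  have := congr1 (fun z : 'rV[R]_m.+1 => z 0 ord0) z0P.
  rewrite /= [RHS]mxE !eqxx mxE big_ord_recl graph_point0 mul1r big1 ?addr0 //.
  by move=> j _; rewrite graph_point_lift mul0r.
pose psi := tail_coord (col ord0 P).
exists (\col_j - P (lift ord0 j) ord0) => x t Fxt.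
have -> : mulmx_coord (\col_j - P (lift ord0 j) ord0) 0 x = - psi x.
  rewrite /psi /tail_coord /= !mxE -sumrN; apply: eq_bigr => j _.
  by rewrite !mxE mulrN.
have /MP/(_ ord0) : M (graph_point (crep t) x) by apply: FM; rewrite crepK.
rewrite ty0 /= => tZ.
rewrite -[RHS]crepK; apply/esym; apply: (circle_pi_eq (crep t) (- psi x)).2.
rewrite opprK.
have := mulmx_graph_point (col ord0 P) (crep t) x.
have -> : (col ord0 P) ord0 0 = 1 by rewrite mxE.
by rewrite mulr1 -/psi => <-; rewrite colE mulmxA -colE mxE.
Qed.

Lemma circle_euclidean_extension : euclidean_extension T.
Proof.
exists [set t : T | `|crep t| < 8^-1]; first by apply: nbhs0_crep; rewrite invr_gt0.
move=> m F F0 FB FU; have [Q QF] := circle_linear_lift F0 FB FU.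
by exists (precomp T (mulmx_coord Q 0) circle_pi).
Qed.

(* Simultaneous Diophantine approximation, through a limit point of the
   fractional parts of the multiples of [x]. *)
Lemma Dirichlet_approximation k (x : nat -> R) (d : R) : 0 < d ->
  exists (q : nat) (n : nat -> int), (0 < q)%N /\
    forall i, (i < k)%N -> `|q%:R * x i - (n i)%:~R| < d.
Proof.
move=> d0; have [U [UU Uoo]] := ultraFilterLemma eventually_filter.
pose fr (n i : nat) : R := n%:R * x i - (Num.floor (n%:R * x i))%:~R.
have /choice[a aP] i : exists l : R, fr n i @[n --> U] --> l.
  apply: (@ultra_bounded_cvg _ U UU _ 1) => n; rewrite /fr.
  have /andP[s1 s2] := floor_itv (n%:R * x i).
  by rewrite intrD1 in s2; rewrite ger0_norm; lra.
have d20 : 0 < d / 2 by rewrite divr_gt0.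
have Ua : U [set n | forall i : 'I_k, `|a i - fr n i| < d / 2].
  by apply: filter_forall => i; have /cvgrPdist_lt := aP i; apply.
have [n nP] := filter_ex Ua.
have Un : U [set m | (n < m)%N] by apply: Uoo; exists n.+1.
have [m [mP nm]] := filter_ex (filterI Ua Un).
exists (m - n)%N, (fun i => Num.floor (m%:R * x i) - Num.floor (n%:R * x i)).
rewrite subn_gt0; split=> // i ik.
rewrite natrB 1?ltnW // intrB.
rewrite (_ : _ - _ = (a i - fr n i) - (a i - fr m i)); last by rewrite /fr; ring.
have := ler_normB (a i - fr n i) (a i - fr m i).
have := nP (Ordinal ik); have := mP (Ordinal ik); rewrite /=; lra.
Qed.

(** The linear span of [F] does not contain the vertical axis: otherwise Dirichlet's theorem would
    give an element of [F] close to [q] times the unit vertical vector with [q >= 1], against the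
    smallness of [F] near 0. A linear form that vanishes on the span and is 1 at the unit vertical
    vector gives [phi]. *)
Lemma real_euclidean_extension : euclidean_extension (R : topologicalZmodType).
Proof.
exists (ball 0 2^-1); first by apply: nbhsx_ballx; rewrite invr_gt0.
move=> m F F0 FB [U /nbhs0_power[e e0 eU] UV].
pose S (z : 'rV[R]_m.+1) := F ((fun j => z 0 (lift ord0 j)), z 0 ord0).
have S0 : S 0.
  rewrite /S (_ : (_, _) = 0) //; congr (_, _); last by rewrite mxE.
  by apply/funext => j; rewrite mxE.
have SB x y : S x -> S y -> S (x - y).
  move=> Sx Sy; have := FB _ _ Sx Sy; rewrite /S; congr F.
  by congr (_, _); [apply/funext => j|]; rewrite !mxE.
have SN x : S x -> S (- x) by move=> Sx; rewrite -sub0r; exact: SB.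
have SD x y : S x -> S y -> S (x + y).
  by move=> Sx /SN Sy; rewrite -[y]opprK; exact: SB.
have SZ x (n : int) : S x -> S (x *~ n).
  move=> Sx; have Sn p : S (x *+ p).
    by elim: p => [|p IH]; rewrite ?mulr0n // mulrSr; exact: SD.
  by case: n => p; rewrite ?NegzE ?mulrNz -pmulrn //; exact: SN.
have [k [v [vi vS vspan]]] : exists k (v : nat -> 'rV[R]_m.+1), [/\ independent k v,
    forall i, (i < k)%N -> S (v i) & forall u, S u -> exists x, lin k v x = u].
  have : exists k (v : nat -> 'rV[R]_m.+1), independent k v /\
      forall i, (i < k)%N -> S (v i) by exists 0%N, (fun=> 0); split.
  move=> [k0 [v0 vS0]].
  move En : (m.+1 - k0)%N => n; elim: n k0 v0 vS0 En => [|n IH] k v [vi vS] En.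
    exists k, v; split=> // u _; apply: contrapT => nu.
    have := independent_leq (independent_extend vi (fun x xu => nu (ex_intro _ x xu))).
    by rewrite -subn_eq0; move: En; lia.
  have [//|nu] := pselect (forall u, S u -> exists x, lin k v x = u); first by exists k, v.
  have [u [Su uk]] : exists u, S u /\ forall x, lin k v x <> u.
    apply: contrapT => nu'; apply: nu => u Su; apply: contrapT => nx.
    by apply: nu'; exists u; split=> // x xu; apply: nx; exists x.
  apply: (IH k.+1 (extend_with k v u)); last by rewrite subnS En.
  split; first exact: independent_extend.
  move=> i; rewrite ltnS leq_eqVlt => /orP[/eqP ->|ik]; first by rewrite extend_eq.
  by rewrite extend_lt //; exact: vS.
pose e0' : 'rV[R]_m.+1 := delta_mx 0 ord0.
have e0k x : lin k v x <> e0'.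
  move=> xe.
  (* An error of at most [Num.min e 2^-1 / C] on each coefficient moves each entry of the
     combination by less than [Num.min e 2^-1]. *)
  pose C := 1 + \sum_(i < k) \sum_j `|v i 0 j|.
  have C0 : 0 < C.
    by rewrite ltr_pwDl // sumr_ge0 // => i _; exact: sumr_ge0.
  have d0 : 0 < Num.min e 2^-1 / C by rewrite divr_gt0 // lt_min e0 invr_gt0 /=.
  have [q [n [q0 qn]]] := Dirichlet_approximation k x d0.
  pose w := lin k v (fun i => (n i)%:~R).
  have Sw : S w.
    rewrite /w /lin; apply: big_ind => //.
    by move=> i _; rewrite scaler_int; apply: SZ; exact: vS.
  have we j : `|q%:R * e0' 0 j - w 0 j| < Num.min e 2^-1.
    have -> : q%:R * e0' 0 j - w 0 j = \sum_(i < k) (q%:R * x i - (n i)%:~R) * v i 0 j.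
      rewrite -xe /w /lin !summxE mulr_sumr -sumrB; apply: eq_bigr => i _.
      by rewrite !mxE mulrBl mulrA.
    apply: le_lt_trans (ler_norm_sum _ _ _) _.
    have : \sum_(i < k) `|(q%:R * x i - (n i)%:~R) * v i 0 j| <=
        Num.min e 2^-1 / C * \sum_(i < k) \sum_j `|v i 0 j|.
      rewrite mulr_sumr; apply: ler_sum => i _; rewrite normrM ler_pM //.
        by apply: ltW; exact: qn.
      by rewrite (bigD1 j) //= lerDl sumr_ge0.
    move=> /le_lt_trans; apply; rewrite mulrAC ltr_pdivrMr // ltr_pM2l.
      by rewrite /C ltrDr.
    by rewrite lt_min e0 invr_gt0 /=.
  have : ball 0 2^-1 (w 0 ord0).
    apply: UV Sw _; apply: eU => j; have := we (lift ord0 j).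
    by rewrite mxE /= mulr0 sub0r normrN lt_min => /andP[].
  have := we ord0; rewrite mxE !eqxx mulr1 lt_min => /andP[_].
  rewrite /ball /= sub0r normrN !ltr_norml => /andP[w1 w2] /andP[w3 w4].
  have : (1 : R) <= q%:R by rewrite ler1n.
  by lra.
have [w wi wE] := independent_basis (independent_extend vi e0k).
pose Q := \matrix_(i < m.+1) w i.
have Qu : Q \in unitmx by rewrite -row_free_unit; exact: independent_row_free.
have km : (k < m.+1)%N := independent_leq (independent_extend vi e0k).
pose P := col (Ordinal km) (invmx Q).
have wP (i : 'I_m.+1) : (w i *m P) 0 0 = (i == k :> nat)%:R.
  have -> : w i = row i Q by rewrite rowK.
  by rewrite /P colE mulmxA -row_mul mulmxV // -colE !mxE.
have Pe : P ord0 0 = 1.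
  have := wP (Ordinal km).
  by rewrite wE //= extend_eq eqxx /e0' -rowE mxE.
exists (- tail_coord P) => x z Fxz.
have [y yE] : exists y, lin k v y = graph_point z x.
  apply: vspan; rewrite /S graph_point0.
  by under eq_fun do rewrite graph_point_lift.
have := mulmx_graph_point P z x; rewrite -yE Pe mulr1.
rewrite /lin mulmx_suml summxE big1 => [/esym/eqP|i _].
  by rewrite addr_eq0 chom_oppE => /eqP ->.
have im : (i < m.+1)%N := ltn_trans (ltn_ord i) km.
have := wP (Ordinal im); rewrite /= wE ?(leqW (ltn_ord i)) //.
rewrite extend_lt // (ltn_eqF (ltn_ord i)) /= => viP.
by rewrite -scalemxAl mxE viP mulr0.
Qed.

End EuclideanExtension.

Lemma chom_ext (A B : topologicalZmodType) (f g : chom A B) :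
  (forall x, f x = g x) -> f = g.
Proof. by move=> fg; apply: val_inj; apply/funext. Qed.

Section Injectivity.
Variable R : realType.
Local Notation T := (circle R).

(* [i A] need not have a closed image in the Lie quotient [B / N], hence the
   extension property of R^m for arbitrary subgroups. *)
Lemma chom_extension (A B Z : topologicalZmodType) (i : chom A B) (f : chom A Z) :
  proLiePAb R B -> closed_embedding i -> @euclidean_extension R Z -> divisible Z ->
  exists h : chom B Z, forall a, h (i a) = f a.
Proof.
move=> [Bp BL] iemb [V V0 Vext] Zdiv.
have [W W0 WV] := closed_embedding_nbhs0 iemb (nbhs0_preimage f V0).
have [W1 [W10 _ _ W1W]] := nbhs0_split W0.
have [N [Ncl NW1 [m [e eo]]]] := (pro_lie_cover Bp).1 BL _ W10.
pose q := quotient_pi N.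
pose F : set (power 'I_m R * Z) := [set z | exists a, e z.1 = q (i a) /\ z.2 = f a].
have F0 : F 0 by exists 0; rewrite !chom0.
have FB x y : F x -> F y -> F (x - y).
  move=> [a [xa xf]] [b [yb yf]]; exists (a - b); split; last first.
    by rewrite chomB -xf -yf.
  have -> : e (x - y).1 = e x.1 - e y.1 by exact: (chomB e).
  by rewrite !chomB xa yb.
have [|phi phiF] := Vext m F F0 FB.
  exists (e @^-1` (q @` W1)).
    by apply: nbhs0_preimage; exact: quotient_pi_open.
  move=> x z [a [xa zf]] [w W1w wx]; have -> : z = f a := zf; apply: WV.
  have {}xa : e x = q (i a) := xa.
  rewrite -(subrKC w (i a)); apply: W1W => //; apply: NW1.
  by apply/quotient_pi_eq0; rewrite chomB -/q -xa -wx subrr.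
pose S : set (B * Z) := [set z | exists x a, q z.1 = e x + q (i a) /\ z.2 = phi x + f a].
have [h hB hS] : exists2 h : B -> Z, zmod_morphism h & forall x y, S (x, y) -> h x = y.
  apply: divisible_extension Zdiv _ _; split.
  - by exists 0, 0; rewrite !chom0 !addr0.
  - move=> u v [x [a [ux uf]]] [y [b [vy vf]]]; exists (x - y), (a - b).
    split.
      have -> : q (u.1 - v.1) = q u.1 - q v.1 by exact: chomB.
      by rewrite ux vy (chomB e) (chomB i) (chomB q) opprD addrACA.
    have -> : (u.1 - v.1, u.2 - v.2).2 = u.2 - v.2 by [].
    by rewrite uf vf (chomB phi) (chomB f) opprD addrACA.
  - move=> d [x [a [x0 dE]]]; have {}x0 : q 0 = e x + q (i a) := x0.
    have -> : d = phi x + f a := dE.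
    rewrite chom0 in x0.
    have /phiF : F (- x, f a).
      exists a; split=> //; have : e (- x) = q (i a); last by [].
      by rewrite chomN; apply/eqP; rewrite eq_sym -addr_eq0 addrC -x0.
    by rewrite chomN => <-; rewrite subrr.
have hc : continuous h.
  apply: continuous_additive => // U /(nbhs0_preimage phi)/eo/(nbhs0_preimage q).
  apply: filterS => b [x Ux xb].
  suff hb : h b = phi x by rewrite /preimage /mkset hb.
  apply: hS; exists x, 0; split; last by rewrite chom0 addr0.
  by rewrite !chom0 addr0.
exists (mk_chom hB hc) => a; rewrite mk_chomE.
apply: hS; exists 0, a; split; last by rewrite chom0 add0r.
by rewrite chom0 add0r.
Qed.

Lemma chom_extension_power (I J : Type) (A B : topologicalZmodType) (i : chom A B)
    (f : chom A (dsum (power I R) (power J T))) :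
  proLiePAb R B -> closed_embedding i ->
  exists h : chom B (dsum (power I R) (power J T)), forall a, h (i a) = f a.
Proof.
move=> Bp iemb.
pose fR x := precomp _ f (precomp _ chom_fst (power_eval x)) : chom A R.
pose fT y := precomp _ f (precomp _ chom_snd (power_eval y)) : chom A T.
have /choice[hR hRE] x : exists h : chom B R, forall a, h (i a) = fR x a.
  by apply: chom_extension => //; [exact: real_euclidean_extension|exact: real_divisible].
have /choice[hT hTE] y : exists h : chom B T, forall a, h (i a) = fT y a.
  by apply: chom_extension => //; [exact: circle_euclidean_extension|exact: circle_divisible].
exists (chom_pair (chom_power hR) (chom_power hT)) => a.
rewrite chom_pairE [RHS]surjective_pairing; congr (_, _); apply/funext => x.
  exact: hRE.
exact: hTE.
Qed.

Lemma power_injective (I J : Type) (G : topologicalZmodType) : proLiePAb R G ->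
  isomorphic G (dsum (power I R) (power J T)) -> injective_object R G.
Proof.
move=> Gp [f [g [fK gK]]]; split=> // A B C i p [Ap Bp Cp [iI irng prng] iemb].
have ps b : exists a, p a = b.
  have [x _ xa] : range p b by rewrite prng.
  by exists x.
have po : open_hom p.
  apply: (@open_mapping R); [by apply/(polish_groupP R); case: Bp|by case: Cp|exact: ps].
split.
- move=> h k hk; apply: chom_ext => c; have [b <-] := ps c.
  exact: (congr1 (fun u : chom B G => u b) hk).
- apply/seteqP; split=> [_ [h _ <-]|h /= hi].
    apply: chom_ext => a; have : [set b | p b = 0] (i a) by rewrite -irng; exists a.
    by move=> /= pia; apply: etrans (congr1 h pia) (chom0 h).
  have [|k kE] := chom_factor (h := h) po ps.
    move=> b pb; have [a _ <-] : range i b by rewrite irng.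
    exact: (congr1 (fun u : chom A G => u a) hi).
  by exists k => //; apply: chom_ext.
- apply/seteqP; split=> // h _.
  have [k kE] := chom_extension_power (precomp _ h f) Bp iemb.
  exists (precomp _ k g) => //; apply: chom_ext => a.
  by apply: etrans (congr1 g (kE a)) (fK _).
Qed.

Lemma power_path_connected (I J : Type) (G : topologicalZmodType) :
  isomorphic G (dsum (power I R) (power J T)) -> path_connected R G.
Proof.
move=> [f [g [fK gK]]] x y.
pose d := f (y - x).
have linc (t : R) : continuous (fun s : R => s * t).
  by move=> s; apply: cvgMl; exact: cvg_id.
pose c (s : R) : dsum (power I R) (power J T) :=
  ((fun i => s * d.1 i) : power I R,
   (fun j => circle_pi (s * crep (d.2 j))) : power J T).
have cc : continuous c.
  apply: continuous_dsum; apply: continuous_power => k; first exact: linc.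
  move=> s; apply: (@continuous_comp R R T (fun s => s * crep (d.2 k)) circle_pi).
    exact: linc.
  exact: chom_continuous.
exists (fun s => x + g (c s)); split.
- apply: continuous_subspaceT; apply: continuous_add2 => s; first exact: cvg_cst.
  by apply: continuous_comp; [exact: cc|exact: chom_continuous].
- rewrite (_ : c 0 = 0) ?chom0 ?addr0 //; congr (_, _); apply/funext => k.
    exact: mul0r.
  by rewrite mul0r chom0.
- rewrite (_ : c 1 = d) /d ?fK ?subrKC //.
  rewrite /c [RHS]surjective_pairing; congr (_, _); apply/funext => k.
    exact: mul1r.
  by rewrite mul1r crepK.
Qed.

End Injectivity.

(** * Lifts of characters *)

Lemma cvg_sub2 (H : topologicalZmodType) (S : Type) (F : set_system S) (a b : S -> H) x y :
  Filter F -> a @ F --> x -> b @ F --> y -> (fun n => a n - b n) @ F --> x - y.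
Proof.
move=> FF ax bx; have abx : (a n, b n) @[n --> F] --> (x, y).
  by apply: cvg_pair; [exact: ax|exact: bx].
exact: cvg_comp abx (@sub_continuous H (x, y)).
Qed.

Section Increments.
Context {R : realType} {G : topologicalZmodType}.

(** [inc g k i] is the increment, over the dyadic interval of index [i] and length [2^-k], of a path
    from 0 to [g]. Characters are lifted by means of these three properties only. *)
Definition dyadic_increments (inc : G -> nat -> nat -> G) :=
  [/\ forall g k, \sum_(i < 2 ^ k) inc g k i = g,
      forall g k i, inc g k i = inc g k.+1 i.*2 + inc g k.+1 i.*2.+1 &
      forall g U, nbhs 0 U ->
        exists K, forall k i, (K <= k)%N -> (i < 2 ^ k)%N -> U (inc g k i)].

(** The third property is uniform continuity on [0, 1]: the two endpoints of shorter and shorter bad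
    intervals have a common limit along an ultrafilter, where the path is continuous. *)
Lemma path_increments : path_connected R G ->
  exists inc, dyadic_increments inc.
Proof.
move=> Gpc; have /choice[f fP] g := Gpc 0 g.
pose t k i : R := i%:R / (2 ^ k)%:R.
have p2 k : (2 ^ k)%:R != 0 :> R by rewrite pnatr_eq0 expn_eq0.
have p20 k : 0 < (2 ^ k)%:R :> R by rewrite ltr0n expn_gt0.
have t2 k i : t k.+1 i.*2 = t k i.
  by rewrite /t expnS -mul2n !natrM invfM mulrACA divff ?mul1r // pnatr_eq0.
have t01 k i : (i <= 2 ^ k)%N -> t k i \in `[0, 1].
  move=> ik; rewrite in_itv /= divr_ge0 //= ler_pdivrMr // mul1r ler_nat //.
exists (fun g k i => f g (t k i.+1) - f g (t k i)); split.
- move=> g k; have [_ f0 f1] := fP g.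
  rewrite -(big_mkord xpredT (fun i => f g (t k i.+1) - f g (t k i))).
  rewrite telescope_sumr // /t divff // mul0r f0 f1.
  by rewrite subr0.
- move=> g k i; have -> : t k i.+1 = t k.+1 i.*2.+2 by rewrite -doubleS t2.
  by rewrite -(t2 k i) [RHS]addrC subrKA.
- move=> g U U0; have [fc _ _] := fP g.
  apply: contrapT => nK.
  have /choice[c cP] n : exists c : nat * nat, [/\ (n <= c.1)%N, (c.2 < 2 ^ c.1)%N &
      ~ U (f g (t c.1 c.2.+1) - f g (t c.1 c.2))].
    apply: contrapT => nc; apply: nK; exists n => k i nk ik.
    by apply: contrapT => nU; apply: nc; exists (k, i).
  have [F [FU Foo]] := ultraFilterLemma eventually_filter.
  pose a n := t (c n).1 (c n).2; pose b n := t (c n).1 (c n).2.+1.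
  have a01 n : a n \in `[0, 1] by have [_ /ltnW ? _] := cP n; exact: t01.
  have b01 n : b n \in `[0, 1] by have [_ ? _] := cP n; exact: t01.
  have [l al] : exists l : R, a @ F --> l.
    apply: (@ultra_bounded_cvg _ F FU _ 1) => n.
    by have := a01 n; rewrite in_itv /= => /andP[a0 a1]; rewrite ger0_norm.
  have bl : b @ F --> l.
    rewrite -[l]addr0 (_ : b = fun n => a n + (2 ^ (c n).1)%:R^-1); last first.
      by apply/funext => n; rewrite /b /a /t -natr1 mulrDl mul1r.
    apply: cvgD => //; apply/cvgrPdist_lt => e e0; apply: Foo.
    exists (Num.truncn e^-1) => // m /= em; rewrite sub0r normrN ger0_norm ?invr_ge0 //.
    rewrite -ltf_pV2 ?(posrE,invr_gt0) // invrK (lt_le_trans (truncnS_gt _)) //.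
    rewrite ler_nat (leq_ltn_trans em) //; have [mc _ _] := cP m.
    by apply: leq_ltn_trans mc _; exact: ltn_expl.
  have l01 : l \in `[0, 1].
    apply: (@closed_cvg _ _ F _ a [set` `[0, 1]%R]) => //.
      exact: interval_closed.
    exact: (@filterE _ F).
  have [V [V0 _ VU _]] := nbhs0_split U0.
  have fl : nbhs (f g l) (fun y => V (y - f g l)) by exact/nbhs_shiftB.
  have /= W := (subspace_continuousP _ _).1 fc l l01 _ fl.
  have Fa : F [set n | V (f g (a n) - f g l)].
    by apply: (@filterS _ F _ _ _ _ (al _ W)) => n; apply; exact: a01.
  have Fb : F [set n | V (f g (b n) - f g l)].
    by apply: (@filterS _ F _ _ _ _ (bl _ W)) => n; apply; exact: b01.
  have [n [an bn]] := filter_ex (filterI Fa Fb).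
  have [_ _ nU] := cP n; apply: nU.
  have -> : f g (b n) - f g (a n) = (f g (b n) - f g l) - (f g (a n) - f g l).
    by rewrite opprB subrKA.
  by apply: VU; [exact: bn|exact: an].
Qed.

End Increments.

(** * Baire category and families of characters *)

Section BaireCategory.
Context {R : realType} {G : topologicalZmodType}.
Hypothesis Gm : completely_metrizable R G.
Local Notation T := (circle R).

Lemma Baire_difference (F : nat -> set G) :
  (forall n, closed (F n)) -> (forall x, exists n, F n x) ->
  exists N, nbhs 0 [set g | exists a b, [/\ F N a, F N b & g = a - b]].
Proof.
move=> Fcl Fcov; have [n [x xF]] := Baire_group Gm Fcl Fcov.
exists n; apply: filterS ((nbhs_shift x _).1 xF) => g Fg.
by exists (x + g), x; split=> //; [exact: nbhs_singleton|rewrite addrAC subrr add0r].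
Qed.

Lemma closed_crep_le (f : chom G T) (e : R) : closed [set g | `|crep (f g)| <= e].
Proof.
move=> g gcl /=; rewrite leNgt; apply/negP => eg.
have d0 : 0 < `|crep (f g)| - e by rewrite subr_gt0.
have := nbhs_shiftN g (nbhs0_preimage f (nbhs0_crep d0)).
move=> /gcl[h [/= he]]; rewrite /preimage /mkset chomB => hd.
have := crep_triangle (f h) (f g - f h); rewrite subrKC; lra.
Qed.

(* Osgood's theorem. *)
Lemma pointwise_null_equicontinuous (chi : nat -> chom G T) (e : R) : 0 < e ->
  (forall g, crep (chi n g) @[n --> \oo] --> (0 : R)) ->
  exists N, nbhs 0 [set g | forall n, (N <= n)%N -> `|crep (chi n g)| <= e].
Proof.
move=> e0 chi0; have e20 : 0 < e / 2 by rewrite divr_gt0.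
have [||N NU] := Baire_difference
    (F := fun N => \bigcap_(n in [set n | (N <= n)%N]) [set g | `|crep (chi n g)| <= e / 2]).
- by move=> N; apply: closed_bigI => n _; exact: closed_crep_le.
- move=> g; have /cvgrPdist_le/(_ _ e20)[N _ NP] := chi0 g.
  by exists N => n Nn; have := NP n Nn; rewrite /= sub0r normrN.
exists N; apply: filterS NU => _ [a [b [aF bF ->]]] n Nn.
rewrite chomB (le_trans (crep_triangle _ _)) // crep_normN.
have := aF n Nn; have := bF n Nn; rewrite /=; lra.
Qed.

(** By Baire's theorem the differences [chi n - chi N] with [n >= N] are at most [e / 4] on one
    neighborhood of 0. Continuity of [chi N] and pointwise convergence contribute [e / 4] each. *)
Lemma pointwise_limit_continuous (chi : nat -> chom G T) (f : G -> T) :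
  (forall g, chi n g @[n --> \oo] --> f g) ->
  exists h : chom G T, forall g, h g = f g.
Proof.
move=> chif.
have small g e : 0 < e -> exists N, forall n, (N <= n)%N -> `|crep (chi n g - f g)| < e.
  move=> e0; have /chif[N _ NP] := (nbhs_shiftB (f g) _).2 (nbhs0_crep e0).
  by exists N => n Nn; exact: NP.
have Th : hausdorff_space T by have [] := @polish_circle R.
have fB : zmod_morphism f.
  move=> g h; apply: (cvg_unique Th (chif (g - h))).
  rewrite (_ : (fun n => _) = fun n => chi n g - chi n h); last first.
    by apply/funext => n; exact: chomB.
  exact: cvg_sub2.
suff fc : continuous f by exists (mk_chom fB fc).
apply: continuous_additive => // U /nbhs0_crep_ex[e e0 eU].
have e80 : 0 < e / 8 by rewrite divr_gt0.
have [||N NU] := Baire_difference (F := fun N => \bigcap_(n in [set n | (N <= n)%N])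
    [set g | `|crep ((chi n - chi N) g)| <= e / 8]).
- by move=> N; apply: closed_bigI => n _; exact: closed_crep_le.
- move=> g; have e160 : 0 < e / 16 by rewrite divr_gt0.
  have [N NP] := small g _ e160; exists N => n Nn.
  suff: `|crep ((chi n - chi N) g)| <= e / 8 by [].
  have -> : (chi n - chi N) g = (chi n g - f g) - (chi N g - f g).
    by rewrite chom_addE chom_oppE opprB subrKA.
  rewrite (le_trans (crep_triangle _ _)) // crep_normN.
  have := NP n Nn; have := NP N (leqnn N); lra.
have e40 : 0 < e / 4 by rewrite divr_gt0.
apply: filterS (filterI NU (nbhs0_preimage (chi N) (nbhs0_crep e40))).
move=> g [[a [b [aF bF gab]]] gN]; apply: eU.
have [n1 P1] := small g _ e40; pose n := maxn n1 N.
have Pn := P1 n (leq_maxl _ _).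
have aP := aF n (leq_maxr _ _); have bP := bF n (leq_maxr _ _).
rewrite /= in aP bP gN.
have gP : `|crep ((chi n - chi N) g)| <= e / 4.
  rewrite gab chomB (le_trans (crep_triangle _ _)) // crep_normN.
  by move: aP bP; lra.
have -> : f g = - (chi n g - f g) + ((chi n - chi N) g + chi N g).
  by rewrite chom_addE chom_oppE subrK opprB subrK.
apply: le_lt_trans (crep_triangle _ _) _; rewrite crep_normN.
have := crep_triangle ((chi n - chi N) g) (chi N g).
by move: gP gN Pn; rewrite /preimage /mkset; lra.
Qed.

(** All the values of [c] are used. The defect of additivity of [v] has only integer multiples,
    hence is 0. By Baire's theorem the characters with small [c] are uniformly small near 0, which
    bounds [v] there; an additive function bounded near 0 is continuous. *)
Lemma lift_continuous (v : G -> R) (chi : R -> chom G T) :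
  (forall c g, chi c g = circle_pi (c * v g)) ->
  exists h : chom G R, forall g, h g = v g.
Proof.
move=> chiv; have vB : zmod_morphism v.
  move=> g h; apply/eqP; rewrite -subr_eq0; set d := _ - _.
  apply: contrapT => /negP d0.
  have : (2^-1 / d) * d \is a Num.int.
    apply/circle_pi_eq0; rewrite /d mulrBr mulrBr 2!chomB -!chiv -chomB.
    by rewrite subrr.
  rewrite divfK // => /intrP[z zE].
  have : (z * 2)%:~R = (1 : int)%:~R :> R by rewrite intrM -zE mulVf.
  by move/intr_inj; lia.
suff vc : continuous v by exists (mk_chom vB vc).
have [||N NU] := Baire_difference (F := fun n =>
    \bigcap_(c in [set c : R | `|c| <= n.+1%:R^-1]) [set g | `|crep (chi c g)| <= 4^-1]).
- by move=> n; apply: closed_bigI => c _; exact: closed_crep_le.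
- move=> g; exists (Num.truncn (4 * `|v g|)) => c /= cn.
  rewrite chiv (le_trans (crep_le _)) // normrM.
  have n0 : 0 < (Num.truncn (4 * `|v g|)).+1%:R :> R by rewrite ltr0n.
  have := truncnS_gt (4 * `|v g|).
  have : `|c| * `|v g| <= (Num.truncn (4 * `|v g|)).+1%:R^-1 * `|v g|.
    by rewrite ler_wpM2r.
  move=> /le_trans h1 h2; apply: h1; rewrite mulrC ler_pdivrMr //; lra.
pose B : R := N.+1%:R.
have B0 : 0 < B by rewrite ltr0n.
have vF g : (\bigcap_(c in [set c : R | `|c| <= B^-1])
    [set g | `|crep (chi c g)| <= 4^-1]) g -> `|v g| <= B.
  move=> gF; rewrite leNgt; apply/negP => vg.
  have v0 : v g != 0 by rewrite -normr_gt0 (lt_trans B0).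
  (* [3 / 8] is below [2^-1], hence its own representative, and above the bound [4^-1]. *)
  have : `|crep (chi ((3 / 8) / v g) g)| <= 4^-1.
    apply: gF => /=; rewrite normrM normfV ger0_norm ?divr_ge0 //.
    rewrite ler_pdivrMr ?normr_gt0 // [B^-1 * _]mulrC ler_pdivlMr //; lra.
  rewrite chiv divfK // crep_circle_pi ger0_norm; lra.
have vU : nbhs 0 [set g | `|v g| <= 2 * B].
  apply: filterS NU => _ [a [b [/vF aB /vF bB ->]]] /=.
  by rewrite vB (le_trans (ler_normB _ _)) //; move: aB bB; lra.
have vM g n : v (g *+ n) = n%:R * v g.
  elim: n => [|n IH].
    by have := vB 0 0; rewrite !subrr mulr0n mul0r.
  have := vB (g *+ n.+1) g; rewrite {1}mulrSr addrK IH => /(congr1 (fun x => x + v g)).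
  by rewrite subrK -natr1 mulrDl mul1r.
have mulrn_nbhs n : nbhs 0 [set g : G | `|v (g *+ n)| <= 2 * B].
  have mc : continuous (fun g : G => g *+ n).
    elim: n => [|n IH] g.
      by rewrite (_ : (fun _ => _) = cst 0); [exact: cvg_cst|apply/funext => h; rewrite mulr0n].
    rewrite (_ : (fun _ => _) = fun g : G => g + g *+ n).
      by apply: continuous_add2 => // h; exact: cvg_id.
    by apply/funext => h; rewrite mulrS.
  by have := mc 0 [set g | `|v g| <= 2 * B]; rewrite mul0rn; apply.
apply: continuous_additive => // U /nbhs_ballP[e /= e0 eU].
pose n := (Num.truncn (2 * B / e)).+1.
apply: filterS (mulrn_nbhs n) => g /= gn; apply: eU.
rewrite /ball /= sub0r normrN.
have n0 : 0 < n%:R :> R by rewrite ltr0n.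
move: gn; rewrite vM normrM normr_nat mulrC -ler_pdivlMr // => /le_lt_trans; apply.
rewrite ltr_pdivrMr // [e * _]mulrC -ltr_pdivrMr //; exact: truncnS_gt.
Qed.

End BaireCategory.

(** * Lifts along paths *)

Section CharacterLift.
Context {R : realType} {G : topologicalZmodType} (inc : G -> nat -> nat -> G).
Hypothesis incP : dyadic_increments inc.
Local Notation T := (circle R).

Definition dyadic_sum (a : G -> R) g k := \sum_(i < 2 ^ k) a (inc g k i).

(** Once the increments are small, splitting each of them in two does not change the sum, because
    [a] is additive on the two halves. *)
Lemma dyadic_sum_stable (a : G -> R) g K :
  (forall x y, `|a x| < 8^-1 -> `|a y| < 8^-1 -> a (x + y) = a x + a y) ->
  (forall k i, (K <= k)%N -> (i < 2 ^ k)%N -> `|a (inc g k i)| < 8^-1) ->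
  forall k, (K <= k)%N -> dyadic_sum a g k = dyadic_sum a g K.
Proof.
move=> aD small k /subnKC <-; elim: (k - K)%N => [|d IH]; first by rewrite addn0.
rewrite -IH addnS; have [_ split_inc _] := incP.
have sum_double n (b : nat -> R) :
    \sum_(i < n.*2) b i = \sum_(i < n) (b i.*2 + b i.*2.+1).
  by elim: n => [|n IHn]; rewrite ?big_ord0 // doubleS !big_ord_recr /= IHn addrA.
rewrite /dyadic_sum expnS mul2n.
rewrite (sum_double _ (fun i => a (inc g (K + d).+1 i))); apply: eq_bigr => i _.
rewrite [in RHS]split_inc aD //; apply: small.
- by rewrite -addnS leq_addr.
- by rewrite expnS mul2n ltn_double.
- by rewrite -addnS leq_addr.
- by rewrite expnS mul2n -doubleS leq_double.
Qed.

Let aD (chi : chom G T) x y : `|crep (chi x)| < 8^-1 -> `|crep (chi y)| < 8^-1 ->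
  crep (chi (x + y)) = crep (chi x) + crep (chi y).
Proof. by move=> x8 y8; rewrite chomD crepD //; move: x8 y8; lra. Qed.

Fact lift_exists (chi : chom G T) g : exists r, exists K,
  forall k, (K <= k)%N -> dyadic_sum (fun x => crep (chi x)) g k = r.
Proof.
have [_ _ small] := incP.
have c8 : 0 < 8^-1 :> R by rewrite invr_gt0.
have [K KP] := small g _ (nbhs0_preimage chi (nbhs0_crep c8)).
exists (dyadic_sum (fun x => crep (chi x)) g K), K.
by apply: dyadic_sum_stable; [exact: aD|exact: KP].
Qed.

(* The endpoint of the lift to R of the image under [chi] of a path from 0
   to [g]. *)
Definition lift (chi : chom G T) : G -> R^o :=
  fun g => projT1 (cid (lift_exists chi g)).

Lemma lift_dyadic_sum (chi : chom G T) g : exists K, forall k, (K <= k)%N ->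
  dyadic_sum (fun x => crep (chi x)) g k = lift chi g.
Proof. exact: projT2 (cid (lift_exists chi g)). Qed.

Lemma lift_dyadic_sum_small (chi : chom G T) g K :
  (forall k i, (K <= k)%N -> (i < 2 ^ k)%N -> `|crep (chi (inc g k i))| < 8^-1) ->
  lift chi g = dyadic_sum (fun x => crep (chi x)) g K.
Proof.
move=> small; have [L LP] := lift_dyadic_sum chi g.
rewrite -(LP (maxn K L)) ?leq_maxr //.
by apply: dyadic_sum_stable (leq_maxl _ _); [exact: aD|exact: small].
Qed.

Lemma circle_pi_lift (chi : chom G T) g : circle_pi (lift chi g) = chi g.
Proof.
have [K KP] := lift_dyadic_sum chi g; rewrite -(KP K (leqnn K)).
have [inc_sum _ _] := incP; rewrite -[in RHS](inc_sum g K) /dyadic_sum.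
rewrite (raddf_sum circle_pi) (raddf_sum chi).
by apply: eq_bigr => i _; exact: crepK.
Qed.

(** On a subdivision fine enough for both characters the bound [8^-1] keeps their difference below
    [4^-1], where [crep] is additive. *)
Lemma liftB (chi psi : chom G T) : lift (chi - psi) = lift chi - lift psi.
Proof.
apply/funext => g.
have [K1 P1] := lift_dyadic_sum chi g; have [K2 P2] := lift_dyadic_sum psi g.
have [K3 P3] := lift_dyadic_sum (chi - psi) g.
have [_ _ small] := incP; have c8 : 0 < 8^-1 :> R by rewrite invr_gt0.
have [K4 P4] := small g _ (filterI (nbhs0_preimage chi (nbhs0_crep c8))
  (nbhs0_preimage psi (nbhs0_crep c8))).
pose k := maxn (maxn K1 K2) (maxn K3 K4).
rewrite -(P3 k); last by rewrite !leq_max leqnn ?orbT.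
have -> : (lift chi - lift psi) g = lift chi g - lift psi g by [].
rewrite -(P1 k) ?leq_max ?leqnn // -(P2 k) ?leq_max ?leqnn ?orbT //.
rewrite /dyadic_sum -sumrB; apply: eq_bigr => i _.
have [] := P4 k i _ (ltn_ord i); first by rewrite !leq_max leqnn ?orbT.
rewrite /preimage /mkset => chi8 psi8.
have -> : chi (inc g k i) = (chi - psi) (inc g k i) + psi (inc g k i).
  by rewrite chom_addE chom_oppE subrK.
rewrite crepD ?addrK //; last by move: psi8; lra.
rewrite chom_addE chom_oppE; apply: le_lt_trans (crep_triangle _ _) _.
by rewrite crep_normN; move: chi8 psi8; lra.
Qed.

HB.instance Definition _ := GRing.isZmodMorphism.Build (chom G T) (G -> R^o)
  lift liftB.

Lemma lift_real (x : chom G R) : lift (precomp T x circle_pi) = x.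
Proof.
apply/funext => g; have [K LP] := lift_dyadic_sum (precomp T x circle_pi) g.
have [inc_sum _ small] := incP.
have c2 : 0 < 2^-1 :> R by rewrite invr_gt0.
have [L LS] := small g _ (nbhs0_preimage x (nbhsx_ballx (0 : R) _ c2)).
rewrite -(LP (maxn K L)) ?leq_maxl // -[in RHS](inc_sum g (maxn K L)).
rewrite (raddf_sum x); apply: eq_bigr => i _; apply: crep_circle_pi.
have := LS _ _ (leq_maxr K L) (ltn_ord i).
by rewrite /preimage /ball /= sub0r normrN.
Qed.

(** [g] is a sum of increments that [f] sends into the neighborhood [[set 0]]. This is what removes
    the discrete factor of the Lie quotients. *)
Lemma no_loop_discrete (D : topologicalZmodType) (f : chom G D) :
  nbhs (0 : D) [set 0] -> forall g, f g = 0.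
Proof.
move=> D0 g; have [inc_sum _ small] := incP.
have [K KP] := small g _ (nbhs0_preimage f D0).
rewrite -(inc_sum g K) (raddf_sum f) big1 // => i _.
exact: KP.
Qed.

Hypothesis Gm : completely_metrizable R G.

(** By equicontinuity, with [9^-1] as a constant below [8^-1], one subdivision computes the lifts of
    all [chi n] with [n >= N]; they are sums of a fixed finite number of null sequences. *)
Lemma lift_null (chi : nat -> chom G T) :
  (forall g, crep (chi n g) @[n --> \oo] --> (0 : R)) ->
  forall g, lift (chi n) g @[n --> \oo] --> (0 : R).
Proof.
move=> chi0 g; have c9 : 0 < 9^-1 :> R by rewrite invr_gt0.
have [N NU] := pointwise_null_equicontinuous Gm c9 chi0.
have [_ _ small] := incP; have [K KP] := small g _ NU.
have lE n : (N <= n)%N ->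
    lift (chi n) g = dyadic_sum (fun x => crep (chi n x)) g K.
  move=> Nn; apply: lift_dyadic_sum_small => k i Kk ik.
  by apply: le_lt_trans (KP k i Kk ik n Nn) _; lra.
apply: (@cvg_trans _ (dyadic_sum (fun x => crep (chi n x)) g K @[n --> \oo])).
  apply: near_eq_cvg; exists N => // n Nn; exact/esym/lE.
rewrite (_ : (0 : R) = \sum_(i < 2 ^ K) (0 : R)); last by rewrite big1.
apply: (cvg_sum_ord (f := fun i n => crep (chi n (inc g K i)))) => i.
exact: chi0.
Qed.

(** The characters converge pointwise to the reduction of the limit combination, which is thus a
    character [psi]. The lifts of [chi n - psi] tend to 0, so [psi] lifts to that combination itself
    and not to another function with the same reduction. *)
Lemma lift_span_closed : span_closed (range lift).
Proof.
move=> k v x l xl Mx.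
have /choice[chi chiE] n : exists chi, lift chi = lin k v (x n).
  by have [chi _ <-] := Mx n; exists chi.
have wl g : lin k v (x n) g @[n --> \oo] --> (lin k v l g : R).
  have linE y : lin k v y g = \sum_(i < k) y i * v i g.
    by rewrite /lin fct_sumE.
  rewrite linE (_ : (fun n => _) = fun n => \sum_(i < k) x n i * v i g); last first.
    by apply/funext => n; rewrite linE.
  apply: (cvg_sum_ord (f := fun i n => x n i * v i g)) => i.
  by apply: cvgMl; exact: xl.
have chil g : chi n g @[n --> \oo] --> circle_pi (lin k v l g).
  rewrite (_ : (fun n => _) = fun n => circle_pi (lin k v (x n) g)).
    exact: cvg_comp (wl g) (@chom_continuous _ _ circle_pi _).
  by apply/funext => n; rewrite -chiE circle_pi_lift.
have [psi psiE] := pointwise_limit_continuous Gm chil.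
exists psi => //; apply/funext => g.
have null h : crep ((chi n - psi) h) @[n --> \oo] --> (0 : R).
  apply/cvgrPdist_lt => e e0.
  have en : \forall n \near \oo, `|crep (chi n h - circle_pi (lin k v l h))| < e.
    exact: chil h _ ((nbhs_shiftB (circle_pi (lin k v l h)) _).2 (nbhs0_crep e0)).
  apply: filterS en => n; rewrite sub0r normrN chom_addE chom_oppE psiE.
  exact.
have := lift_null null g => ln.
have : lift (chi n) g - lift (chi n - psi) g @[n --> \oo] --> (lin k v l g : R) - 0.
  apply: cvgB => //; rewrite (_ : (fun n => _) = fun n => lin k v (x n) g) //.
  by apply/funext => n; rewrite chiE.
rewrite subr0 (_ : (fun n => _) = cst (lift psi g)).
  move=> e; apply/esym; apply: (cvg_unique (@Rhausdorff R) e).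
  exact: cvg_cst.
apply/funext => n; rewrite liftB.
have -> : (lift (chi n) - lift psi) g = lift (chi n) g - lift psi g by [].
by rewrite opprB addrC subrK.
Qed.

End CharacterLift.

Lemma chom_zeroE (A B : topologicalZmodType) x : (0 : chom A B) x = 0.
Proof. by rewrite -(subrr (0 : chom A B)) chom_addE chom_oppE subrr. Qed.

Section ChomScale.
Context {R : realType}.

Fact chom_scale_subproof (c : R) : (fun t : R => c * t) \in @chom_pred R R.
Proof.
apply/asboolT; split=> [x y|x]; first exact: mulrBr.
by apply: cvgMr; exact: cvg_id.
Qed.

Definition chom_scale (c : R) : chom R R := CHom (chom_scale_subproof c).

End ChomScale.

Lemma nbhs0_power_circle {R : realType} m (U : set (power 'I_m (circle R))) :
  nbhs 0 U -> exists2 e : R, 0 < e &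
  forall x : power 'I_m (circle R), (forall i, `|crep (x i)| < e) -> U x.
Proof.
pose pi : chom (power 'I_m R) (power 'I_m (circle R)) :=
  chom_power (fun i => precomp (circle R) (power_eval i) circle_pi).
move=> /(nbhs0_preimage pi)/nbhs0_power[e e0 eU]; exists e => // x xe.
have -> : x = pi (fun i => crep (x i)).
  by apply/funext => i; rewrite -[LHS]crepK.
exact: eU.
Qed.

(** * Characters that describe the neighborhoods of 0 *)

Section LieCoordinates.
Context {R : realType} {G : topologicalZmodType} (inc : G -> nat -> nat -> G).
Hypotheses (incP : dyadic_increments inc).
Local Notation T := (circle R).
Local Notation lift := (@lift R G inc incP).

(* Equivalently, [lift chi] is a continuous homomorphism: see
   [lift_continuous]. *)
Definition real_character (chi : chom G T) :=
  forall c : R, exists psi, lift psi = c *: lift chi.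

(** A real coordinate of a Lie quotient is recorded by the character that it induces; its size has
    to be measured on the lift, before reduction modulo Z. *)
Definition character_size (chi : chom G T) g :=
  if `[< real_character chi >] then `|lift chi g| else `|crep (chi g)|.

Lemma precomp_real_character (x : chom G R) :
  real_character (precomp T x circle_pi).
Proof.
move=> c; exists (precomp T (precomp R x (chom_scale c)) circle_pi).
by rewrite !lift_real.
Qed.

Lemma crep_le_character_size (chi : chom G T) g : `|crep (chi g)| <= character_size chi g.
Proof.
by rewrite /character_size; case: asboolP => // _; rewrite -(circle_pi_lift incP) crep_le.
Qed.

(** The characters are the coordinates of a Lie quotient by a small subgroup; the component in its
    discrete factor is 0 by [no_loop_discrete]. *)
Lemma lie_characters U : proLiePAb R G -> nbhs 0 U ->
  exists (s : seq (chom G T)), exists2 e : R, 0 < e &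
    forall g, (forall chi, chi \in s -> character_size chi g < e) -> U g.
Proof.
move=> hG U0; have [U1 [U10 _ _ U1U]] := nbhs0_split U0.
have [N [Ncl NU1 [_ [a [b [D [_ Dd [h [k [hK kK]]]]]]]]]] := hG.2 _ U10.
pose q := quotient_pi N.
pose E := dsum (power 'I_a R) (power 'I_b T).
have D0 : nbhs (0 : D) [set 0] by apply: open_nbhs_nbhs; split; [exact: Dd|].
have hD g : (h (q g)).2 = 0.
  exact: (no_loop_discrete incP (precomp D (precomp _ q h) chom_snd) D0 g).
pose hE : chom G E := precomp E (precomp _ q h) chom_fst.
pose x i : chom G R := precomp R hE (precomp R chom_fst (power_eval i)).
pose y j : chom G T := precomp T hE (precomp T chom_snd (power_eval j)).
have hqE g : h (q g) = (((fun i => x i g) : power 'I_a R,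
    (fun j => y j g) : power 'I_b T), 0 : D).
  by rewrite -(hD g) /x /y /=; case: (h (q g)) => [[u v] w].
have : nbhs 0 (h @` (q @` U1)).
  by apply: (isomorphic_open hK kK); exact: quotient_pi_open.
move=> /dsum_nbhs0[A [A2 [/dsum_nbhs0[B1 [B2 [B10 B20 BA]]] A20 AU]]].
have [e1 e10 e1B] := nbhs0_power B10; have [e2 e20 e2B] := nbhs0_power_circle B20.
exists ([seq precomp T (x i) circle_pi | i <- enum 'I_a] ++
        [seq y j | j <- enum 'I_b]), (Num.min e1 e2); first by rewrite lt_min e10.
move=> g small.
have : (h @` (q @` U1)) (h (q g)).
  rewrite hqE; apply: AU; last exact: nbhs_singleton.
  apply: BA; [apply: e1B => i|apply: e2B => j].
    have xi : precomp T (x i) circle_pi \in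
        [seq precomp T (x i) circle_pi | i <- enum 'I_a].
      by apply/mapP; exists i; rewrite ?mem_enum.
    have := small (precomp T (x i) circle_pi); rewrite mem_cat xi.
    rewrite /character_size (asboolT (@precomp_real_character (x i))) lift_real.
    by move=> /(_ isT); rewrite lt_min => /andP[].
  have yj : y j \in [seq y j | j <- enum 'I_b].
    by apply/mapP; exists j; rewrite ?mem_enum.
  have := small (y j); rewrite mem_cat yj orbT => /(_ isT).
  rewrite lt_min => /andP[_]; apply: le_lt_trans.
  exact: crep_le_character_size.
move=> [_ [w U1w <-] /(can_inj hK) qwg].
rewrite -(subrKC w g); apply: U1U => //; apply: NU1.
by apply/quotient_pi_eq0; rewrite chomB -/q qwg subrr.
Qed.

End LieCoordinates.

(** * Path-connected groups *)

Lemma range_enumeration (A : set nat) :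
  exists (alpha : option nat) (f : ordinal_le_omega alpha -> nat),
  injective f /\ range f = A.
Proof.
have [/finite_seqP[s sA]|Ai] := pselect (finite_set A).
  exists (Some (size (undup s))), (fun i : 'I_(size (undup s)) => nth 0%N (undup s) i).
  split=> [i j /eqP|].
    by rewrite nth_uniq ?undup_uniq ?ltn_ord // => /eqP/val_inj.
  rewrite sA; apply/seteqP; split=> [_ [i _ <-]|x] /=.
    by rewrite -mem_undup mem_nth.
  rewrite -mem_undup => xs; have ix : (index x (undup s) < size (undup s))%N.
    by rewrite index_mem.
  by exists (Ordinal ix) => //=; rewrite nth_index.
have : ([set: nat] #= A)%card.
  by rewrite card_eq_sym; exact: eq_card_nat (countableP _) Ai.
move=> /card_set_bijP[f [fA fi fs]]; exists None, f; split.
  by move=> i j; apply: fi; rewrite inE.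
by apply/seteqP; split=> [_ [i _ <-]|x /fs]; [exact: fA|].
Qed.

Section LinDelta.
Context {R : realType} {V : lmodType R}.

Lemma lin_delta k (v : nat -> V) i c : (i < k)%N ->
  lin k v (fun j => c * (j == i)%:R) = c *: v i.
Proof.
move=> ik; rewrite /lin (bigD1 (Ordinal ik)) //= eqxx mulr1 big1 ?addr0 // => j.
by rewrite -val_eqE /= => /negbTE ->; rewrite mulr0 scale0r.
Qed.

Lemma adapted_mem (M : set V) k (v : nat -> V) tau i : adapted M k v tau ->
  (i < k)%N -> M (v i).
Proof.
move=> [_ vM] ik; rewrite -[v i]scale1r -(lin_delta v 1 ik); apply/vM => j jk.
by case: (j == i); rewrite ?mulr1 ?mulr0 ?rpred0 ?rpred1 orbT.
Qed.

Lemma adapted_line (M : set V) k (v : nat -> V) tau i c : adapted M k v tau ->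
  (i < k)%N -> tau i -> M (c *: v i).
Proof.
move=> [_ vM] ik ti; rewrite -(lin_delta v c ik); apply/vM => j jk.
by case: eqVneq => [->|_]; rewrite ?ti // mulr0 rpred0 orbT.
Qed.

End LinDelta.

Section Classification.
Context {R : realType} {G : topologicalZmodType} (inc : G -> nat -> nat -> G).
Hypotheses (incP : dyadic_increments inc) (Gm : completely_metrizable R G).
Local Notation T := (circle R).
Local Notation lift := (@lift R G inc incP).
Local Notation M := (range lift).

Section Density.
Variables (k : nat) (v : nat -> G -> R^o) (tau : nat -> bool).
Hypothesis kvt : adapted M k v tau.

(* By Kronecker's argument: otherwise a closed subgroup of R^k would provide
   a nontrivial combination of the [v i] with integer values, that is, a lift of
   the zero character. *)
Lemma adapted_dense (t : 'I_k -> R) (e : R) : 0 < e -> exists g, forall i : 'I_k,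
  if tau i then `|t i - v i g| < e else `|crep (circle_pi (t i - v i g))| < e.
Proof.
move=> e0.
have /choice[X XE] (i : 'I_k) : exists chi, lift chi = v i.
  by have [chi _ <-] := adapted_mem kvt (ltn_ord i); exists chi.
have /choice[W WE] (i : 'I_k) : exists w : chom G R, tau i -> forall g, w g = v i g.
  case ti : (tau i); last by exists 0.
  have /choice[chi chiE] c : exists chi, lift chi = c *: v i.
    have [chi _ <-] := adapted_line c kvt (ltn_ord i) ti; by exists chi.
  have [|w wE] := lift_continuous Gm (v := v i) (chi := chi); last by exists w.
  by move=> c g; rewrite -(circle_pi_lift incP) chiE.
have XvE (i : 'I_k) g : circle_pi (v i g) = X i g by rewrite -XE circle_pi_lift.
(* The tuples of values taken simultaneously, known only modulo Z at the circle indices. *)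
pose C : set 'rV[R]_k := [set z | exists g, forall i : 'I_k,
  if tau i then z 0 i = v i g else circle_pi (z 0 i) = circle_pi (v i g)].
have C0 : C 0.
  exists 0 => i; rewrite mxE; case: ifP => ti; first by rewrite -(WE i ti) chom0.
  by rewrite XvE (chom0 circle_pi) (chom0 (X i)).
have CB x y : C x -> C y -> C (x - y).
  move=> [g gx] [h hy]; exists (g - h) => i; rewrite !mxE.
  have := gx i; have := hy i; case: ifP => ti.
    by rewrite -!(WE i ti) chomB => -> ->.
  rewrite (chomB circle_pi) => -> ->.
  by rewrite !XvE -chomB.
have [|P [t0 [Pu Pt _]]] := closed_subgroup_coordinates (row_closure0 C0)
    (row_closureB CB) (@row_closure_cvg _ _ C)
    (k := 0) (v := fun=> 0) (tau := fun=> false).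
  by split=> [x _ i //|x]; rewrite /lin big_ord0; split=> // _; exact: row_closure0.
suff t0E i : t0 i = Some true.
  have : row_closure C (\row_i t i) by apply/Pt => i; rewrite t0E.
  move=> /(_ e e0)[w [g gw] tw]; exists g => i.
  have := tw i; have := gw i; rewrite mxE; case: ifP => _; first by move=> <-.
  move=> wE; apply: le_lt_trans; rewrite chomB -wE -chomB; exact: crep_le.
apply: contrapT => ti.
(* If the closure of [C] is not free in the direction [i], the corresponding linear form takes
   integer values on [C]. *)
have integral z : C z -> (z *m P) 0 i \is a Num.int.
  move=> /subset_row_closure/Pt/(_ i); rewrite /coord_ok.
  by case: (t0 i) ti => [[]|] // _ ->; rewrite rpred0.
pose p j : R := if insub j is Some j' then P j' i else 0.
have pE (j : 'I_k) : p j = P j i by rewrite /p valK.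
have linE g : lin k v p g = ((\row_j v j g) *m P) 0 i.
  rewrite /lin fct_sumE mxE; apply: eq_bigr => j _; rewrite mxE pE mulrC.
  by [].
(* At a circle index the unit vector is in [C], with [g = 0], so the coefficient is an integer and
   adaptedness puts the combination in [M]. Its values being integers, it lifts the zero character,
   so all its coefficients vanish by independence, against the invertibility of [P]. *)
have [chi _ chiE] : M (lin k v p).
  apply/kvt.2 => j jk; case tj : (tau j) => //=.
  have -> : p j = ((delta_mx 0 (Ordinal jk) : 'rV[R]_k) *m P) 0 i.
    by rewrite -rowE mxE -pE.
  apply: integral; exists 0 => l; rewrite mxE eqxx andTb; case: ifP => tl.
    by rewrite -(WE l tl) chom0; case: eqVneq => // lj; rewrite lj tj in tl.
  rewrite XvE (chom0 (X l)); apply/circle_pi_eq0.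
  by case: (_ == _); rewrite ?rpred0 ?rpred1.
have chi0 : chi = 0.
  apply: chom_ext => g; rewrite -(circle_pi_lift incP) chiE.
  rewrite chom_zeroE.
  apply/circle_pi_eq0; rewrite linE; apply: integral; exists g => j.
  by rewrite mxE; case: ifP.
have p0 : forall j, (j < k)%N -> p j = 0.
  by apply: kvt.1; rewrite -chiE chi0 raddf0.
have /matrixP/(_ i i)/eqP := mulVmx Pu; rewrite !mxE eqxx big1 ?(eq_sym 0) ?oner_eq0 //.
by move=> j _; rewrite -pE p0 ?mulr0.
Qed.

End Density.
End Classification.

Definition coordinate_size {R : realType} (t : bool) (c : R) : R :=
  if t then `|c| else `|crep (circle_pi c)|.

Lemma coordinate_sizeB {R : realType} t (a b : R) :
  coordinate_size t (a - b) <= coordinate_size t a + coordinate_size t b.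
Proof.
rewrite /coordinate_size; case: t; first exact: ler_normB.
rewrite (chomB circle_pi) -(crep_normN (circle_pi b)); exact: crep_triangle.
Qed.

Section Coordinates.
Context {R : realType} {G : topologicalZmodType} (inc : G -> nat -> nat -> G).
Hypotheses (incP : dyadic_increments inc).
Local Notation T := (circle R).
Local Notation lift := (@lift R G inc incP).
Local Notation M := (range lift).

(** A countable base at 0 and finitely many characters for each of its members leave countably many
    lifts, which [adapted_sequence] absorbs one by one. *)
Lemma character_basis : proLiePAb R G ->
  exists (K : nat -> nat) (v : nat -> G -> R^o) (tau : nat -> bool),
  [/\ forall j, adapted M (K j) v tau, forall j, (K j <= K j.+1)%N &
      forall U : set G, nbhs 0 U -> exists (s : seq (chom G T)) (e : R),
        [/\ 0 < e, forall g, (forall chi, chi \in s ->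
                     character_size incP chi g < e) -> U g &
            forall chi, chi \in s -> exists J x, lin (K J) v x = lift chi]].
Proof.
move=> hG; have [_ [B B0 BU] _ _] := (polish_groupP R G).1 hG.1.
have /choice[se seP] n : exists se : seq (chom G T) * R, 0 < se.2 /\
    forall g, (forall chi, chi \in se.1 -> character_size incP chi g < se.2) -> B n g.
  by have [s [e e0 se]] := lie_characters incP hG (B0 n); exists (s, e).
pose chi k : chom G T := let: (n, j) := odflt (0, 0)%N (unpickle k) in nth 0 (se n).1 j.
have M0 : M 0 by exists (0 : chom G T) => //; exact: raddf0.
have MB x y : M x -> M y -> M (x - y).
  by move=> [a _ <-] [b _ <-]; exists (a - b : chom G T) => //; exact: raddfB.
have Mchi k : M (lift (chi k)) by exists (chi k).
have [K [v [tau [kvt Kle sp]]]] :=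
  adapted_sequence M0 MB (@lift_span_closed _ _ _ incP hG.1.2) Mchi.
exists K, v, tau; split=> // U /BU[n nU]; exists (se n).1, (se n).2; split.
- by have [] := seP n.
- by move=> g gs; apply: nU; have [_] := seP n; exact.
- move=> psi psis; exists (pickle (n, index psi (se n).1)).+1.
  have [x xE] := sp (pickle (n, index psi (se n).1)); exists x.
  by rewrite xE /chi pickleK /= nth_index.
Qed.

(** The coefficients of [lift chi] at circle indices are integers, so replacing [v i g] there by its
    representative changes the sum by an integer. If [chi] is real these coefficients vanish:
    otherwise a multiple of [lift chi] in [M] would have the coefficient [2^-1] at such an index. *)
Lemma adapted_character_size k (v : nat -> G -> R^o) tau chi x (e : R) :
  adapted M k v tau -> lin k v x = lift chi -> 0 < e ->
  exists2 d : R, 0 < d & forall g,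
    (forall i, (i < k)%N -> coordinate_size (tau i) (v i g) < d) ->
    character_size incP chi g < e.
Proof.
move=> kvt xE e0; pose s i g : R := if tau i then v i g else crep (circle_pi (v i g)).
have sE i g : coordinate_size (tau i) (v i g) = `|s i g|.
  by rewrite /coordinate_size /s; case: (tau i).
have xZ i : (i < k)%N -> tau i || (x i \is a Num.int).
  by move: i; apply/kvt.2; exists chi.
have S0 : 0 <= \sum_(i < k) `|x i| by apply: sumr_ge0.
exists (e / (1 + \sum_(i < k) `|x i|)); first by rewrite divr_gt0 // ltr_pwDl.
move=> g gs; have small : `|\sum_(i < k) x i * s i g| < e.
  apply: le_lt_trans (ler_norm_sum _ _ _) _.
  apply: (@le_lt_trans _ _ ((\sum_(i < k) `|x i|) * (e / (1 + \sum_(i < k) `|x i|)))).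
    rewrite mulr_suml; apply: ler_sum => i _; rewrite normrM ler_wpM2l //.
    by rewrite -sE ltW // gs.
  rewrite mulrCA gtr_pMr // ltr_pdivrMr ?ltr_pwDl // mul1r; lra.
have liftE : lift chi g = \sum_(i < k) x i * v i g by rewrite -xE /lin fct_sumE.
rewrite /character_size; case: asboolP => [chi_real|_].
  rewrite liftE (_ : \sum_(i < k) _ = \sum_(i < k) x i * s i g) //.
  apply: eq_bigr => i _; rewrite /s; case ti : (tau i) => //.
  have [->|xi0] := eqVneq (x i) 0; first by rewrite !mul0r.
  have [psi psiE] := chi_real (2^-1 / x i).
  have /kvt.2/(_ i (ltn_ord i)) : M (lin k v (fun j => 2^-1 / x i * x j)).
    by rewrite linZ xE -psiE; exists psi.
  rewrite ti divfK //= => /int_lt1; rewrite gtr0_norm ?invr_gt0 // invf_lt1 ?ltr1n //.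
  by move=> /(_ isT)/eqP; rewrite invr_eq0 pnatr_eq0.
rewrite -(circle_pi_lift incP) liftE.
rewrite (_ : circle_pi _ = circle_pi (\sum_(i < k) x i * s i g)); last first.
  apply/circle_pi_eq; rewrite -sumrB; apply: rpred_sum => i _.
  rewrite -mulrBr /s; case ti : (tau i); first by rewrite subrr mulr0 rpred0.
  have := xZ i (ltn_ord i); rewrite ti => xi; apply: rpredM => //.
  by apply/circle_pi_eq; rewrite crepK.
exact: le_lt_trans (crep_le _) small.
Qed.

End Coordinates.

Lemma nbhs0_coordinate_size {R : realType} {G : topologicalZmodType}
    (t : bool) (f : G -> R) (w : chom G R) (x : chom G (circle R)) (e : R) :
  (t -> forall g, w g = f g) -> (forall g, circle_pi (f g) = x g) -> 0 < e ->
  nbhs 0 [set g | coordinate_size t (f g) < e].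
Proof.
move=> wE xE e0; rewrite /coordinate_size; case: t wE => [/(_ isT) wE|_].
  have := nbhs0_preimage w (nbhsx_ballx (0 : R) _ e0).
  apply: filterS => g; rewrite /preimage /ball /= sub0r normrN.
  by rewrite wE.
have := nbhs0_preimage x (nbhs0_crep e0).
by apply: filterS => g; rewrite /preimage /mkset -xE.
Qed.

Section CoordinateFilter.
Context {R : realType} {G : topologicalZmodType} (K : nat -> nat)
  (size : nat -> G -> R).
Hypothesis Kle : forall j, (K j <= K j.+1)%N.

(** It is used twice: with the sizes of the coordinates, to compare with the neighborhoods of 0, and
    with the distances to prescribed coordinates, as the filter of approximate solutions. *)
Definition coordinate_filter : set_system G := [set A | exists J,
  exists2 e : R, 0 < e & forall g, (forall i, (i < K J)%N -> size i g < e) -> A g].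

Lemma coordinate_filter_filter : Filter coordinate_filter.
Proof.
have Kmono : {homo K : m n / (m <= n)%N} := homo_leq leqnn leq_trans Kle.
split=> [|A B [J [e e0 JA]] [L [d d0 LB]]|A B AB [J [e e0 JA]]].
- by exists 0%N, 1.
- exists (maxn J L), (Num.min e d); first by rewrite lt_min e0.
  move=> g gs; split; [apply: JA|apply: LB] => i iK.
    by have := gs i; rewrite lt_min => /(_ _)/andP[]//; apply: leq_trans iK _;
      apply: Kmono; exact: leq_maxl.
  by have := gs i; rewrite lt_min => /(_ _)/andP[]//; apply: leq_trans iK _;
    apply: Kmono; exact: leq_maxr.
- by exists J, e => // g /JA/AB.
Qed.

End CoordinateFilter.

Section PathConnected.
Context {R : realType} {G : topologicalZmodType}.
Local Notation T := (circle R).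

Lemma path_connected_power : proLiePAb R G -> path_connected R G ->
  exists alpha beta : option nat,
    isomorphic G (dsum (power (ordinal_le_omega alpha) R)
                       (power (ordinal_le_omega beta) T)).
Proof.
move=> hG /path_increments[inc incP].
have [Gh _ Gc _] := (polish_groupP R G).1 hG.1.
have [K [v [tau [kvt Kle sp]]]] := character_basis incP hG.
have Kmono : {homo K : m n / (m <= n)%N} := homo_leq leqnn leq_trans Kle.
(* [K] may be bounded; only the indices reached at some stage are coordinates. *)
pose used i := exists J, (i < K J)%N.
have /choice[X XE] i : exists chi, used i -> @lift R G inc incP chi = v i.
  have [[J iJ]|nu] := pselect (used i); last by exists 0.
  by have [chi _ <-] := adapted_mem (kvt J) iJ; exists chi.
have {}XE i g : used i -> circle_pi (v i g) = X i g.
  by move=> /XE <-; exact: circle_pi_lift.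
have /choice[W WE] i : exists w : chom G R,
    used i -> tau i -> forall g, w g = v i g.
  have [[J iJ]|nu] := pselect (used i); last by exists 0.
  case ti : (tau i); last by exists 0.
  have /choice[chi chiE] c : exists chi, @lift R G inc incP chi = c *: v i.
    by have [chi _ <-] := adapted_line c (kvt J) iJ ti; exists chi.
  have [|w wE] := lift_continuous hG.1.2 (v := v i) (chi := chi); last by exists w.
  by move=> c g; rewrite -(circle_pi_lift incP) chiE.
pose size i g := coordinate_size (tau i) (v i g).
have sizeB i g h : used i ->
    coordinate_size (tau i) (v i (g - h)) = coordinate_size (tau i) (v i g - v i h).
  move=> ui; rewrite /coordinate_size; case: ifP => ti; first by rewrite -!WE // chomB.
  by rewrite XE // chomB -!XE // -chomB.
have basis U : nbhs 0 U -> coordinate_filter K size U.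
  move=> /sp[s [e [e0 sU sK]]].
  have FF := coordinate_filter_filter size Kle.
  suff : coordinate_filter K size (fun g => forall chi, chi \in s ->
      character_size incP chi g < e).
    by apply: filterS => g; exact: sU.
  have : forall i : 'I_(seq.size s), coordinate_filter K size
      [set g | character_size incP (nth 0 s i) g < e].
    move=> i; have [J [x xE]] := sK _ (mem_nth 0 (ltn_ord i)).
    have [d d0 dP] := adapted_character_size (kvt J) xE e0.
    by exists J, d.
  move=> /(filter_forall (F := coordinate_filter K size)).
  apply: filterS => g gs chi chis.
  have ix : (index chi s < seq.size s)%N by rewrite index_mem.
  by have := gs (Ordinal ix); rewrite /= nth_index.
have [alpha [f [f_inj fE]]] := range_enumeration [set i | used i /\ tau i].
have [beta [f' [f'_inj f'E]]] := range_enumeration [set i | used i /\ ~~ tau i].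
have fP a : used (f a) /\ tau (f a).
  by have : range f (f a) by []; rewrite fE.
have f'P b : used (f' b) /\ ~~ tau (f' b).
  by have : range f' (f' b) by []; rewrite f'E.
exists alpha, beta.
pose Phi := chom_pair (chom_power (fun a => W (f a))) (chom_power (fun b => X (f' b))).
have Phi1 g a : (Phi g).1 a = v (f a) g by apply: WE; have [] := fP a.
have Phi2 g b : (Phi g).2 b = circle_pi (v (f' b) g).
  by apply/esym/XE; have [] := f'P b.
have size_lt y g i e : used i -> Phi g = y ->
    (forall a, f a = i -> `|y.1 a| < e) ->
    (forall b, f' b = i -> `|crep (y.2 b)| < e) -> size i g < e.
  move=> ui <- y1 y2; rewrite /size /coordinate_size; case: ifP => ti.
    have [a _ fa] : range f i by rewrite fE.
    by have := y1 a fa; rewrite Phi1 fa.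
  have [b _ fb] : range f' i by rewrite f'E; split=> //; rewrite ti.
  by have := y2 b fb; rewrite Phi2 fb.
have Phi_inj g : Phi g = 0 -> g = 0.
  move=> g0; apply: hausdorff_nbhs0 Gh _ => U /basis[J [e e0 JU]].
  apply: JU => i iJ; apply: (size_lt _ _ _ _ _ g0); first by exists J.
    by move=> a _; rewrite normr0.
  by move=> b _; rewrite /= (_ : (0 : power _ _) b = 0) // crep0 normr0.
have Phi_surj y : exists g, Phi g = y.
  have /choice[t tE] i : exists c : R, (forall a, f a = i -> c = y.1 a) /\
      (forall b, f' b = i -> circle_pi c = y.2 b).
    have [[a fa]|na] := pselect (exists a, f a = i).
      exists (y.1 a); split=> [a' fa'|b f'b].
        by congr (y.1 _); apply: f_inj; rewrite fa.
      by have [_] := fP a; have [_] := f'P b; rewrite fa f'b => /negP.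
    have [[b fb]|nb] := pselect (exists b, f' b = i).
      have [c cE] := circle_pi_surj (y.2 b); exists c; split=> [a fa|b' fb'].
        by case: na; exists a.
      by rewrite cE; congr (y.2 _); apply: f'_inj; rewrite fb.
    by exists 0; split=> [a fa|b fb]; [case: na; exists a|case: nb; exists b].
  (* The approximate solutions form a proper filter by [adapted_dense] and a Cauchy filter because
     the coordinates control the neighborhoods of 0; its limit has exactly the prescribed
     coordinates. *)
  pose near_t i g := coordinate_size (tau i) (t i - v i g).
  pose H := coordinate_filter K near_t.
  have HF : ProperFilter H.
    apply: Build_ProperFilter_ex; last exact: coordinate_filter_filter.
    move=> A [J [e e0 JA]].
    have [g gt] := adapted_dense hG.1.2 (kvt J) (fun i => t i) e0.
    exists g; apply: JA => i iJ; have := gt (Ordinal iJ).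
    by rewrite /near_t /coordinate_size /=; case: (tau i).
  have near_close i g h e : used i -> near_t i g < e / 2 -> near_t i h < e / 2 ->
      coordinate_size (tau i) (v i (g - h)) < e.
    move=> ui ge he; rewrite sizeB //.
    rewrite (_ : v i g - v i h = (t i - v i h) - (t i - v i g)); last first.
      by rewrite opprB [RHS]addrC subrKA.
    apply: le_lt_trans (coordinate_sizeB _ _ _) _.
    by move: ge he; rewrite /near_t; lra.
  have [l Hl] : exists l : G, H --> l.
    apply: Gc; apply/group_cauchyP => U /basis[J [e e0 JU]].
    exists [set g | forall i, (i < K J)%N -> near_t i g < e / 2].
      by exists J, (e / 2); rewrite ?divr_gt0.
    move=> g h gs hs; apply: JU => i iJ.
    by apply: near_close; [exists J|exact: gs|exact: hs].
  have tl i : used i -> coordinate_size (tau i) (t i - v i l) = 0.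
    move=> ui; apply/eqP; rewrite eq_le; apply/andP; split; last first.
      by rewrite /coordinate_size; case: ifP.
    apply/ler_addgt0Pr => e e0; rewrite add0r.
    have e2 : 0 < e / 2 by rewrite divr_gt0.
    have [J iJ] := ui.
    have l0 : nbhs 0 [set g | coordinate_size (tau i) (v i g) < e / 2].
      by apply: nbhs0_coordinate_size (WE i ui) _ e2 => g; exact: XE.
    have Ht : H [set g | near_t i g < e / 2].
      by exists J, (e / 2) => // g; exact.
    have [g [tg gl]] := filter_ex (filterI Ht (Hl _ ((nbhs_shiftB l _).2 l0))).
    rewrite (_ : t i - v i l = (t i - v i g) - (v i l - v i g)); last first.
      by rewrite opprB addrA subrK.
    apply: le_trans (coordinate_sizeB _ _ _) _.
    have : coordinate_size (tau i) (v i l - v i g) < e / 2.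
      move: gl; rewrite /mkset sizeB // /coordinate_size.
      by case: (tau i); [rewrite distrC|rewrite -opprB chomN crep_normN].
    by move: tg; rewrite /mkset /near_t; lra.
  exists l; rewrite [LHS]surjective_pairing [RHS]surjective_pairing.
  congr (_, _); apply/funext.
    move=> a; rewrite Phi1; have [ua ta] := fP a.
    have /eqP := tl _ ua; rewrite /coordinate_size ta normr_eq0 subr_eq0 => /eqP <-.
    by have [ty _] := tE (f a); exact: ty.
  move=> b; rewrite Phi2; have [ub /negbTE tb] := f'P b.
  have /eqP := tl _ ub; rewrite /coordinate_size tb normr_eq0 => /eqP/crep_eq0.
  rewrite chomB => /eqP; rewrite subr_eq0 => /eqP <-.
  by have [_ ty] := tE (f' b); exact: ty.
(* Openness uses surjectivity: a point of a small box has a preimage with small coordinates, and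
   such an element is in [U]. *)
apply: (isomorphic_bij _ Phi_surj Phi_inj) => U /basis[J [e e0 JU]].
pose D : topologicalZmodType :=
  dsum (power (ordinal_le_omega alpha) R) (power (ordinal_le_omega beta) T).
pose B (i : 'I_(K J)) : set D := [set y | (forall a, f a = i -> `|y.1 a| < e) /\
  (forall b, f' b = i -> `|crep (y.2 b)| < e)].
have B0 i : nbhs 0 (B i).
  apply: filterI.
    have [[a fa]|na] := pselect (exists a, f a = i); last first.
      by apply: filterE => y a fa; case: na; exists a.
    apply: (@filterS _ (nbhs (0 : D)) _ _ _ _ (nbhs0_preimage
      (precomp R chom_fst (power_eval a)) (nbhsx_ballx (0 : R) _ e0))) => y.
    rewrite /preimage /ball /= sub0r normrN => ya a' fa'.
    by rewrite (_ : a' = a) //; apply: f_inj; rewrite fa.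
  have [[b fb]|nb] := pselect (exists b, f' b = i); last first.
    by apply: filterE => y b fb; case: nb; exists b.
  apply: (@filterS _ (nbhs (0 : D)) _ _ _ _ (nbhs0_preimage
    (precomp T chom_snd (power_eval b)) (nbhs0_crep e0))) => y yb b' fb'.
  by rewrite (_ : b' = b) //; apply: f'_inj; rewrite fb.
have Ball := filter_forall (nbhs_filter (0 : D)) B0.
apply: (@filterS _ (nbhs (0 : D)) _ _ _ _ Ball) => y yP.
have [g gy] := Phi_surj y; exists g => //.
apply: JU => i iJ; have [y1 y2] := yP (Ordinal iJ).
by apply: (size_lt y) gy y1 y2; exists J.
Qed.

End PathConnected.

Theorem theorem3p57 (R : realType) (G : topologicalZmodType)
    (hG : proLiePAb R G) :
  [<-> injective_object R G;
       exists alpha beta : option nat,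
         isomorphic G (dsum (power (ordinal_le_omega alpha) R)
                            (power (ordinal_le_omega beta) (circle R)));
       path_connected R G;
       Ext_eq0 R (circle R) G].
Proof.
tfae.
(* The goals follow the order of the statement while the arguments go from (1) to (4), (3), (2) and
   back to (1); hence the compositions, and the direct construction of paths for the second goal. *)
- move=> /injective_Ext_eq0 GE; apply: path_connected_power => //.
  exact: Ext_path_connected.
- by move=> [alpha [beta]]; exact: power_path_connected.
- move=> /(path_connected_power hG)[alpha [beta Giso]].
  exact: injective_Ext_eq0 (power_injective hG Giso).
- move=> /(Ext_path_connected hG)/(path_connected_power hG)[alpha [beta]].
  exact: power_injective.
Qed.
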